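(* Let $n \geq 2$, let $m \geq 2$ be even and let $k_1,\dots,k_n \in \mathbb{Z}$ be coprime to $m$. Let $$\varphi \colon \mathbb{C}^n \to \mathbb{C}^n, \qquad \varphi(z^1,\dots,z^n) := \big(e^{2\pi i k_1/m}z^1,\dots,e^{2\pi i k_n/m}z^n\big).$$ Let $\Sigma \subseteq \mathbb{C}^n$ be a compact and connected star-shaped hypersurface with $\varphi(\Sigma) = \Sigma$. Then the quotient contact manifold $\Sigma/\mathbb{Z}_m$ (where $\mathbb{Z}_m$ acts via $[k]\cdot z = \varphi^k(z)$) admits a noncontractible periodic Reeb orbit.
   Context: $\mathbb{C}^n$ carries the standard Liouville form $\lambda = \frac{1}{2}\sum_{j=1}^n (y^j dx^j - x^j dy^j)$, $z^j = x^j + i y^j$, with symplectic form $d\lambda$ and Liouville vector field $X = \frac12\sum_j (x^j\partial_{x^j} + y^j\partial_{y^j})$. A star-shaped hypersurface is the boundary of a compact domain which is star-shaped with respect to the origin and whose boundary is transverse to the radial (Liouville) vector field; then $\lambda|_\Sigma$ is a contact form. Since $\varphi^*\lambda = \lambda$ and the $\mathbb{Z}_m$-action on $\Sigma$ is free, $\lambda|_\Sigma$ descends to a contact form on the smooth manifold $\Sigma/\mathbb{Z}_m$. The Reeb vector field $R$ of a contact form $\alpha$ is defined by $i_R d\alpha = 0$, $\alpha(R) = 1$; a periodic Reeb orbit is a nonconstant closed orbit of its flow, and noncontractible means not freely null-homotopic in $\Sigma/\mathbb{Z}_m$. *)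

(* Defs.v *)
From HB Require Import structures.
From mathcomp Require Import all_boot all_order all_algebra generic_quotient.
From mathcomp Require Import all_classical all_reals all_analysis.
From mathcomp Require Import ring lra.
Set Implicit Arguments. Unset Strict Implicit. Unset Printing Implicit Defensive.
Import Order.TTheory GRing.Theory Num.Theory.
Import numFieldNormedType.Exports.
Local Open Scope classical_set_scope.
Local Open Scope ring_scope.
Local Open Scope quotient_scope.

Section Defs.
Variables (R : realType) (n : nat).

(* C^n with real coordinates: a point p = (x, y), z^j = x^j + i y^j *)
Definition Cn := ('rV[R]_n * 'rV[R]_n)%type.

Definition xc (p : Cn) (j : 'I_n) : R := p.1 ord0 j.
Definition yc (p : Cn) (j : 'I_n) : R := p.2 ord0 j.

Definition liouville (p v : Cn) : R :=
  2^-1 * \sum_(j < n) (yc p j * xc v j - xc p j * yc v j).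

Definition dliouville (u v : Cn) : R :=
  \sum_(j < n) (yc u j * xc v j - xc u j * yc v j).

Definition liouville_field (p : Cn) : Cn := 2^-1 *: p.

Fixpoint Dseq (vs : seq Cn) (f : Cn -> R) : Cn -> R :=
  match vs with
  | [::] => f
  | v :: vs' => fun x => 'D_v (Dseq vs' f) x
  end.

Definition smooth (f : Cn -> R) : Prop :=
  forall (vs : seq Cn) (x : Cn), differentiable (Dseq vs f) x.

Definition smooth_hypersurface (S : set Cn) : Prop :=
  forall p, S p -> exists (U : set Cn) (F : Cn -> R),
    [/\ open U, U p, smooth F,
        (forall q, U q -> (S q <-> F q = 0)) &
        exists v, 'D_v F p != 0].

Definition tangent (S : set Cn) (p v : Cn) : Prop :=
  exists g : R -> Cn, [/\ forall t, S (g t), g 0 = p,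
                          derivable g 0 1 & 'D_1 g 0 = v].

Definition star_shaped_hypersurface (S : set Cn) : Prop :=
  exists D : set Cn,
    [/\ compact D, D 0,
        (forall p t, D p -> 0 <= t <= 1 -> D (t *: p)),
        S = closure D `\` interior D &
        smooth_hypersurface S /\
        forall p, S p -> ~ tangent S p (liouville_field p)].

Definition reeb_vector (S : set Cn) (p r : Cn) : Prop :=
  [/\ tangent S p r, liouville p r = 1 &
      forall w, tangent S p w -> dliouville r w = 0].

Definition reeb_trajectory (S : set Cn) (g : R -> Cn) : Prop :=
  forall t, S (g t) /\ derivable g t 1 /\ reeb_vector S (g t) ('D_1 g t).

Definition rot_angle (m : nat) (k : 'I_n -> int) (j : 'I_n) : R :=
  2 * pi * (k j)%:~R / m%:R.

Definition rotate (a : 'I_n -> R) (p : Cn) : Cn :=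
  (\row_j (cos (a j) * xc p j - sin (a j) * yc p j),
   \row_j (sin (a j) * xc p j + cos (a j) * yc p j)).

Definition phi (m : nat) (k : 'I_n -> int) : Cn -> Cn := rotate (rot_angle m k).

Definition orbit_rel (m : nat) (k : 'I_n -> int) : rel Cn :=
  fun p q => `[< exists j : nat, q = iter j (phi m k) p >].

Lemma iter_phi m k j p :
  iter j (phi m k) p = rotate (fun l => j%:R * rot_angle m k l) p.
Proof.
elim: j => [|j IH] /=.
  rewrite /rotate; case: p => x y /=; congr pair; apply/rowP => l;
  rewrite !mxE /xc /yc /= mul0r cos0 sin0; ring.
rewrite IH /phi /rotate /xc /yc /=; congr pair; apply/rowP => l;
rewrite !mxE -natr1 mulrDl mul1r cosD sinD; ring.
Qed.

Lemma cos_sin_2piZ (z : int) : cos (2 * pi * z%:~R) = 1 :> R /\ sin (2 * pi * z%:~R) = 0 :> R.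
Proof.
have pos : forall N : nat, cos (2 * pi * N%:R) = 1 :> R /\ sin (2 * pi * N%:R) = 0 :> R.
  elim=> [|N [c s]]; first by rewrite mulr0n mulr0 cos0 sin0; split.
  have -> : 2 * pi * N.+1%:R = 2 * pi * N%:R + pi *+ 2 :> R.
    by rewrite -addn1 natrD; ring.
  by rewrite cosD2pi sinD2pi.
case: z => N; first by rewrite pmulrn; exact: pos.
have -> : (Negz N)%:~R = - (N.+1%:R) :> R by rewrite NegzE mulrNz.
by rewrite mulrN cosN sinN (pos N.+1).1 (pos N.+1).2 oppr0.
Qed.

Lemma phi_period m k : exists N : nat, (0 < N)%N /\ iter N (phi m k) =1 id.
Proof.
case: m => [|m].
  exists 1%N; split => // p; rewrite iter_phi /rotate /rot_angle.
  case: p => x y; congr pair; apply/rowP => l;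
  rewrite !mxE /xc /yc mulr0n invr0 !mulr0 cos0 sin0 /=; ring.
exists m.+1; split => // p; rewrite iter_phi /rotate.
case: p => x y; congr pair; apply/rowP => l; rewrite !mxE /xc /yc /=;
(have -> : m.+1%:R * rot_angle m.+1 k l = 2 * pi * (k l)%:~R
  by rewrite /rot_angle [LHS]mulrC divfK // pnatr_eq0);
rewrite (cos_sin_2piZ (k l)).1 (cos_sin_2piZ (k l)).2; ring.
Qed.

Lemma orbit_rel_equiv m k : equivalence_rel (orbit_rel m k).
Proof.
have [N [N0 HN]] := phi_period m k.
have idk : forall t p0, iter (t * N) (phi m k) p0 = p0.
  by elim=> [|t IH] p0 //; rewrite mulSn iterD IH HN.
move=> p q r; rewrite /orbit_rel; split.
  by apply/asboolP; exists 0%N.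
move/asboolP => [j ->]; apply/asboolP/asboolP => -[i Hi].
- exists (i + j * N.-1)%N.
  rewrite Hi -iterD -addnA -mulnSr prednK // addnC iterD idk //.
- by exists (i + j)%N; rewrite iterD Hi.
Qed.

Lemma orbit_rel_class m k : equiv_class_of (orbit_rel m k).
Proof.
have H := orbit_rel_equiv m k.
have refl : reflexive (orbit_rel m k) by move=> x; exact: (H x x x).1.
have sym : symmetric (orbit_rel m k).
  by move=> x y; apply/idP/idP => hxy; [rewrite -((H x y x).2 hxy) | rewrite -((H y x y).2 hxy)].
split => //.
by move=> y x z hxy; rewrite ((H x y z).2 hxy).
Qed.

Canonical orbit_equiv m k := EquivRelPack (orbit_rel_class m k).

Definition Cn_mod (m : nat) (k : 'I_n -> int) :=
  quotient_topology {eq_quot orbit_equiv m k}.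

Definition zm_proj (m : nat) (k : 'I_n -> int) : Cn -> Cn_mod m k :=
  fun p => \pi_(Cn_mod m k) p.

Definition freely_nullhomotopic_in {Q : topologicalType} (A : set Q)
    (T : R) (c : R -> Q) : Prop :=
  exists H : R * R -> Q,
    [/\ {within `[0, 1] `*` `[0, T], continuous H},
        forall t s, t \in `[0, 1] -> s \in `[0, T] -> A (H (t, s)),
        forall s, s \in `[0, T] -> H (0, s) = c s,
        forall s, s \in `[0, T] -> H (1, s) = H (1, 0) &
        forall t, t \in `[0, 1] -> H (t, 0) = H (t, T)].

End Defs.

(* Main.v *)
Require Import Defs.
From HB Require Import structures.
From mathcomp Require Import all_boot all_order all_algebra generic_quotient.
From mathcomp Require Import all_classical all_reals all_analysis.
From mathcomp Require Import ring lra zify.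
Import Order.TTheory GRing.Theory Num.Theory.
Import numFieldNormedType.Exports.
Local Open Scope classical_set_scope.
Local Open Scope ring_scope.
Set Implicit Arguments. Unset Strict Implicit. Unset Printing Implicit Defensive.

(* Since [m] is even and every [k j] is odd, [phi^(m/2) = -1]; hence [Sigma = - Sigma],
   and it suffices to find a Reeb trajectory with [g T = - g 0], because such an arc
   projects to a loop whose class in the deck group is the nontrivial element [m/2].

   Let [H] be the square of the gauge of [Sigma]: it is [C^1], even and 2-homogeneous.
   Antiperiodic solutions of [z' = lam J grad H (z)] are the critical points, with
   critical value [lam], of the quotient of the action by the integral of [H].  We discretise:
   on sequences [(x_i, y_i)] with [x_(i+N) = - x_i], [y_(i+N) = - y_i] the action becomes
   [N * sum y_i (x_(i+1) - x_i)].  It vanishes on [y = 0] and is bounded by a multiple,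
   independent of [N], of the energy on the span of [x = 0] and one sawtooth.
   By Borsuk-Ulam these two subspaces link under odd deformations, so there is
   a critical value in an interval independent of [N].  The critical sequences are
   uniformly Lipschitz and converge along an ultrafilter to a solution; its [lam] is
   nonzero since constant antiperiodic curves vanish. *)

(** * Borsuk-Ulam by mod 2 chains *)

(** The action on antiperiodic loops is strongly indefinite; sampling makes all directions finite
    dimensional, so that the link becomes a count of dimensions. Pushing values below zero already
    contradicts the link, which is why the coarse window from [-1] to a uniform bound is enough: the
    limit needs [lam] bounded and nothing about its sign, the period being its absolute value. A
    limit could still be trivial, so each critical sequence is scaled to sup norm one and shifted to
    attain this norm at index 0. On the quotient side, a homotopy is lifted by hand on a grid; lifts
    over one point are uniformly separated, so closeness of two lifts of the same point means
    equality and errors do not accumulate. *)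

Section Chains.
Variables (R : realType) (V : normedModType R).
Implicit Types (a : seq V -> bool) (c : seq (seq V)) (s : seq V).

(* A mod 2 chain is a list of ordered simplices; two chains are equal when all
   mod 2 cochains take the same value on them. *)
Definition eval a c : bool := \big[addb/false]_(s <- c) a s.

Lemma eval_cat a c1 c2 : eval a (c1 ++ c2) = eval a c1 (+) eval a c2.
Proof. exact: big_cat. Qed.

Lemma eval_cons a s c : eval a (s :: c) = a s (+) eval a c.
Proof. exact: big_cons. Qed.

Lemma eval_map a (f : seq V -> seq V) c : eval a (map f c) = eval (a \o f) c.
Proof. exact: big_map. Qed.

Lemma eval_flatten a (f : seq V -> seq (seq V)) c :
  eval a (flatten (map f c)) = eval (fun s => eval a (f s)) c.
Proof. by rewrite /eval big_flatten big_map. Qed.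

Lemma eval_addb a a' c :
  eval (fun s => a s (+) a' s) c = eval a c (+) eval a' c.
Proof. exact: big_split. Qed.

Lemma eq_eval_in a a' c : {in c, a =1 a'} -> eval a c = eval a' c.
Proof. by move=> h; apply: eq_big_seq. Qed.

Lemma eval_andl (t : bool) a c : eval (fun s => t && a s) c = t && eval a c.
Proof. by case: t => //; rewrite /eval big1_eq. Qed.

(** The only face of a vertex is the empty simplex, so the complex is augmented; cones, subdivisions
    and the cross-polytope can all start from [[::]]. *)
Fixpoint faces s : seq (seq V) :=
  if s is v :: s' then s' :: map (cons v) (faces s') else [::].

Definition boundary c := flatten (map faces c).

Lemma eval_boundary a c : eval a (boundary c) = eval (fun s => eval a (faces s)) c.
Proof. exact: eval_flatten. Qed.

Lemma eval_boundary_cone a b c :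
  eval a (boundary (map (cons b) c)) =
  eval a c (+) eval (a \o cons b) (boundary c).
Proof.
rewrite eval_boundary eval_map eval_boundary -eval_addb.
by apply: eq_bigr => s _ /=; rewrite eval_cons eval_map.
Qed.

Lemma eval_boundary_faces a s : eval a (boundary (faces s)) = false.
Proof.
elim: s a => [|v s IH] a; first exact: big_nil.
rewrite /boundary /= eval_cat -/(boundary _) eval_boundary_cone IH.
by rewrite addbF addbb.
Qed.

Lemma size_faces s f : f \in faces s -> (size f).+1 = size s.
Proof.
elim: s f => //= v s IH f; rewrite inE => /orP[/eqP->//|/mapP[g gs ->]] /=.
by rewrite IH.
Qed.

Lemma mem_faces s f : f \in faces s -> {subset f <= s}.
Proof.
elim: s f => //= v s IH f; rewrite inE => /orP[/eqP->|/mapP[g gs ->]] u us.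
  by rewrite inE us orbT.
move: us; rewrite !inE => /orP[->//|/(IH _ gs) ->]; exact: orbT.
Qed.

Lemma faces_map (f : V -> V) s : faces (map f s) = map (map f) (faces s).
Proof. by elim: s => //= v s ->; rewrite -!map_comp. Qed.

Definition barycenter s : V := (size s)%:R^-1 *: \sum_(v <- s) v.

(** Barycentric subdivision, as the cone from the barycenter over the subdivided boundary. Faces are
    not structural subterms, so the recursion runs on [k], meant to be the number of vertices. *)
Fixpoint subdiv k s : seq (seq V) :=
  if k is k'.+1
  then map (cons (barycenter s)) (flatten (map (subdiv k') (faces s)))
  else [:: s].

Lemma size_subdiv k s t : size s = k -> t \in subdiv k s -> size t = k.
Proof.
elim: k s t => [|k IH] s t sk /=; first by rewrite inE => /eqP ->.
move=> /mapP[u /flatten_mapP[f fs uf] ->] /=; congr S.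
by apply: (IH f) => //; apply: succn_inj; rewrite (size_faces fs).
Qed.

(** Subdivision is a chain map: the boundary of a cone is its base plus the cone over the boundary
    of the base. Here the base is the subdivided boundary of [s], and by induction its own boundary
    subdivides a boundary of a boundary, hence vanishes. *)
Lemma eval_boundary_subdiv a k s : size s = k.+1 ->
  eval a (boundary (subdiv k.+1 s)) = eval (eval a \o subdiv k) (faces s).
Proof.
elim: k a s => [|k IH] a s sk.
  case: s sk => [|v [|w s]] sk //.
  by rewrite /boundary /eval /= !big_cons !big_nil !addbF.
rewrite [subdiv _ _]/= eval_boundary_cone.
set X := flatten _; rewrite [X in _ (+) X](_ : _ = false); last first.
  rewrite eval_boundary eval_flatten.
  transitivity (eval (fun f => eval (eval (a \o cons (barycenter s)) \o subdiv k)
     (faces f)) (faces s)).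
    apply: eq_eval_in => f fs /=; rewrite -eval_boundary IH //.
    by apply: succn_inj; rewrite (size_faces fs).
  by rewrite -eval_boundary eval_boundary_faces.
by rewrite addbF /X eval_flatten.
Qed.

Lemma barycenter_opp s : barycenter (map -%R s) = - barycenter s.
Proof. by rewrite /barycenter size_map big_map sumrN scalerN. Qed.

Lemma subdiv_opp k s : subdiv k (map -%R s) = map (map -%R) (subdiv k s).
Proof.
elim: k s => //= k IH s; rewrite faces_map barycenter_opp.
have -> : flatten (map (subdiv k) (map (map -%R) (faces s))) =
          map (map -%R) (flatten (map (subdiv k) (faces s))).
  by rewrite map_flatten -!map_comp; congr flatten; apply: eq_map => f /=; rewrite IH.
by rewrite -!map_comp.
Qed.

Definition subdiv_chain k c := flatten (map (subdiv k) c).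

Lemma eval_subdiv_chain a k c :
  eval a (subdiv_chain k c) = eval (eval a \o subdiv k) c.
Proof. exact: eval_flatten. Qed.

Lemma barycenter_ball s (p : V) r : s != [::] ->
  {in s, forall v, `|p - v| <= r} -> `|p - barycenter s| <= r.
Proof.
move=> s0 h; have k0 : 0 < (size s)%:R :> R by rewrite ltr0n lt0n size_eq0.
have -> : p - barycenter s = (size s)%:R^-1 *: \sum_(v <- s) (p - v).
  rewrite sumrB scalerBr; congr (_ - _).
  by rewrite big_const_seq count_predT iter_addr addr0 -[p *+ _]scaler_nat scalerA mulVf
    ?scale1r ?gt_eqF.
rewrite normrZ ger0_norm ?invr_ge0 ?ler0n // ler_pdivrMl //.
apply: le_trans (ler_norm_sum _ _ _) _.
rewrite mulr_natl -[X in _ *+ X]count_predT -iter_addr_0 -big_const_seq.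
rewrite big_seq [leRHS]big_seq; exact: ler_sum.
Qed.

Lemma subdiv_vertices (C : V -> Prop) k s t : size s = k ->
  (forall u : seq V, u != [::] -> {in u, forall v, C v} -> C (barycenter u)) ->
  {in s, forall v, C v} -> t \in subdiv k s -> {in t, forall v, C v}.
Proof.
move=> + hC; elim: k s t => [|k IH] s t sk sC /=.
  by rewrite inE => /eqP ->.
move=> /mapP[u /flatten_mapP[f fs uf] ->] v; rewrite inE => /orP[/eqP->|].
  by apply: hC => //; rewrite -size_eq0 sk.
apply: (IH f) => //; first by apply: succn_inj; rewrite (size_faces fs).
by move=> w /(mem_faces fs); exact: sC.
Qed.

(** In the average of the differences [w - v] the vertex [v] contributes zero, so only [k] of the
    [k + 1] terms count. This is the contraction factor of the mesh. *)
Lemma barycenter_vertex s k v D : size s = k.+1 -> v \in s ->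
  {in s &, forall u w, `|u - w| <= D} ->
  `|barycenter s - v| <= k%:R / k.+1%:R * D.
Proof.
move=> sk vs h.
have -> : barycenter s - v = k.+1%:R^-1 *: \sum_(w <- rem v s) (w - v).
  have -> : \sum_(w <- rem v s) (w - v) = \sum_(w <- s) (w - v).
    by rewrite [RHS](big_rem v vs) /= subrr add0r.
  rewrite sumrB scalerBr /barycenter sk; congr (_ - _).
  by rewrite big_const_seq count_predT iter_addr addr0 -[v *+ _]scaler_nat scalerA sk
     mulVf ?scale1r ?pnatr_eq0.
rewrite normrZ ger0_norm ?invr_ge0 ?ler0n // -mulrA [leRHS]mulrCA.
apply: ler_wpM2l; first by rewrite invr_ge0 ler0n.
apply: le_trans (ler_norm_sum _ _ _) _.
have sr : size (rem v s) = k by rewrite size_rem // sk.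
rewrite mulr_natl -[X in _ *+ X]sr -[X in _ *+ X]count_predT -iter_addr_0 -big_const_seq.
rewrite big_seq [leRHS]big_seq; apply: ler_sum => w /mem_rem ws.
exact: h.
Qed.

Lemma subdiv_mesh k s t D : size s = k.+1 -> t \in subdiv k.+1 s ->
  {in s &, forall u w, `|u - w| <= D} ->
  {in t &, forall u w, `|u - w| <= k%:R / k.+1%:R * D}.
Proof.
elim: k s t D => [|k IH] s t D sk ts h.
  have st := size_subdiv sk ts.
  case: t st ts => [|x [|]] // _ _ u w; rewrite !inE => /eqP -> /eqP ->.
  by rewrite subrr normr0 !mul0r.
move: ts => /mapP[u /flatten_mapP[f fs uf] ->].
have sf : size f = k.+1 by apply: succn_inj; rewrite (size_faces fs).
have D0 : 0 <= D.
  by case: s sk h {fs} => // x s _ h; apply: le_trans (h x x _ _); rewrite ?mem_head.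
(* A closed ball about the barycenter is stable under barycenters, so the bound at the vertices of
   [s] passes to every vertex of the subdivision. *)
have bv v : v \in u -> `|barycenter s - v| <= k.+1%:R / k.+2%:R * D.
  move=> vu; move: v vu; apply: (subdiv_vertices sf _ _ uf).
    by move=> l l0 hl; exact: barycenter_ball.
  by move=> v /(mem_faces fs) vs; exact: barycenter_vertex.
move=> v w; rewrite !inE => /orP[/eqP->|vu] /orP[/eqP->|wu].
- by rewrite subrr normr0 mulr_ge0.
- exact: bv.
- by rewrite distrC; exact: bv.
- apply: (@le_trans _ _ (k%:R / k.+1%:R * D)).
    by apply: (IH f u) => // x y /(mem_faces fs) ? /(mem_faces fs) ?; exact: h.
  apply: ler_wpM2r => //; rewrite ler_pdivrMr ?ltr0n // mulrAC ler_pdivlMr ?ltr0n //.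
  by rewrite -!natrM ler_nat; lia.
Qed.

(** * Cup products of sign cochains *)

Section SignChange.
Variable sg : nat -> V -> bool.

(* The cup product of the coboundaries of the 0-cochains [sg j], decreasing [j]. *)
Fixpoint sign_changes s : bool :=
  if s is v :: s' then
    if s' is w :: _ then
      (sg (size s') v (+) sg (size s') w) && sign_changes s'
    else true
  else true.

Lemma sign_changes_cons v w s :
  sign_changes [:: v, w & s] =
  (sg (size s).+1 v (+) sg (size s).+1 w) && sign_changes (w :: s).
Proof. by []. Qed.

(** A product of coboundaries is a cocycle. The first two terms are the faces that omit [v] and [w];
    the sum runs over the faces that keep both. *)
Lemma sign_changes_cocycle v w s :
  sign_changes (w :: s) (+) sign_changes (v :: s) (+)
  eval (fun t => sign_changes [:: v, w & t]) (faces s) = false.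
Proof.
elim: s v w => [|u s IH] v w; first by rewrite /eval big_nil.
have -> : eval (fun t => sign_changes [:: v, w & t]) (faces (u :: s)) =
  (sg (size s).+1 v (+) sg (size s).+1 w) &&
  eval (fun t => sign_changes (w :: t)) (faces (u :: s)).
  rewrite -eval_andl; apply: eq_eval_in => t /size_faces[st].
  by rewrite sign_changes_cons st.
have -> : eval (fun t => sign_changes (w :: t)) (faces (u :: s)) =
    sign_changes (w :: s) (+) eval (fun t => sign_changes [:: w, u & t]) (faces s).
  by rewrite [faces _]/= eval_cons eval_map.
move: (IH w u); rewrite !sign_changes_cons.
move: (eval _ _) (sign_changes (u :: s)) (sign_changes (w :: s)) => E x y.
move: (sg _ v) (sg _ w) (sg _ u) => p q r.
by case: p q r x y E => [] [] [] [] [] [].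
Qed.

(** Leibniz rule for the cup product: the second factor is a cocycle, so only the coboundary of
    [sg k.+1] remains, and it is the leading factor of [sign_changes s]. *)
Lemma sign_changes_coboundary s k : size s = k.+2 ->
  eval (fun t => sg k.+1 (head 0 t) && sign_changes t) (faces s) = sign_changes s.
Proof.
case: s => [|v [|w s]] // [sk].
rewrite [faces _]/= !eval_cons !eval_map sign_changes_cons sk.
set E := eval (_ \o _) _.
have -> : E = sg k.+1 v && eval (fun t => sign_changes [:: v, w & t]) (faces s).
  by rewrite -eval_andl.
move: (sign_changes_cocycle v w s); rewrite [head _ _]/= [head _ _]/=.
move: (sign_changes _) (sign_changes _) (eval _ _) (sg _ v) (sg _ w).
by do 5!case.
Qed.

(* [sign_changes] in dimension [k] is the coboundary of [sg k] cup [sign_changes] in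
   dimension [k - 1], so its value on [c k] descends through the boundary to [c (k - 1)]. *)
Lemma eval_sign_changes (c : nat -> seq (seq V)) k :
  (forall i j v, (j < k)%N -> v \in flatten (c j) -> sg i.+1 (- v) = ~~ sg i.+1 v) ->
  (forall j s, s \in c j -> size s = j.+1) ->
  (forall j a, eval a (boundary (c j.+1)) =
     eval a (c j) (+) eval (a \o map -%R) (c j)) ->
  size (c 0%N) = 1%N -> eval sign_changes (c k) = true.
Proof.
move=> sgN szc bdc c0; elim: k sgN => [|k IH] sgN.
  move: c0 (szc 0%N); case: (c 0%N) => [|s []] // _ /(_ s (mem_head _ _)).
  by case: s => [|v []] // _; rewrite /eval big_cons big_nil.
rewrite -[RHS]IH; last by move=> i j v jk; apply: sgN; rewrite ltnW.
transitivity (eval (fun t => sg k.+1 (head 0 t) && sign_changes t) (boundary (c k.+1))).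
  rewrite eval_boundary; apply: eq_eval_in => s /szc ?.
  by rewrite sign_changes_coboundary.
rewrite bdc -eval_addb; apply: eq_eval_in => s sc.
have sN v : v \in s -> forall i, sg i.+1 (- v) = ~~ sg i.+1 v.
  by move=> vs i; apply: (sgN _ k) => //; apply/flattenP; exists s.
(* The antipode flips both ends of each edge, so every factor is unchanged; only the leading value
   [sg k.+1] flips, and the two copies of the simplex add up to [sign_changes s]. *)
have scN : sign_changes (map -%R s) = sign_changes s.
  elim: s {sc} sN => // v [//|w s] IHs sN.
  rewrite [map _ _]/= !sign_changes_cons size_map !sN ?inE ?eqxx ?orbT //.
  rewrite -IHs; first by rewrite addbN addNb negbK.
  by move=> u us; apply: sN; rewrite inE us orbT.
rewrite [(_ \o _) s]/= scN.
have := szc _ _ sc; case: s sN {sc scN} => // v s sN _.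
by rewrite ![head _ _]/= sN ?mem_head //; case: (sg _ v); case: (sign_changes _).
Qed.

Lemma sign_changesP s j : sign_changes s -> (j.+1 < size s)%N ->
  exists v w, [/\ v \in s, w \in s & sg j.+1 v (+) sg j.+1 w].
Proof.
elim: s => // v [//|w s] IH; rewrite sign_changes_cons => /andP[hvw hs].
rewrite [size _]/= ltnS leq_eqVlt => /orP[/eqP[->]|js].
  by exists v, w; rewrite !inE !eqxx orbT.
have [x [y [xs ys xy]]] := IH hs js.
by exists x, y; split => //; rewrite inE ?xs ?ys orbT.
Qed.

End SignChange.
(** Nested hemispheres: [c j] stands for half of a [j]-sphere, and the boundary of the next half is
    the whole equator, made of [c j] and its antipodal image. *)
Record antipodal_chains (c : nat -> seq (seq V)) : Prop := AntipodalChains {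
  size_antipodal : forall j s, s \in c j -> size s = j.+1;
  boundary_antipodal : forall j a, eval a (boundary (c j.+1)) =
    eval a (c j) (+) eval (a \o map -%R) (c j);
  size_antipodal0 : size (c 0%N) = 1%N }.

Lemma subdiv_antipodal (c : nat -> seq (seq V)) : antipodal_chains c ->
  antipodal_chains (fun j => subdiv_chain j.+1 (c j)).
Proof.
move=> [szc bdc c0]; split.
- by move=> j s /flatten_mapP[t tc]; apply: size_subdiv; exact: szc.
- move=> j a; rewrite eval_boundary !eval_subdiv_chain.
  transitivity (eval (eval (eval a \o subdiv j.+1) \o faces) (c j.+1)).
    apply: eq_eval_in => s sc.
    rewrite -[LHS]/(eval (fun t => eval a (faces t)) (subdiv j.+2 s)) -eval_boundary.
    by rewrite eval_boundary_subdiv ?(szc _ _ sc).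
  rewrite -[LHS]eval_boundary bdc; congr (_ (+) _).
  apply: eq_bigr => s _.
  by rewrite -[LHS]/(eval a (subdiv j.+1 (map -%R s))) subdiv_opp eval_map.
- move: c0 (szc 0%N); case: (c 0%N) => [|s []] // _ /(_ s (mem_head _ _)).
  by case: s => [|v []].
Qed.

(** * The cross-polytope and its subdivided hemispheres *)

Section Octahedron.
Variable e : nat -> V.

(** Mod 2 fundamental cycle of the cross-polytope with vertices [e i] and [- e i] for [i < k]. The
    previous cycle is its own antipodal image, so the two cones form its suspension. *)
Fixpoint octahedron k : seq (seq V) :=
  if k is k'.+1 then
    let c := map (cons (e k')) (octahedron k') in c ++ map (map -%R) c
  else [:: [::]].

Definition hemisphere k := map (cons (e k)) (octahedron k).

Lemma octahedronS k :
  octahedron k.+1 = hemisphere k ++ map (map -%R) (hemisphere k).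
Proof. by []. Qed.

Lemma eval_octahedron_opp a k :
  eval (a \o map -%R) (octahedron k) = eval a (octahedron k).
Proof.
case: k => [|k]; first by rewrite /eval !big_cons !big_nil.
rewrite octahedronS !eval_cat !eval_map addbC; congr (_ (+) _).
by apply: eq_bigr => s _ /=; rewrite opprK (mapK (@opprK V)).
Qed.

Lemma boundary_map_opp a c :
  eval a (boundary (map (map -%R) c)) = eval (a \o map -%R) (boundary c).
Proof.
rewrite !eval_boundary eval_map.
by apply: eq_bigr => s _ /=; rewrite faces_map eval_map.
Qed.

Lemma eval_boundary_octahedron a k : eval a (boundary (octahedron k)) = false.
Proof.
elim: k a => [|k IH] a; first exact: big_nil.
rewrite octahedronS /boundary map_cat flatten_cat eval_cat -!/(boundary _).
rewrite boundary_map_opp !eval_boundary_cone !IH !addbF.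
by rewrite eval_octahedron_opp addbb.
Qed.

Lemma size_octahedron k s : s \in octahedron k -> size s = k.
Proof.
elim: k s => [|k IH] s; first by rewrite inE => /eqP ->.
rewrite octahedronS mem_cat => /orP[/mapP[t /IH tk ->]|]; first by rewrite /= tk.
by move=> /mapP[u /mapP[t /IH tk ->] ->]; rewrite size_map /= tk.
Qed.

Lemma hemisphere_antipodal : antipodal_chains hemisphere.
Proof.
split=> //; first by move=> j s /mapP[t /size_octahedron <- ->].
move=> j a; rewrite eval_boundary_cone eval_boundary_octahedron addbF.
by rewrite octahedronS eval_cat; congr (_ (+) _); exact: eval_map.
Qed.

Definition fine_hemisphere r k := iter r (subdiv_chain k.+1) (hemisphere k).

Lemma fine_hemisphere_antipodal r : antipodal_chains (fine_hemisphere r).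
Proof.
elim: r => [|r IH]; first exact: hemisphere_antipodal.
exact: (subdiv_antipodal IH).
Qed.

Lemma fine_hemisphere_mesh r k s D :
  (forall t, t \in hemisphere k -> {in t &, forall u w, `|u - w| <= D}) ->
  s \in fine_hemisphere r k ->
  {in s &, forall u w, `|u - w| <= (k%:R / k.+1%:R) ^+ r * D}.
Proof.
move=> hD; elim: r s => [|r IH] s.
  by move=> /hD h u w us ws; rewrite expr0 mul1r; exact: h.
move=> /flatten_mapP[t th st] u w us ws; rewrite exprS -mulrA.
apply: (subdiv_mesh _ st) => //; last exact: IH.
exact: (size_antipodal (fine_hemisphere_antipodal r) th).
Qed.

(** New vertices are barycenters, so a subdivision never leaves a set stable under them. [Q] is a
    family of such sets because different simplices of the hemisphere need different ones. *)
Lemma fine_hemisphere_hull (Q : (V -> Prop) -> Prop) r k s :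
  (forall C, Q C -> forall u, u != [::] -> {in u, forall v, C v} -> C (barycenter u)) ->
  (forall t, t \in hemisphere k -> exists2 C, Q C & {in t, forall v, C v}) ->
  s \in fine_hemisphere r k -> exists2 C, Q C & {in s, forall v, C v}.
Proof.
move=> hQ h0; elim: r s => [//|r IH] s /flatten_mapP[t th st].
have [C QC Ct] := IH t th; exists C => //.
apply: (subdiv_vertices _ (hQ C QC) Ct st).
exact: (size_antipodal (fine_hemisphere_antipodal r) th).
Qed.

End Octahedron.
End Chains.

(** The Lebesgue number principle for a property that persists when [e] shrinks; it is the
    near-covering form of compactness applied to the filter of small positive reals. *)
Lemma compact_uniform (R : realType) (V : normedModType R) (K : set V)
    (P : R -> V -> Prop) :
  compact K ->
  (forall (e e' : R) (y : V), 0 < e' -> e' <= e -> P e y -> P e' y) ->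
  (forall x, K x -> exists2 e : R, 0 < e & forall y : V, K y -> `|x - y| < e -> P e y) ->
  exists2 e : R, 0 < e & forall x, K x -> P e x.
Proof.
move=> /compact_near_coveringP cK mono h.
have := cK R (0^'+) (fun e x => K x -> P e x) _ _.
case=> [x Kx|].
  have [e e0 he] := h _ Kx.
  exists (ball x e, [set i | 0 < i <= e]) => /=.
    split; first exact: nbhsx_ballx.
    by exists e => //= i /=; rewrite sub0r normrN => + i0; rewrite gtr0_norm // i0 => /ltW.
  move=> [x' i] /= []; rewrite -ball_normE /= => xx' /andP[i0 ie] Kx'.
  by apply: (mono e) => //; exact: he.
move=> r /= r0 hr; exists (r / 2); first by rewrite divr_gt0.
move=> x Kx; apply: hr => //=; last by rewrite divr_gt0.
by rewrite sub0r normrN gtr0_norm ?divr_gt0// ltr_pdivrMr// ltr_pMr// ltr1n.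
Qed.

Lemma mx_norm_coord (R : realType) m n (x : 'M[R]_(m, n)) i j : `|x i j| <= `|x|.
Proof.
rewrite [leRHS]/Num.Def.normr /= mx_normrE; apply/bigmax_geP; right => /=.
by exists (i, j).
Qed.

Lemma mx_norm_le (R : realType) m n (x : 'M[R]_(m, n)) (c : R) :
  0 <= c -> (forall i j, `|x i j| <= c) -> `|x| <= c.
Proof.
move=> c0 h; rewrite [leLHS]/Num.Def.normr /= mx_normrE; apply/bigmax_leP; split => //= -[i j] _.
Qed.

Lemma bigsum_norm_le (R : realType) (I : Type) (s : seq I) (F : I -> R) (c : R) :
  (forall i, `|F i| <= c) -> `|\sum_(i <- s) F i| <= (size s)%:R * c.
Proof.
move=> h; apply: le_trans (ler_norm_sum _ _ _) _; elim: s => [|x s IH].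
  by rewrite big_nil mul0r.
by rewrite big_cons [size _]/= -addn1 natrD mulrDl mul1r addrC lerD.
Qed.

(** * The Borsuk-Ulam theorem *)

Section BorsukUlam.
Variables (R : realType) (d : nat).
Notation V := 'rV[R]_d.+1.

Definition unit_vector (k : nat) : V := \row_j (j == k :> nat)%:R.

(** The hyperplane through a facet, cut by the sup-norm ball. It is convex, and when [|eps i| <= 1]
    its points satisfy [1 <= d.+1 * |v|]; this keeps subdivided simplices away from the origin. *)
Definition near_facet (eps : 'I_d.+1 -> R) (v : V) : Prop :=
  \sum_i eps i * v 0 i = 1 /\ `|v| <= 1.

Lemma barycenter_near_facet eps (u : seq V) : u != [::] ->
  {in u, forall v, near_facet eps v} -> near_facet eps (barycenter u).
Proof.
move=> u0 h; have k0 : (size u)%:R != 0 :> R by rewrite pnatr_eq0 size_eq0.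
split; last first.
  rewrite -normrN -sub0r; apply: barycenter_ball => // v /h [_].
  by rewrite sub0r normrN.
transitivity ((size u)%:R^-1 * \sum_(v <- u) \sum_i eps i * v 0 i).
  rewrite exchange_big mulr_sumr; apply: eq_bigr => i _ /=.
  by rewrite !mxE summxE -mulr_sumr mulrCA.
rewrite (eq_big_seq (fun=> 1)); last by move=> v /h [].
by rewrite big_const_seq count_predT iter_addr addr0 mulVf.
Qed.

Lemma octahedron_near_facet k s : (k <= d.+1)%N -> s \in octahedron unit_vector k ->
  exists eps : 'I_d.+1 -> R, [/\ forall i, `|eps i| <= 1,
    {in s, forall v, near_facet eps v} &
    {in s, forall v : V, forall i : 'I_d.+1, (k <= i)%N -> v 0 i = 0}].
Proof.
elim: k s => [|k IH] s kd.
  by rewrite inE => /eqP ->; exists (fun=> 0); split=> // i; rewrite normr0 ler01.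
have cone t : t \in octahedron unit_vector k ->
  exists eps : 'I_d.+1 -> R, [/\ forall i, `|eps i| <= 1,
    {in unit_vector k :: t, forall v, near_facet eps v} &
    {in unit_vector k :: t, forall v : V, forall i : 'I_d.+1, (k.+1 <= i)%N -> v 0 i = 0}].
  move=> /(IH _ (ltnW kd)) [eps [e1 enf e0]].
  (* The earlier vertices vanish in coordinate [k], so giving it the sign 1 accommodates the new
     vertex and leaves their sums unchanged. *)
  exists (fun i : 'I_d.+1 => if (i : nat) == k then 1 else eps i); split.
  - by move=> i; case: ifP => // _; rewrite normr1.
  - move=> v; rewrite inE => /orP[/eqP ->|vt].
      split; last first.
        by apply: mx_norm_le => // i j; rewrite mxE; case: eqP; rewrite ?normr1 ?normr0.
      rewrite (bigD1 (Ordinal kd)) //= mxE !eqxx mulr1 big1 ?addr0 // => i ik.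
      by rewrite mxE [(i : nat) == k](negbTE ik) mulr0.
    have [ev v1] := enf _ vt; split=> //; rewrite -ev.
    apply: eq_bigr => i _; case: eqP => // ik.
    by rewrite (e0 _ vt) ?ik // !mulr0.
  - move=> v; rewrite inE => /orP[/eqP -> i ki|vt i ki].
      by rewrite mxE gtn_eqF.
    by apply: (e0 _ vt); rewrite ltnW.
rewrite octahedronS mem_cat => /orP[/mapP[t /cone ht -> //]|].
move=> /mapP[t' /mapP[t /cone [eps [e1 enf e0]] ->] ->].
exists (fun i => - eps i); split.
- by move=> i; rewrite normrN.
- move=> v /mapP[w /enf [ew w1] ->]; split; last by rewrite normrN.
  by rewrite -ew; apply: eq_bigr => i _; rewrite mxE mulrNN.
- by move=> v /mapP[w wt ->] i ki; rewrite mxE (e0 _ wt) // oppr0.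
Qed.

Definition annulus : set V := [set x | `|x| <= 1 /\ 1 <= d.+1%:R * `|x|].

Lemma annulus_neq0 x : annulus x -> x != 0.
Proof.
by move=> [_]; apply: contraTneq => ->; rewrite normr0 mulr0 -ltNge ltr01.
Qed.

Lemma compact_annulus : compact annulus.
Proof.
apply: bounded_closed_compact.
  by exists 1; split => // M M1 x [x1 _]; exact: le_trans x1 (ltW M1).
have -> : annulus = [set x | `|x| <= 1] `&` [set x | d.+1%:R^-1 <= `|x|].
  apply/seteqP; split => x /= [x1 x2]; split => //.
    by rewrite -[leLHS]mulr1 ler_pdivrMl.
  by rewrite -ler_pdivrMl ?mulr1.
apply: closedI.
  apply: (@closed_comp _ _ (fun x : V => `|x|) [set t | t <= 1]).
    by move=> x _; exact: norm_continuous.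
  exact: closed_le.
apply: (@closed_comp _ _ (fun x : V => `|x|) [set t | d.+1%:R^-1 <= t]).
  by move=> x _; exact: norm_continuous.
exact: closed_ge.
Qed.

Lemma fine_hemisphere_annulus r k s : (k <= d)%N ->
  s \in fine_hemisphere unit_vector r k -> {in s, forall v, annulus v}.
Proof.
move=> kd hs.
pose Q (C : V -> Prop) := exists2 eps : 'I_d.+1 -> R, forall i, `|eps i| <= 1 &
  C = near_facet eps.
have [|t th|C [eps e1 ->] Cs] := @fine_hemisphere_hull _ _ unit_vector Q r k s _ _ hs.
- by move=> C [eps _ ->]; exact: barycenter_near_facet.
- have /(octahedron_near_facet (k := k.+1))[//|eps [e1 enf _]] :
    t \in octahedron unit_vector k.+1 by rewrite octahedronS mem_cat th.
  by exists (near_facet eps) => //; exists eps.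
move=> v /Cs [ev v1]; split=> //; rewrite -[leLHS]ev.
apply: le_trans (ler_norm _) _.
have := @bigsum_norm_le R _ (index_enum 'I_d.+1) (fun i => eps i * v 0 i) `|v|.
rewrite /index_enum -enumT size_enum_ord; apply=> i.
by rewrite normrM -[leRHS]mul1r ler_pM // mx_norm_coord.
Qed.

(* An arbitrary odd selection of one of [v], [- v], used to break ties at zeros of an odd map. *)
Definition selected (v : V) : bool := choose (pred2 v (- v)) v == v.

Lemma selected_opp v : v != 0 -> selected (- v) = ~~ selected v.
Proof.
move=> v0; rewrite /selected.
have -> : choose (pred2 (- v) (- - v)) (- v) = choose (pred2 v (- v)) v.
  rewrite (@eq_choose _ _ (pred2 v (- v))); last by move=> w /=; rewrite opprK orbC.
  by apply: choose_id; rewrite /= eqxx ?orbT.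
have vN : v != - v.
  apply: contra v0 => /eqP vv; have : v *+ 2 = 0 by rewrite mulr2n {1}vv addNr.
  by move/eqP; rewrite -scaler_nat scaler_eq0 pnatr_eq0.
have /= := @chooseP _ (pred2 v (- v)) v; rewrite eqxx => /(_ isT).
by move=> /orP[/eqP ->|/eqP ->]; rewrite eqxx ?(negbTE vN) // eq_sym vN.
Qed.

(** Without a common zero, every simplex of a fine subdivision has some [h j] of constant strict
    sign. But the number of simplices of the hemisphere on which all the signs change is odd. *)
Theorem borsuk_ulam (h : 'I_d -> V -> R) :
  (forall j x, x != 0 -> {for x, continuous (h j)}) ->
  (forall j x, x != 0 -> h j (- x) = - h j x) ->
  exists2 x, x != 0 & forall j, h j x = 0.
Proof.
move=> hc hodd; apply: contrapT => hno.
pose P (e : R) (x : V) := exists j, forall y y' : V,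
  `|x - y| < e -> `|x - y'| < e -> 0 < h j y * h j y'.
have [e e0 he] : exists2 e, 0 < e & forall x, annulus x -> P e x.
  apply: (@compact_uniform _ _ _ P compact_annulus).
    move=> e e' y _ ee' [j hj]; exists j => z z' /lt_le_trans yz /lt_le_trans yz'.
    by apply: hj; [exact: yz | exact: yz'].
  move=> x /annulus_neq0 x0.
  have [j hj] : exists j, h j x != 0.
    by apply: contrapT => hn; apply: hno; exists x => // j; apply/eqP/negP => /negP hj;
      apply: hn; exists j.
  have : \forall y \near x, `|h j x - h j y| < `|h j x|.
    by move/cvgrPdist_lt: (hc j x x0); apply; rewrite normr_gt0.
  move=> /nbhs_ballP[r /= r0 hr]; exists (r / 2); first by rewrite divr_gt0.
  move=> y _ xy; exists j => z z' yz yz'.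
  have key w : `|y - w| < r / 2 -> 0 < h j x * h j w.
    move=> yw; have : `|h j x - h j w| < `|h j x|.
      apply: hr; rewrite -ball_normE /=.
      by rewrite -(subrKA y) (splitr r) (le_lt_trans (ler_normD _ _)) ?ltrD.
    by rewrite ltr_norml; move: hj; case: (ltrgt0P (h j x)) => // hx _ /andP[h1 h2];
      [rewrite pmulr_rgt0//; lra | rewrite nmulr_rgt0//; lra].
  have := mulr_gt0 (key _ yz) (key _ yz').
  by rewrite mulrACA pmulr_rgt0 // -expr2 exprn_even_gt0.
(* The product involves the indices from 1 on, so [sg j.+1] carries the sign of [h j]. Beyond the
   range the tie-break alone decides, which keeps [sg] odd for every index. *)
pose sg i (v : V) := let t := if insub i.-1 is Some j then h j v else 0 in
  (0 < t) || (t == 0) && selected v.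
have sgN i v : v != 0 -> sg i (- v) = ~~ sg i v.
  move=> v0; rewrite /sg; case: insubP => [j _ _|_].
    by rewrite hodd // oppr_gt0 oppr_eq0 selected_opp //; case: ltrgt0P.
  by rewrite ltxx eqxx selected_opp.
(* The factor 2 bounds the distance of two points of the unit ball, hence the mesh before any
   subdivision. *)
have [r hr] : exists r : nat, (d%:R / d.+1%:R) ^+ r * 2 < e.
  have /cvgrPdist_lt /(_ (e / 2) (divr_gt0 e0 _)) [//|r _ hr] :
     (fun r => (d%:R / d.+1%:R : R) ^+ r) @ \oo --> 0.
    apply: cvg_expr; rewrite ger0_norm ?divr_ge0 ?ler0n //.
    by rewrite ltr_pdivrMr ?ltr0n // mul1r ltr_nat.
  exists r; have /= := hr r (leqnn r); rewrite sub0r normrN.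
  by rewrite ltr_pdivlMr // => /(le_lt_trans _); apply; rewrite ler_wpM2r // ler_norm.
have [szc bdc c0] := fine_hemisphere_antipodal unit_vector r.
have hann k v : (k <= d)%N -> v \in flatten (fine_hemisphere unit_vector r k) -> annulus v.
  by move=> kd /flattenP[s sc vs]; exact: (fine_hemisphere_annulus kd sc).
have : eval (sign_changes sg) (fine_hemisphere unit_vector r d) = true.
  apply: eval_sign_changes => // i j v jd vf.
  by apply: sgN; apply: annulus_neq0; apply: (hann j) => //; exact: ltnW.
apply/negP; rewrite /eval big_seq big1 // => s sc.
apply/negbTE/negP => hs.
have sz := szc _ _ sc.
have sann := fine_hemisphere_annulus (leqnn d) sc.
have mesh : {in s &, forall u w, `|u - w| < e}.
  move=> u w us ws; apply: le_lt_trans _ hr.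
  apply: (@fine_hemisphere_mesh _ _ unit_vector r d s 2) => // t th x y xt yt.
  have tann := @fine_hemisphere_annulus 0 d t (leqnn d) th.
  apply: le_trans (ler_normB _ _) _.
  have [x1 _] := tann _ xt; have [y1 _] := tann _ yt; lra.
case: s sz hs sann mesh {sc} => // x s sz hs sann mesh.
have [j hj] := he x (sann _ (mem_head _ _)).
have [|v [w [vs ws]]] := @sign_changesP _ _ sg (x :: s) j hs.
  by rewrite sz ltnS ltn_ord.
have := hj v w (mesh _ _ (mem_head _ _) vs) (mesh _ _ (mem_head _ _) ws).
rewrite /sg /= valK.
case: (ltrgt0P (h j v)) => hv; case: (ltrgt0P (h j w)) => hw //=;
  rewrite ?hv ?hw ?mul0r ?mulr0 ?ltxx //.
by rewrite pmulr_rgt0 // ltNge (ltW hw).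
by rewrite nmulr_rgt0 // ltNge (ltW hw).
Qed.

End BorsukUlam.

(** * A symmetric minimax principle *)

Section Minimax.
Variables (R : realType) (U : normedModType R) (d : nat).
Variables (f : U -> R) (W : U -> U) (q : U -> U -> R) (b : R).
Variables (L : 'rV[R]_d.+1 -> U) (P : 'I_d -> U -> R).
Hypothesis sphere_compact : compact [set z : U | `|z| = 1].
Hypothesis Wc : forall z : U, z != 0 -> {for z, continuous W}.
Hypothesis fd : forall (z w : U) (t : R), z + t *: w != 0 ->
  is_derive t (1 : R) (fun s => f (z + s *: w)) (q (z + t *: w) w).
Hypothesis fc : forall z : U, z != 0 -> {for z, continuous f}.
Hypothesis qN : forall z w, q z (- w) = - q z w.
Hypothesis qc : forall z w : U, z != 0 -> {for (z, w), continuous (fun p => q p.1 p.2)}.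
Hypothesis W_transverse : forall (z : U) (t : R), z != 0 -> z + t *: W z != 0.
Hypothesis q_gt0 : forall z : U, z != 0 -> W z != 0 -> 0 < q z (W z).
Hypothesis Wh : forall (c : R) (z : U), c != 0 -> W (c *: z) = c *: W z.
Hypothesis fh : forall (c : R) (z : U), c != 0 -> f (c *: z) = f z.
Hypothesis Lc : continuous L.
Hypothesis Lodd : forall x : 'rV[R]_d.+1, L (- x) = - L x.
Hypothesis L0 : forall x : 'rV[R]_d.+1, x != 0 -> L x != 0.
Hypothesis b0 : 0 <= b.
Hypothesis fL : forall x : 'rV[R]_d.+1, x != 0 -> f (L x) <= b.
Hypothesis Pc : forall j, continuous (P j).
Hypothesis Podd : forall j (z : U), P j (- z) = - P j z.
Hypothesis fP : forall z : U, z != 0 -> (forall j, P j z = 0) -> 0 <= f z.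

Let flow (p : U * R) : U := p.1 - p.2 *: W p.1.

Let flow_cont (z : U) : z != 0 -> {for (z, 0), continuous flow}.
Proof.
move=> z0; have c1 : {for (z, 0), continuous (fun p : U * R => p.1)} by exact: cvg_fst.
have c2 : {for (z, 0), continuous (fun p : U * R => p.2)} by exact: cvg_snd.
apply: continuousB => //; apply: continuousZ => //.
by apply: (@continuous_comp _ _ _ (fun p : U * R => p.1) W) => //; exact: Wc.
Qed.

Let flow0 z : flow (z, 0) = z.
Proof. by rewrite /flow /= scale0r subr0. Qed.

Let flow_neq0 (z : U) t : z != 0 -> flow (z, t) != 0.
Proof. by move=> z0; rewrite /flow /= -scaleNr W_transverse. Qed.

Let cont_box (g : U * R -> R) (z : U) (c : R) : 0 < c ->
  {for (z, 0), continuous g} ->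
  exists2 e : R, 0 < e & forall (y : U) (t : R), `|z - y| < e -> 0 <= t <= e ->
    `|g (z, 0) - g (y, t)| < c.
Proof.
move=> c0 /cvgrPdist_lt /(_ _ c0) /nbhs_ballP [e /= e0 he].
exists (e / 2); first by rewrite divr_gt0.
move=> y t zy /andP[t0 te]; apply: he; split => /=.
  by rewrite -ball_normE /=; apply: lt_le_trans zy _; rewrite ler_pdivrMr // ler_pMr // ler1n.
rewrite -ball_normE /= sub0r normrN ger0_norm //; apply: le_lt_trans te _.
by rewrite ltr_pdivrMr // ltr_pMr // ltr1n.
Qed.

(* Without a critical value in [[-1, b]], finitely many steps [z - e *: W z] push the image of
   [L] oddly into [f < 0], which misses the common zeros of the [P j]. *)
Lemma minimax_critical_point :
  exists z : U, [/\ z != 0, W z = 0 & -1 <= f z <= b].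
Proof.
apply: contrapT => hno.
have Wn0 (z : U) : z != 0 -> -1 <= f z <= b -> W z != 0.
  by move=> z0 fz; apply/negP => /eqP Wz; apply: hno; exists z.
(* One number [e] is both the length of a step and a lower bound of the slope along it, so a step
   that starts in the window gains [e ^+ 2]. The second clause limits any rise to one half. *)
pose Q (e : R) (z : U) :=
  (-1 <= f z <= b -> forall t : R, 0 <= t <= e -> e <= q (flow (z, t)) (W z)) /\
  (forall t : R, 0 <= t <= e -> `|f (flow (z, t)) - f z| <= 2^-1).
have sph0 (z : U) : `|z| = 1 -> z != 0 by move=> z1; rewrite -normr_eq0 z1 oner_eq0.
have [e e0 he] : exists2 e : R, 0 < e & forall z : U, `|z| = 1 -> Q e z.
  apply: (@compact_uniform _ _ _ Q sphere_compact).
    move=> e e' y _ ee' [h1 h2]; split=> [fy t|t] /andP[t0 te].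
      by apply: (le_trans ee'); apply: h1 => //; rewrite t0 (le_trans te).
    by apply: h2; rewrite t0 (le_trans te).
  move=> x /= /sph0 x0.
  have fx := fc x0.
  have [e2 e20 h2] : exists2 e : R, 0 < e & forall (y : U) (t : R), `|x - y| < e -> 0 <= t <= e ->
      `|f (flow (y, t)) - f y| <= 2^-1.
    have c4 : (0 : R) < 4^-1 by rewrite invr_gt0.
    have gc : {for (x, 0), continuous (f \o flow)}.
      by apply: continuous_comp; [exact: flow_cont | rewrite flow0].
    have [e1 e10 h] := cont_box c4 gc.
    exists e1 => // y t xy te; have := h y t xy te.
    have := h y 0 xy; rewrite lexx (ltW e10) => /(_ isT) /=; rewrite !flow0.
    move=> A B; have -> : f (flow (y, t)) - f y =
      - (f x - f (flow (y, t))) + (f x - f y) by ring.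
    by apply: le_trans (ler_normD _ _) _; rewrite normrN; lra.
  have [e1 e10 h1] : exists2 e : R, 0 < e & forall y : U, `|x - y| < e -> -1 <= f y <= b ->
      forall t : R, 0 <= t <= e -> e <= q (flow (y, t)) (W y).
    have [fxb|fxb] := boolP (-1 <= f x <= b).
      have c0 := q_gt0 x0 (Wn0 _ x0 fxb); set c := q x (W x) in c0.
      have gc : {for (x, 0), continuous (fun p : U * R => q (flow p) (W p.1))}.
        apply: (@continuous_comp _ _ _ (fun p : U * R => (flow p, W p.1))
           (fun p => q p.1 p.2)); last by rewrite flow0; exact: qc.
        apply: cvg_pair; first exact: flow_cont.
        by apply: (@continuous_comp _ _ _ (fun p : U * R => p.1) W);
          [exact: cvg_fst | exact: Wc].
      have [e1 e10 h] := cont_box (divr_gt0 c0 (ltr0n _ 2)) gc.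
      exists (Num.min e1 (c / 2)); first by rewrite lt_min e10 divr_gt0.
      move=> y; rewrite lt_min => /andP[xy _] _ t /andP[t0]; rewrite le_min => /andP[te _].
      have := h y t xy; rewrite t0 te => /(_ isT) /=; rewrite flow0 -/c ltr_norml => /andP[_ B].
      rewrite ge_min; apply/orP; right; lra.
    (* Outside the window the slope clause is vacuous, and being outside is an open condition. *)
    have [r r0 hr] : exists2 r : R, 0 < r & forall y : U, `|x - y| < r -> ~~ (-1 <= f y <= b).
      have [r r0 hr] : exists2 r : R, 0 < r & forall y, `|f x - y| < r -> ~~ (-1 <= y <= b).
        move: fxb; rewrite negb_and -!ltNge => /orP[h|h].
          exists (-1 - f x) => [|y]; first by rewrite subr_gt0.
          by rewrite ltr_norml => /andP[? _]; rewrite negb_and -!ltNge; apply/orP; left; lra.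
        exists (f x - b) => [|y]; first by rewrite subr_gt0.
        by rewrite ltr_norml => /andP[_ ?]; rewrite negb_and -!ltNge; apply/orP; right; lra.
      move/cvgrPdist_lt: fx => /(_ _ r0) /nbhs_ballP [s /= s0 hs]; exists s => // y xy.
      by apply: hr; apply: hs; rewrite -ball_normE.
    by exists r => // y /hr /negbTE ->.
  exists (Num.min e1 e2); first by rewrite lt_min e10.
  move=> y _; rewrite lt_min => /andP[xy1 xy2]; split=> [fy t|t] /andP[t0];
    rewrite le_min => /andP[te1 te2].
    by rewrite ge_min (h1 y xy1 fy t) // t0.
  by apply: h2 => //; rewrite t0.
pose s (z : U) : U := z - e *: W z.
have sE (z : U) : s z = flow (z, e) by [].
have s0 (z : U) : z != 0 -> s z != 0 by move=> z0; exact: flow_neq0.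
have sh (c : R) (z : U) : c != 0 -> s (c *: z) = c *: s z.
  by move=> c0; rewrite /s Wh // scalerBr !scalerA mulrC.
(* The step commutes with scaling and [f] ignores it, so the estimates on the sphere hold at all
   nonzero points. *)
have red (z : U) : z != 0 -> exists2 u, `|u| = 1 & f z = f u /\ f (s z) = f (s u).
  move=> z0; have nz : `|z| != 0 by rewrite normr_eq0.
  exists (`|z|^-1 *: z); first by rewrite normrZ normfV normr_id mulVf.
  by rewrite sh ?invr_eq0 // !fh ?invr_eq0.
have dec (z : U) : z != 0 -> -1 <= f z <= b -> f (s z) <= f z - e ^+ 2.
  move=> /red [u u1 [-> ->]] fu; have [h1 _] := he u u1.
  have u0 := sph0 u u1.
  pose g t := f (u + t *: - W u).
  have gd t : is_derive t (1 : R) g (q (u + t *: - W u) (- W u)).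
    by apply: fd; rewrite scalerN -scaleNr; exact: W_transverse.
  have gc : {within `[0, e], continuous g}.
    by apply: continuous_subspaceT => t; apply: differentiable_continuous;
      apply/derivable1_diffP; have [] := gd t.
  have [t] := MVT e0 (fun t _ => gd t) gc; rewrite in_itv /= => /andP[t0 te].
  rewrite subr0 qN.
  have <- : f (s u) = g e by rewrite /g /s scalerN.
  have -> : g 0 = f u by rewrite /g scale0r addr0.
  have : e <= q (u + t *: - W u) (W u).
    have := h1 fu t; rewrite (ltW t0) (ltW te) => /(_ isT).
    by rewrite /flow /= scalerN.
  move=> B E; have : e * e <= q (u + t *: - W u) (W u) * e by rewrite ler_wpM2r // ltW.
  by rewrite expr2; lra.
have close (z : U) : z != 0 -> `|f (s z) - f z| <= 2^-1.
  move=> /red [u u1 [-> ->]]; have [_ h] := he u u1; apply: h.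
  by rewrite lexx ltW.
have sN (z : U) : s (- z) = - s z by rewrite -scaleN1r sh ?oppr_eq0 ?oner_eq0 // scaleN1r.
have itN k (z : U) : iter k s (- z) = - iter k s z.
  by elim: k => //= k ->; rewrite sN.
have it0 k (z : U) : z != 0 -> iter k s z != 0 by move=> z0; elim: k => //= k /s0.
have itc k (z : U) : z != 0 -> {for z, continuous (iter k s)}.
  move=> z0; elim: k => [|k IH]; first exact: cvg_id.
  apply: (continuous_comp IH).
  apply: continuousB; first exact: cvg_id.
  by apply: continuousZl_tmp; apply: Wc; exact: it0.
(* Inside the window each step descends by [e ^+ 2]. Below [-1] a step may climb, but not above
   [- 2^-1], so a value that has become at most [- 2^-1] remains so. *)
have itf k (z : U) : z != 0 -> f z <= b -> f (iter k s z) <= Num.max (- 2^-1) (b - k%:R * e ^+ 2).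
  move=> z0 fz; elim: k => [|k IH].
    by rewrite mul0r subr0 le_max fz orbT.
  rewrite iterS; have {}z0 := it0 k z z0; move: (iter k s z) z0 IH => y y0 /= fy.
  have [y1|y1] := leP (-1) (f y); last first.
    rewrite le_max; apply/orP; left; have := close y y0; rewrite ler_norml => /andP[_ ?]; lra.
  have yb : f y <= b.
    apply: (le_trans fy); rewrite ge_max; apply/andP; split; first by (have := b0; lra).
    by rewrite gerBl mulr_ge0 // exprn_ge0 // ltW.
  have := dec y y0; rewrite y1 yb => /(_ isT) dy.
  rewrite le_max; apply/orP.
  move: fy; rewrite le_max => /orP[fy|fy]; [left|right].
    by apply: le_trans dy _; apply: le_trans fy; rewrite gerBl exprn_ge0 // ltW.
  rewrite -natr1 mulrDl mul1r; lra.
have [k hk] : exists k : nat, b - k%:R * e ^+ 2 < 0.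
  have e2 : 0 < e ^+ 2 by rewrite exprn_gt0.
  exists (Num.truncn (b / e ^+ 2)).+1; rewrite subr_lt0 -ltr_pdivrMr //.
  by apply: truncnS_gt.
(* The deformed image of [L] still meets the common zeros of the [P j], where [f] is nonnegative,
   although [k] steps have made [f] negative on all of it. *)
have [||x x0 hx] := @borsuk_ulam R d (fun j x => P j (iter k s (L x))).
- move=> j x x0; apply: (@continuous_comp _ _ _ (iter k s \o L) (P j)); last exact: Pc.
  by apply: continuous_comp; [exact: Lc | apply: itc; exact: L0].
- by move=> j x x0; rewrite Lodd itN Podd.
have := fP (it0 k _ (L0 x0)) hx.
apply/negP; rewrite -ltNge; apply: le_lt_trans (itf k _ (L0 x0) (fL x0)) _.
by rewrite gt_max hk andbT; lra.
Qed.

End Minimax.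

(** * The discretised action functional *)

Section Calculus.
Variable R : realType.

Lemma differentiable_eps (V W : normedModType R) (F : V -> W) (p : V) (e : R) :
  differentiable F p -> 0 < e ->
  exists2 r : R, 0 < r & forall w, `|w| < r ->
    `|F (p + w) - F p - 'd F p w| <= e * `|w|.
Proof.
move=> /diff_locally dF e0; move/eqaddoP: dF => /(_ _ e0) /nbhs_ballP [r /= r0 hr].
exists r => // w wr; have := hr w; rewrite -ball_normE /= sub0r normrN => /(_ wr).
by rewrite !fctE /= opprD addrA [w + p]addrC.
Qed.

Lemma is_derive_eps (W : normedModType R) (c : R -> W) (t e : R) v :
  is_derive t 1 c v -> 0 < e ->
  exists2 r : R, 0 < r & forall h, `|h| < r ->
    `|c (t + h) - c t - h *: v| <= e * `|h|.
Proof.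
move=> [dc <-] e0.
have /derivable1_diffP df := dc.
have [r r0 hr] := differentiable_eps df e0; exists r => // h /hr.
by rewrite diff1E // derive1E.
Qed.

Lemma eps_is_derive (W : normedModType R) (c : R -> W) (t : R) v :
  (forall e : R, 0 < e -> exists2 r : R, 0 < r & forall h, `|h| < r ->
    `|c (t + h) - c t - h *: v| <= e * `|h|) ->
  is_derive t 1 c v.
Proof.
move=> H.
have cv : (fun h => h^-1 *: ((c \o shift t) (h *: (1 : R)) - c t)) @ 0^' --> v.
  apply/cvgrPdist_le => e e0; have [r r0 hr] := H e e0.
  exists r => //= h; rewrite /ball_ /= sub0r normrN => hr' h0.
  have -> : v - h^-1 *: (c (h%:A + t) - c t) = - (h^-1 *: (c (t + h) - c t - h *: v)).
    by rewrite [in RHS]scalerBr scalerA mulVf // scale1r opprB [h *: _]mulr1 [h + t]addrC.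
  by rewrite normrN normrZ normfV ler_pdivrMl ?normr_gt0 // mulrC; exact: hr.
by split; [apply/cvg_ex; exists v | exact: cvg_lim].
Qed.

Lemma is_derive_continuous (W : normedModType R) (c : R -> W) (t : R) v :
  is_derive t 1 c v -> {for t, continuous c}.
Proof. by case=> /derivable1_diffP /differentiable_continuous. Qed.

Lemma is_derive0_cst (c : R -> R) :
  (forall t : R, is_derive t 1 c 0) -> forall s t, c s = c t.
Proof.
move=> dc s t; wlog st : s t / s < t.
  by move=> h; case: (ltgtP s t) => [/h //|/h //|-> //].
have cc : {within `[s, t], continuous c}.
  by apply: continuous_subspaceT => x; exact: is_derive_continuous (dc x).
have [x _] := MVT st (fun x _ => dc x) cc.
by rewrite mul0r => /eqP; rewrite subr_eq0 => /eqP.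
Qed.

Lemma continuous_mx (T : topologicalType) m n (f : T -> 'M[R]_(m, n)) (x : T) :
  (forall i j, {for x, continuous (fun t => f t i j)}) -> {for x, continuous f}.
Proof.
move=> fc; apply/cvgrPdist_le => e e0.
have : \forall t \near x, forall ij : 'I_m * 'I_n, `|f x ij.1 ij.2 - f t ij.1 ij.2| <= e.
  apply: filter_forall => -[i j] /=.
  by move/cvgrPdist_le: (fc i j); apply.
apply: filterS => t h; apply: mx_norm_le => [|i j]; first exact: ltW.
by rewrite !mxE; exact: (h (i, j)).
Qed.

Lemma continuous_sum (T : topologicalType) (I : Type) (s : seq I) (f : I -> T -> R) (x : T) :
  (forall i, {for x, continuous (f i)}) ->
  {for x, continuous (fun t => \sum_(i <- s) f i t)}.
Proof.
move=> fc; elim: s => [|i s IH].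
  rewrite (_ : (fun _ => _) = cst 0); first exact: cvg_cst.
  by apply/funext => t; rewrite big_nil.
rewrite (_ : (fun _ => _) = (fun t => f i t + \sum_(j <- s) f j t)).
  by apply: continuousD => //; exact: fc.
by apply/funext => t; rewrite big_cons.
Qed.

Lemma continuous_pair (T U V : topologicalType) (f : T -> U) (g : T -> V) (x : T) :
  {for x, continuous f} -> {for x, continuous g} ->
  {for x, continuous (fun t => (f t, g t))}.
Proof. by move=> fc gc; exact: cvg_pair. Qed.

Lemma is_derive_bigsum (I : Type) (s : seq I) (f : I -> R -> R) (df : I -> R) (t : R) :
  (forall i, is_derive t 1 (f i) (df i)) ->
  is_derive t 1 (fun u => \sum_(i <- s) f i u) (\sum_(i <- s) df i).
Proof.
move=> fd; elim: s => [|i s IH].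
  rewrite big_nil (_ : (fun _ => _) = cst 0); first exact: is_derive_cst.
  by apply/funext => u; rewrite big_nil.
rewrite big_cons (_ : (fun _ => _) = f i + (fun u => \sum_(j <- s) f j u)).
  exact: is_deriveD.
by apply/funext => u; rewrite big_cons.
Qed.

(** In this form the numerator, for the action over the energy, is the pairing with [residual]. *)
Lemma is_derive_quot (f g : R -> R) (t a b : R) : g t != 0 ->
  is_derive t 1 f a -> is_derive t 1 g b ->
  is_derive t 1 (fun u => f u / g u) ((a - f t / g t * b) / g t).
Proof.
move=> g0 fa gb.
have gi : is_derive t (1 : R) (fun u => (g u)^-1) (- (g t) ^- 2 *: b).
  split; first by apply: derivableV => //; case: gb.
  by rewrite deriveV //; case: gb => _ ->.
have := is_deriveM fa gi => h.
apply: (is_derive_eq h); rewrite /GRing.scale /=; field.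
exact: g0.
Qed.

End Calculus.

Section InnerProduct.
Variables (R : realType) (n : nat).
Local Notation Cn := (Cn R n).

Definition inner (u v : Cn) : R := \sum_j (xc u j * xc v j + yc u j * yc v j).

Lemma innerDr u v w : inner u (v + w) = inner u v + inner u w.
Proof.
by rewrite /inner -big_split; apply: eq_bigr => j _; rewrite /xc /yc !mxE /=; ring.
Qed.

Lemma innerZr u a v : inner u (a *: v) = a * inner u v.
Proof.
by rewrite /inner mulr_sumr; apply: eq_bigr => j _; rewrite /xc /yc !mxE /=; ring.
Qed.

Lemma innerC u v : inner u v = inner v u.
Proof. by apply: eq_bigr => j _; ring. Qed.

Lemma innerZl u a v : inner (a *: u) v = a * inner u v.
Proof. by rewrite innerC innerZr innerC. Qed.

Lemma innerDl u v w : inner (u + v) w = inner u w + inner v w.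
Proof. by rewrite innerC innerDr !(innerC w). Qed.

Lemma inner0r u : inner u 0 = 0.
Proof. by rewrite -(scale0r (0 : Cn)) innerZr mul0r. Qed.

Lemma innerNr u v : inner u (- v) = - inner u v.
Proof. by rewrite -scaleN1r innerZr mulN1r. Qed.

Lemma inner_inj u v : (forall w, inner u w = inner v w) -> u = v.
Proof.
move=> h; have e : inner (u - v) (u - v) = 0.
  by rewrite innerDl -[- v]scaleN1r innerZl h mulN1r subrr.
have nn j : 0 <= xc (u - v) j * xc (u - v) j + yc (u - v) j * yc (u - v) j.
  by rewrite addr_ge0 // -expr2 sqr_ge0.
have z j : xc u j = xc v j /\ yc u j = yc v j.
  have /eqP := e; rewrite psumr_eq0 // => /allP /(_ j); rewrite mem_index_enum.
  move=> /(_ isT) /eqP; rewrite /xc /yc /= !mxE -!expr2 => hj.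
  have h1 := sqr_ge0 (u.1 ord0 j - v.1 ord0 j).
  have h2 := sqr_ge0 (u.2 ord0 j - v.2 ord0 j).
  by split; apply/eqP; rewrite -subr_eq0 -sqrf_eq0; apply/eqP; lra.
rewrite [u]surjective_pairing [v]surjective_pairing; congr pair; apply/rowP => j.
  exact: (z j).1.
exact: (z j).2.
Qed.

Lemma Cn_norm_coord (z : Cn) j : `|xc z j| <= `|z| /\ `|yc z j| <= `|z|.
Proof.
by split; rewrite prod_normE le_max mx_norm_coord ?orbT.
Qed.

Lemma inner_le u v : `|inner u v| <= (n.*2)%:R * `|u| * `|v|.
Proof.
have -> : (n.*2)%:R = (size (index_enum 'I_n))%:R * 2 :> R.
  by rewrite /index_enum -enumT size_enum_ord -mul2n natrM mulrC.
rewrite -mulrA -mulrA; apply: bigsum_norm_le => j.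
have [u1 u2] := Cn_norm_coord u j; have [v1 v2] := Cn_norm_coord v j.
apply: le_trans (ler_normD _ _) _; rewrite !normrM mulr_natl mulr2n.
by apply: lerD; apply: ler_pM.
Qed.

Lemma inner_self_le z : inner z z <= (n.*2)%:R * `|z| ^+ 2.
Proof. by rewrite expr2 mulrA; apply: le_trans (ler_norm _) (inner_le _ _). Qed.

(** Frechet differentiability with the differential represented by the Euclidean product, while the
    norm is the sup norm. The epsilon form is what the gauge estimates deliver. *)
Definition has_gradient (H : Cn -> R) (z g : Cn) := forall e : R, 0 < e ->
  exists2 r : R, 0 < r & forall w, `|w| < r ->
    `|H (z + w) - H z - inner g w| <= e * `|w|.

Lemma has_gradient_continuous H z g : has_gradient H z g -> {for z, continuous H}.
Proof.
move=> hg; have [r r0 hr] := hg 1 ltr01.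
apply/cvgrPdist_lt => e e0.
pose C := 1 + (n.*2)%:R * `|g| + 1.
have C0 : 0 < C by rewrite !ltr_pwDr // addr_ge0 // mulr_ge0.
have r'0 : 0 < Num.min r (e / C) by rewrite lt_min r0 divr_gt0.
apply: filterS (nbhsx_ballx z _ r'0) => y; rewrite -ball_normE /= lt_min => /andP[yr ye].
have := hr (y - z); rewrite [X in X < r]distrC => /(_ yr); rewrite [z + _]addrC subrK.
have := inner_le g (y - z); rewrite mul1r.
have -> : H z - H y = - (H y - H z - inner g (y - z)) - inner g (y - z) by ring.
move=> h1 h2; apply: le_lt_trans (ler_normB _ _) _; rewrite normrN.
apply: (@le_lt_trans _ _ ((C - 1) * `|z - y|)); first by rewrite /C [in leRHS]distrC; lra.
rewrite ltr_pdivlMr // in ye; apply: le_lt_trans ye.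
by rewrite mulrC ler_wpM2l // /C; lra.
Qed.

Lemma is_derive_comp_gradient H (c : R -> Cn) (t : R) g v :
  has_gradient H (c t) g -> is_derive t 1 c v ->
  is_derive t 1 (H \o c) (inner g v).
Proof.
move=> Hg cv; apply: eps_is_derive => e e0.
pose C := (n.*2)%:R * `|g| + 1; pose B := `|v| + 1.
have C0 : 0 < C by rewrite ltr_pwDr // mulr_ge0.
have B0 : 0 < B by rewrite ltr_pwDr.
have e1 : 0 < e / 2 / B by rewrite !divr_gt0.
have [r1 r10 h1] := Hg _ e1.
have e2 : 0 < Num.min 1 (e / 2 / C) by rewrite lt_min ltr01 !divr_gt0.
have [r2 r20 h2] := is_derive_eps cv e2.
exists (Num.min r2 (r1 / B)); first by rewrite lt_min r20 divr_gt0.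
move=> h; rewrite lt_min => /andP[hr2 hr1]; rewrite /=.
have {h2} := h2 h hr2; set w := c (t + h) - c t; set m := Num.min _ _ => h2.
have m1 : m <= 1 by rewrite ge_min lexx.
have m2 : m * C <= e / 2 by rewrite -ler_pdivlMr // ge_min lexx orbT.
have wB : `|w| <= B * `|h|.
  rewrite -[w](subrK (h *: v)) (le_trans (ler_normD _ _)) // normrZ /B.
  by have := ler_wpM2r (normr_ge0 h) m1; lra.
have wr : `|w| < r1.
  by apply: le_lt_trans wB _; rewrite mulrC -ltr_pdivlMr.
have := h1 w wr; rewrite [c t + w]addrC subrK => {}h1.
have := inner_le g (w - h *: v); rewrite innerDr innerNr innerZr => h3.
have -> : H (c (t + h)) - H (c t) - h *: inner g v =
  (H (c (t + h)) - H (c t) - inner g w) + (inner g w - h * inner g v).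
  by rewrite /GRing.scale /=; ring.
apply: le_trans (ler_normD _ _) _.
rewrite [e]splitr mulrDl; apply: lerD.
  apply: le_trans h1 _; rewrite -mulrA ler_wpM2l ?divr_ge0 ?(ltW e0) //.
  by rewrite ler_pdivrMl.
apply: le_trans h3 _; apply: (@le_trans _ _ (C * `|w - h *: v|)).
  by rewrite ler_wpM2r // /C lerDl.
apply: (@le_trans _ _ (C * (m * `|h|))); first by rewrite ler_wpM2l // ltW.
by rewrite mulrA ler_wpM2r // mulrC.
Qed.

End InnerProduct.

Section CompactBalls.
Variable R : realType.

Lemma compact_mx_ball m n : compact [set X : 'M[R]_(m, n) | `|X| <= 1].
Proof.
have -> : [set X : 'M[R]_(m, n) | `|X| <= 1] =
    vec_mx @` [set v : 'rV[R]_(m * n) | `|v| <= 1].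
  apply/seteqP; split => [X /= X1|X /= [v v1 <-]].
    exists (mxvec X); last exact: mxvecK.
    apply: mx_norm_le => // i j; rewrite [i]ord1.
    by case/mxvec_indexP: j => i' j'; rewrite mxvecE (le_trans (mx_norm_coord _ _ _)).
  by apply: mx_norm_le => // i j; rewrite mxE (le_trans (mx_norm_coord _ _ _)).
apply: continuous_compact.
  apply: continuous_subspaceT => v; apply: continuous_mx => i j.
  rewrite (_ : (fun _ => _) = (fun v : 'rV[R]_(m * n) => v 0 (mxvec_index i j))).
    exact: coord_continuous.
  by apply/funext => w; rewrite mxE.
apply: bounded_closed_compact.
  by exists 1; split => // M M1 x /= x1; exact: le_trans x1 (ltW M1).
apply: (@closed_comp _ _ (fun x : 'rV[R]_(m * n) => `|x|) [set t | t <= 1]).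
  by move=> x _; exact: norm_continuous.
exact: closed_le.
Qed.

Lemma compact_pair_ball m n :
  compact [set Z : 'M[R]_(m, n) * 'M[R]_(m, n) | `|Z| <= 1].
Proof.
have -> : [set Z : 'M[R]_(m, n) * 'M[R]_(m, n) | `|Z| <= 1] =
  [set X : 'M[R]_(m, n) | `|X| <= 1] `*` [set X : 'M[R]_(m, n) | `|X| <= 1].
  by apply/seteqP; split => Z /=; rewrite prod_normE ge_max => /andP.
by apply: compact_setX; exact: compact_mx_ball.
Qed.

Lemma compact_pair_sphere m n :
  compact [set Z : 'M[R]_(m, n) * 'M[R]_(m, n) | `|Z| = 1].
Proof.
have -> : [set Z : 'M[R]_(m, n) * 'M[R]_(m, n) | `|Z| = 1] =
  [set Z : 'M[R]_(m, n) * 'M[R]_(m, n) | `|Z| <= 1] `&` [set Z | `|Z| = 1].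
  by apply/seteqP; split => Z /= => [->|[]].
apply: compact_closedI; first exact: compact_pair_ball.
apply: (@closed_comp _ _ (fun x : 'M[R]_(m, n) * 'M[R]_(m, n) => `|x|) [set 1]).
  by move=> x _; exact: norm_continuous.
exact: closed_eq.
Qed.

End CompactBalls.

(** * Homogeneous Hamiltonians *)

Record hamiltonian (R : realType) (n : nat) (H : Cn R n -> R) (gr : Cn R n -> Cn R n)
    (c0 : R) : Prop := Hamiltonian {
  ham_gradient : forall z, has_gradient H z (gr z);
  ham_continuous : continuous gr;
  ham_homogeneous : forall a z, H (a *: z) = a ^+ 2 * H z;
  ham_c0 : 0 < c0;
  ham_coercive : forall z, c0 * `|z| ^+ 2 <= H z }.

Section HamiltonianTheory.
Variables (R : realType) (n : nat) (H : Cn R n -> R) (gr : Cn R n -> Cn R n) (c0 : R).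
Hypothesis hH : hamiltonian H gr c0.

Lemma is_derive_line (z w : Cn R n) (t : R) :
  is_derive t 1 (fun s => H (z + s *: w)) (inner (gr (z + t *: w)) w).
Proof.
apply: (@is_derive_comp_gradient _ _ H (fun s => z + s *: w)).
  exact: (ham_gradient hH).
apply: eps_is_derive => e e0; exists 1 => // h _.
have -> : (z + (t + h) *: w) - (z + t *: w) - h *: w = 0.
  by rewrite scalerDl opprD addrACA subrr add0r addrAC addrK subrr.
by rewrite normr0 mulr_ge0 // ltW.
Qed.

Lemma ham_euler z : inner (gr z) z = 2 * H z.
Proof.
have := is_derive_line z z 0; rewrite scale0r addr0 => -[_ <-].
have -> : (fun s : R => H (z + s *: z)) = (fun s => (1 + s) ^+ 2 * H z).
  by apply/funext => s; rewrite -{1}[z]scale1r -scalerDl (ham_homogeneous hH).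
have h : is_derive (0 : R) (1 : R) (fun s : R => (1 + s) ^+ 2 * H z) (2 * H z).
  by apply: is_derive_eq; rewrite /GRing.scale /=; ring.
by case: h.
Qed.

(** Both sides of [H (a z + s a w) = a^2 H (z + s w)] are differentiated at [s = 0] and one factor
    [a] is cancelled. Negative [a] is allowed, so [gr] is odd. *)
Lemma ham_gradZ a z : a != 0 -> gr (a *: z) = a *: gr z.
Proof.
move=> a0; apply: inner_inj => w; rewrite innerZl.
have [_ h1] := is_derive_line (a *: z) (a *: w) 0.
have h2 := is_derive_line z w 0.
rewrite !scale0r !addr0 in h1 h2.
have E : (fun s : R => H (a *: z + s *: (a *: w))) = (a ^+ 2) \*: (fun s => H (z + s *: w)).
  apply/funext => s; rewrite -[RHS]/(a ^+ 2 * H (z + s *: w)) -(ham_homogeneous hH) scalerDr !scalerA.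
  by rewrite [s * a]mulrC.
rewrite E in h1; have [_ h3] := is_deriveZ (a ^+ 2) h2.
rewrite h3 innerZr /GRing.scale /= expr2 -mulrA in h1.
by apply: (mulfI a0); rewrite h1.
Qed.

Lemma ham_gt0 z : z != 0 -> 0 < H z.
Proof.
move=> z0; apply: lt_le_trans (ham_coercive hH z).
by rewrite mulr_gt0 ?(ham_c0 hH) // exprn_gt0 // normr_gt0.
Qed.

Lemma ham_ge0 z : 0 <= H z.
Proof.
apply: le_trans (ham_coercive hH z).
by rewrite mulr_ge0 ?exprn_ge0 // ltW // (ham_c0 hH).
Qed.

End HamiltonianTheory.

(** * Action, energy and their quotient on finite sequences *)

Section DiscreteAction.
Variables (R : realType) (n p : nat).
Notation N := p.+1.
Notation M := 'M[R]_(N, n).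
Notation U := (M * M)%type.

Definition mdot (X Y : M) : R := \sum_i \sum_j X i j * Y i j.

Lemma mdotC X Y : mdot X Y = mdot Y X.
Proof. by apply: eq_bigr => i _; apply: eq_bigr => j _; rewrite mulrC. Qed.

Lemma mdotDl X Y Z : mdot (X + Y) Z = mdot X Z + mdot Y Z.
Proof.
rewrite /mdot -big_split; apply: eq_bigr => i _; rewrite -big_split.
by apply: eq_bigr => j _; rewrite mxE mulrDl.
Qed.

Lemma mdotZl a X Y : mdot (a *: X) Y = a * mdot X Y.
Proof.
rewrite /mdot mulr_sumr; apply: eq_bigr => i _; rewrite mulr_sumr.
by apply: eq_bigr => j _; rewrite mxE mulrA.
Qed.

Lemma mdotDr X Y Z : mdot X (Y + Z) = mdot X Y + mdot X Z.
Proof. by rewrite mdotC mdotDl !(mdotC X). Qed.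

Lemma mdotZr a X Y : mdot X (a *: Y) = a * mdot X Y.
Proof. by rewrite mdotC mdotZl mdotC. Qed.

Lemma mdot_ge0 X : 0 <= mdot X X.
Proof.
by apply: sumr_ge0 => i _; apply: sumr_ge0 => j _; rewrite -expr2 sqr_ge0.
Qed.

Lemma mdot_eq0 X : mdot X X = 0 -> X = 0.
Proof.
move/eqP; rewrite psumr_eq0; last first.
  by move=> i _; apply: sumr_ge0 => j _; rewrite -expr2 sqr_ge0.
move=> /allP h; apply/matrixP => i j.
have /eqP := h i (mem_index_enum i); rewrite -/(is_true _) /= => /eqP.
rewrite psumr_eq0; last by move=> k _; rewrite -expr2 sqr_ge0.
by move=> /allP /(_ j (mem_index_enum j)); rewrite /= mulf_eq0 orbb mxE => /eqP.
Qed.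

Lemma mdot_mul (D : 'M[R]_N) X Y : mdot Y (D *m X) = mdot (D^T *m Y) X.
Proof.
rewrite /mdot (eq_bigr (fun i => \sum_j \sum_k D i k * Y i j * X k j)); last first.
  move=> i _; apply: eq_bigr => j _; rewrite mxE mulr_sumr.
  by apply: eq_bigr => k _; ring.
rewrite [RHS](eq_bigr (fun k => \sum_j \sum_i D i k * Y i j * X k j)); last first.
  move=> i _; apply: eq_bigr => j _; rewrite mxE mulr_suml.
  by apply: eq_bigr => k _; rewrite mxE.
rewrite exchange_big [RHS]exchange_big /=.
by apply: eq_bigr => j _; rewrite exchange_big.
Qed.

Definition udot (Z W : U) : R := mdot Z.1 W.1 + mdot Z.2 W.2.

Lemma udotC Z W : udot Z W = udot W Z.
Proof. by rewrite /udot mdotC (mdotC Z.2). Qed.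

Lemma udotDl Z Z' W : udot (Z + Z') W = udot Z W + udot Z' W.
Proof. by rewrite /udot !mdotDl addrACA. Qed.

Lemma udotZl a Z W : udot (a *: Z) W = a * udot Z W.
Proof. by rewrite /udot !mdotZl mulrDr. Qed.

Lemma udotNl Z W : udot (- Z) W = - udot Z W.
Proof. by rewrite -scaleN1r udotZl mulN1r. Qed.

Lemma udotNr Z W : udot W (- Z) = - udot W Z.
Proof. by rewrite udotC udotNl udotC. Qed.

Lemma udot_eq0 Z : udot Z Z = 0 -> Z = 0.
Proof.
move=> e; have := mdot_ge0 Z.1; have := mdot_ge0 Z.2 => h2 h1.
rewrite [Z]surjective_pairing; congr pair; apply: mdot_eq0.
  by move: e; rewrite /udot; lra.
by move: e; rewrite /udot; lra.
Qed.

Lemma udot_gt0 Z : Z != 0 -> 0 < udot Z Z.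
Proof.
move=> Z0; rewrite lt_neqAle addr_ge0 ?mdot_ge0 // andbT eq_sym.
by apply: contra Z0 => /eqP /udot_eq0 ->.
Qed.

Definition point (Z : U) (i : 'I_N) : Cn R n := (row i Z.1, row i Z.2).

Lemma pointD Z W i : point (Z + W) i = point Z i + point W i.
Proof. by rewrite /point !raddfD. Qed.

Lemma pointZ a Z i : point (a *: Z) i = a *: point Z i.
Proof. by rewrite /point !linearZ. Qed.

Lemma udotE Z W : udot Z W = \sum_i inner (point Z i) (point W i).
Proof.
rewrite /udot /mdot -big_split; apply: eq_bigr => i _ /=.
by rewrite -big_split; apply: eq_bigr => j _; rewrite /xc /yc !mxE.
Qed.

Lemma continuous_point i : continuous (point^~ i).
Proof.
move=> Z; apply: (@continuous_pair _ _ _ (fun Z : U => row i Z.1) (fun Z : U => row i Z.2)).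
  apply: continuous_mx => a b.
  rewrite (_ : (fun _ => _) = (fun X : M => X i b) \o fst).
    by apply: continuous_comp; [exact: cvg_fst | exact: coord_continuous].
  by apply/funext => t; rewrite /= mxE.
apply: continuous_mx => a b.
rewrite (_ : (fun _ => _) = (fun X : M => X i b) \o snd).
  by apply: continuous_comp; [exact: cvg_snd | exact: coord_continuous].
by apply/funext => t; rewrite /= mxE.
Qed.

Variables (H : Cn R n -> R) (gr : Cn R n -> Cn R n) (c0 : R).
Hypothesis hH : hamiltonian H gr c0.

Definition energy (Z : U) : R := \sum_i H (point Z i).

Definition energy_grad (Z : U) : U :=
  (\matrix_(i, j) xc (gr (point Z i)) j, \matrix_(i, j) yc (gr (point Z i)) j).

Lemma point_energy_grad Z i : point (energy_grad Z) i = gr (point Z i).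
Proof.
rewrite [RHS]surjective_pairing.
by congr pair; apply/rowP => j; rewrite !mxE /= /xc /yc.
Qed.

Lemma point_inj (Z W : U) : (forall i, point Z i = point W i) -> Z = W.
Proof.
move=> h; rewrite [Z]surjective_pairing [W]surjective_pairing.
by congr pair; apply/row_matrixP => i; have [] := h i.
Qed.

Lemma energy_gt0 Z : Z != 0 -> 0 < energy Z.
Proof.
move=> Z0; have [i hi] : exists i, point Z i != 0.
  apply: contrapT => hn; move/negP: Z0; apply; apply/eqP/point_inj => i.
  apply: contrapT => /eqP hi; apply: hn; exists i.
  by apply: contra hi => /eqP ->; rewrite /point !raddf0.
rewrite /energy (bigD1 i) //= ltr_pwDl ?(ham_gt0 hH hi) //.
by apply: sumr_ge0 => j _; exact: (ham_ge0 hH).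
Qed.

Lemma energyZ a Z : energy (a *: Z) = a ^+ 2 * energy Z.
Proof.
by rewrite /energy mulr_sumr; apply: eq_bigr => i _; rewrite pointZ (ham_homogeneous hH).
Qed.

Lemma energy_gradZ a Z : a != 0 -> energy_grad (a *: Z) = a *: energy_grad Z.
Proof.
move=> a0; apply: point_inj => i.
by rewrite pointZ !point_energy_grad pointZ (ham_gradZ hH).
Qed.

Lemma energy_euler Z : udot (energy_grad Z) Z = 2 * energy Z.
Proof.
rewrite udotE /energy mulr_sumr; apply: eq_bigr => i _.
by rewrite point_energy_grad (ham_euler hH).
Qed.

Lemma is_derive_energy (Z w : U) (t : R) :
  is_derive t 1 (fun s => energy (Z + s *: w)) (udot (energy_grad (Z + t *: w)) w).
Proof.
rewrite udotE; apply: is_derive_bigsum => i.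
have := is_derive_line hH (point Z i) (point w i) t.
rewrite point_energy_grad pointD pointZ; congr is_derive.
by apply/funext => s; rewrite pointD pointZ.
Qed.

Lemma continuous_energy : continuous energy.
Proof.
move=> Z; apply: continuous_sum => i.
apply: (@continuous_comp _ _ _ (point^~ i) H); first exact: continuous_point.
exact: has_gradient_continuous (ham_gradient hH _).
Qed.

Lemma continuous_pair_coord (T : topologicalType) (f : T -> Cn R n) (x : T) j :
  {for x, continuous f} ->
  {for x, continuous (fun t => xc (f t) j)} /\ {for x, continuous (fun t => yc (f t) j)}.
Proof.
move=> fc; split.
  apply: (@continuous_comp _ _ _ (fst \o f) (fun v : 'rV[R]_n => v ord0 j)).
    by apply: (@continuous_comp _ _ _ f fst); [exact: fc | exact: cvg_fst].
  exact: coord_continuous.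
apply: (@continuous_comp _ _ _ (snd \o f) (fun v : 'rV[R]_n => v ord0 j)).
  by apply: (@continuous_comp _ _ _ f snd); [exact: fc | exact: cvg_snd].
exact: coord_continuous.
Qed.

Lemma continuous_energy_grad : continuous energy_grad.
Proof.
have gc i Z : {for Z, continuous (fun Z => gr (point Z i))}.
  apply: (@continuous_comp _ _ _ (point^~ i) gr); first exact: continuous_point.
  exact: (ham_continuous hH).
move=> Z; apply: (@continuous_pair _ _ _ (fun Z => (energy_grad Z).1) (fun Z => (energy_grad Z).2)); apply: continuous_mx => i j.
  rewrite (_ : (fun _ => _) = (fun Z => xc (gr (point Z i)) j)).
    exact: (continuous_pair_coord j (gc i Z)).1.
  by apply/funext => t; rewrite mxE.
rewrite (_ : (fun _ => _) = (fun Z => yc (gr (point Z i)) j)).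
  exact: (continuous_pair_coord j (gc i Z)).2.
by apply/funext => t; rewrite mxE.
Qed.

Variable D : 'M[R]_N.

Definition action (Z : U) : R := mdot Z.2 (D *m Z.1).

Definition action_grad (Z : U) : U := (D^T *m Z.2, D *m Z.1).

Lemma actionZ a Z : action (a *: Z) = a ^+ 2 * action Z.
Proof. by rewrite /action -scalemxAr mdotZl mdotZr mulrA. Qed.

Lemma action_gradZ a Z : action_grad (a *: Z) = a *: action_grad Z.
Proof. by rewrite /action_grad -!scalemxAr. Qed.

Lemma action_gradD Z W : action_grad (Z + W) = action_grad Z + action_grad W.
Proof. by rewrite /action_grad !mulmxDr. Qed.

Lemma action_euler Z : udot (action_grad Z) Z = 2 * action Z.
Proof. by rewrite /udot /= -mdot_mul [mdot (D *m _) _]mdotC /action; ring. Qed.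

Lemma action_line (Z w : U) (s : R) :
  action (Z + s *: w) = action Z + s * udot (action_grad Z) w + s ^+ 2 * action w.
Proof.
rewrite /action /udot /= mulmxDr -scalemxAr !(mdotDl, mdotDr, mdotZl, mdotZr).
by rewrite -mdot_mul [mdot (D *m _) w.2]mdotC; ring.
Qed.

Lemma is_derive_action (Z w : U) (t : R) :
  is_derive t 1 (fun s => action (Z + s *: w)) (udot (action_grad (Z + t *: w)) w).
Proof.
rewrite action_gradD action_gradZ udotDl udotZl action_euler.
have -> : (fun s : R => action (Z + s *: w)) = (fun s : R =>
    action Z + s * udot (action_grad Z) w + s ^+ 2 * action w).
  by apply/funext => s; rewrite action_line.
by apply: is_derive_eq; rewrite /GRing.scale /=; ring.
Qed.

Lemma continuous_coordU (i : 'I_N) (j : 'I_n) (Z : U) :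
  {for Z, continuous (fun Z : U => Z.1 i j)} /\ {for Z, continuous (fun Z : U => Z.2 i j)}.
Proof.
split.
  apply: (@continuous_comp _ _ _ fst (fun v : M => v i j)); first exact: cvg_fst.
  exact: coord_continuous.
apply: (@continuous_comp _ _ _ snd (fun v : M => v i j)); first exact: cvg_snd.
exact: coord_continuous.
Qed.

Lemma continuous_udot (T : topologicalType) (f g : T -> U) (x : T) :
  {for x, continuous f} -> {for x, continuous g} ->
  {for x, continuous (fun t => udot (f t) (g t))}.
Proof.
move=> fc gc; apply: continuousD; apply: continuous_sum => i; apply: continuous_sum => j;
  apply: continuousM.
- exact: (continuous_comp fc (continuous_coordU i j _).1).
- exact: (continuous_comp gc (continuous_coordU i j _).1).
- exact: (continuous_comp fc (continuous_coordU i j _).2).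
- exact: (continuous_comp gc (continuous_coordU i j _).2).
Qed.

Lemma continuous_action_grad : continuous action_grad.
Proof.
move=> Z; apply: (@continuous_pair _ _ _ (fun Z : U => D^T *m Z.2) (fun Z : U => D *m Z.1)); apply: continuous_mx => i j.
  rewrite (_ : (fun _ => _) = (fun Z : U => \sum_k D^T i k * Z.2 k j)).
    apply: continuous_sum => k; apply: continuousM; first exact: cvg_cst.
    exact: (continuous_coordU k j Z).2.
  by apply/funext => t; rewrite mxE.
rewrite (_ : (fun _ => _) = (fun Z : U => \sum_k D i k * Z.1 k j)).
  apply: continuous_sum => k; apply: continuousM; first exact: cvg_cst.
  exact: (continuous_coordU k j Z).1.
by apply/funext => t; rewrite mxE.
Qed.

Lemma continuous_action : continuous action.
Proof.
have -> : action = (fun Z => 2^-1 * udot (action_grad Z) Z).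
  by apply/funext => Z; rewrite action_euler mulrA mulVf ?mul1r.
move=> Z; apply: (@continuousM _ _ (cst 2^-1) (fun Z => udot (action_grad Z) Z)).
  exact: cvg_cst.
by apply: continuous_udot; [exact: continuous_action_grad | exact: cvg_id].
Qed.

Definition rayleigh (Z : U) : R := action Z / energy Z.

(** The gradient of [rayleigh] multiplied by the energy: its zeros are the critical points, with
    [rayleigh Z] as multiplier. Without the denominator it is homogeneous of degree one, as the
    deformation step requires. *)
Definition residual (Z : U) : U := action_grad Z - rayleigh Z *: energy_grad Z.

Lemma rayleighZ a Z : a != 0 -> rayleigh (a *: Z) = rayleigh Z.
Proof.
move=> a0; rewrite /rayleigh actionZ energyZ -mulf_div divff ?mul1r //.
by rewrite expf_neq0.
Qed.

Lemma residualZ a Z : a != 0 -> residual (a *: Z) = a *: residual Z.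
Proof.
move=> a0; rewrite /residual rayleighZ // action_gradZ energy_gradZ //.
by rewrite scalerBr !scalerA mulrC.
Qed.

(** Euler's identity for both 2-homogeneous functions. Orthogonality keeps every step along the
    residual away from the origin. *)
Lemma residual_orth Z : Z != 0 -> udot (residual Z) Z = 0.
Proof.
move=> Z0; rewrite /residual udotDl udotNl udotZl action_euler energy_euler /rayleigh.
have := energy_gt0 Z0 => G0; field.
by rewrite gt_eqF.
Qed.

Lemma continuous_rayleigh Z : Z != 0 -> {for Z, continuous rayleigh}.
Proof.
move=> Z0; apply: (@continuousM _ _ action (fun Z => (energy Z)^-1)).
  exact: continuous_action.
apply: (@continuous_comp _ _ _ energy); first exact: continuous_energy.
by apply: inv_continuous; rewrite gt_eqF // energy_gt0.
Qed.

Lemma continuous_residual Z : Z != 0 -> {for Z, continuous residual}.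
Proof.
move=> Z0; apply: (@continuousB _ _ _ action_grad (fun Z => rayleigh Z *: energy_grad Z)).
  exact: continuous_action_grad.
by apply: continuousZ; [exact: continuous_rayleigh | exact: continuous_energy_grad].
Qed.

Lemma rayleigh_critical d (b : R) (L : 'rV[R]_d.+1 -> U) (P : 'I_d -> U -> R) :
  continuous L -> (forall x, L (- x) = - L x) -> (forall x, x != 0 -> L x != 0) ->
  0 <= b -> (forall x, x != 0 -> rayleigh (L x) <= b) ->
  (forall j, continuous (P j)) -> (forall j Z, P j (- Z) = - P j Z) ->
  (forall Z, Z != 0 -> (forall j, P j Z = 0) -> 0 <= rayleigh Z) ->
  exists Z, [/\ Z != 0, residual Z = 0 & -1 <= rayleigh Z <= b].
Proof.
move=> Lc LN L0 b0 Lb Pc PN P0.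
apply: (@minimax_critical_point R _ d rayleigh residual
  (fun Z w => udot (residual Z) w / energy Z) b L P) => //.
- exact: compact_pair_sphere.
- by move=> Z; exact: continuous_residual.
- move=> Z w t Zt.
  have := is_derive_quot _ (is_derive_action Z w t) (is_derive_energy Z w t).
  rewrite /residual udotDl udotNl udotZl; apply.
  by rewrite gt_eqF // energy_gt0.
- by move=> Z; exact: continuous_rayleigh.
- by move=> Z w; rewrite udotNr mulNr.
- move=> Z w Z0; apply: continuousM.
    apply: continuous_udot; last exact: cvg_snd.
    apply: (@continuous_comp _ _ _ fst residual); first exact: cvg_fst.
    exact: continuous_residual.
  apply: (@continuous_comp _ _ _ (energy \o fst)).
    by apply: continuous_comp; [exact: cvg_fst | exact: continuous_energy].
  by apply: inv_continuous; rewrite gt_eqF // energy_gt0.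
- move=> Z t Z0; apply: contraTneq (udot_gt0 Z0) => e.
  have : udot (Z + t *: residual Z) Z = udot Z Z.
    by rewrite udotDl udotZl residual_orth // mulr0 addr0.
  by rewrite e -{2}[Z]/(Z) -(scale0r Z) udotZl mul0r => <-; rewrite ltxx.
- by move=> Z Z0 W0; rewrite divr_gt0 ?udot_gt0 // energy_gt0.
- by move=> a Z; exact: residualZ.
- by move=> a Z; exact: rayleighZ.
Qed.

End DiscreteAction.

(** * The antiperiodic difference operator and the linking subspaces *)

Section DifferenceScheme.
Variables (R : realType) (n p : nat).
Notation N := p.+1.
Notation M := 'M[R]_(N, n).
Notation U := (M * M)%type.

(* [N] times the forward difference on sequences extended by [x (i + N) = - x i]. *)
Definition difference : 'M[R]_N := \matrix_(i, l) (N%:R *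
  (((l : nat) == i.+1)%:R - ((l : nat) == i)%:R
   - (i.+1 == N)%:R * ((l : nat) == 0%N)%:R)).

Lemma sum_delta k (f : 'I_N -> R) :
  \sum_(l < N) ((l : nat) == k)%:R * f l = (k < N)%:R * f (inord k).
Proof.
have [kN|kN] := ltnP k N.
  rewrite (bigD1 (inord k)) //= inordK // eqxx big1 ?addr0 // => i ik.
  have : (i : nat) != k by apply: contra ik => /eqP <-; rewrite inord_val.
  by move=> /negbTE ->; rewrite mul0r.
rewrite mul0r big1 // => i _.
by rewrite ltn_eqF ?mul0r // (leq_trans (ltn_ord i)).
Qed.

Lemma difference_mul (X : M) i j : (difference *m X) i j = N%:R *
  ((i.+1 < N)%:R * X (inord i.+1) j - X i j - (i.+1 == N)%:R * X ord0 j).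
Proof.
rewrite mxE (eq_bigr (fun l : 'I_N => N%:R * (((l : nat) == i.+1)%:R * X l j
   - ((l : nat) == i)%:R * X l j - (i.+1 == N)%:R * (((l : nat) == 0%N)%:R * X l j)))).
  rewrite -mulr_sumr !sumrB -mulr_sumr !sum_delta ltn_ord inord_val mul1r ltn0Sn mul1r.
  by congr (_ * (_ - _ - _ * X _ _)); apply/val_inj; rewrite /= inordK.
by move=> l _; rewrite !mxE; ring.
Qed.

(** Summation by parts: the transpose is minus the backward difference, with
    [y (-1) = - y (N - 1)]. *)
Lemma difference_tr_mul (Y : M) l j : (difference^T *m Y) l j = N%:R *
  ((0 < l)%:R * Y (inord l.-1) j - Y l j - ((l : nat) == 0%N)%:R * Y ord_max j).
Proof.
rewrite mxE (eq_bigr (fun i : 'I_N => N%:R * ((0 < l)%:R * (((i : nat) == l.-1)%:R * Y i j)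
   - ((i : nat) == l)%:R * Y i j - ((l : nat) == 0%N)%:R * (((i : nat) == p)%:R * Y i j)))).
  rewrite -mulr_sumr !sumrB -!mulr_sumr !sum_delta ltn_ord inord_val mul1r ltnSn mul1r.
  rewrite (leq_ltn_trans (leq_pred _) (ltn_ord l)) mul1r.
  by congr (_ * (_ - _ - _ * Y _ _)); apply/val_inj; rewrite /= inordK.
move=> i _; rewrite !mxE eqSS [(l : nat) == i]eq_sym.
have -> : ((l : nat) == i.+1)%:R = (0 < l)%:R * ((i : nat) == l.-1)%:R :> R.
  by rewrite -natrM mulnb; congr (nat_of_bool _)%:R; case: (l : nat) => //= k; rewrite eqSS eq_sym.
by ring.
Qed.

Definition antiperiodic (Z : U) (k : nat) : Cn R n :=
  (-1) ^+ (k %/ N) *: point Z (inord (k %% N)).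

Lemma antiperiodicD Z k : antiperiodic Z (k + N) = - antiperiodic Z k.
Proof.
rewrite /antiperiodic modnDr divnDr // divnn /= addn1 exprS mulN1r scaleNr //.
Qed.

Lemma antiperiodicMD Z q k : antiperiodic Z (q * N + k) = (-1) ^+ q *: antiperiodic Z k.
Proof.
elim: q => [|q IH]; first by rewrite expr0 scale1r.
by rewrite mulSn -addnA addnC antiperiodicD IH exprS mulN1r scaleNr.
Qed.

Lemma antiperiodic_lt Z (i : 'I_N) : antiperiodic Z i = point Z i.
Proof. by rewrite /antiperiodic divn_small // modn_small // expr0 scale1r inord_val. Qed.

Lemma antiperiodic_norm Z k : `|antiperiodic Z k| <= `|Z|.
Proof.
rewrite /antiperiodic normrZ normrX normrN1 expr1n mul1r.
rewrite prod_normE ge_max; apply/andP; split; apply: mx_norm_le => // i j;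
  rewrite mxE (le_trans (mx_norm_coord _ _ _)) // le_max lexx ?orbT //.
Qed.

Lemma antiperiodic_norm_attained Z : Z != 0 -> exists k, `|antiperiodic Z k| = `|Z|.
Proof.
move=> Z0; have nZ : 0 < `|Z| by rewrite normr_gt0.
have [i hi] : exists i, `|Z| <= `|point Z i|.
  apply: contrapT => hn.
  have lt i : `|point Z i| < `|Z|.
    by rewrite ltNge; apply/negP => h; apply: hn; exists i.
  suff : `|Z| < `|Z| by rewrite ltxx.
  pose m := \big[Num.max/0]_i `|point Z i|.
  have mi i : `|point Z i| <= m by exact: le_bigmax.
  apply: (@le_lt_trans _ _ m); last by apply/bigmax_ltP; split.
  have m0 : 0 <= m by apply: le_trans (mi ord0); rewrite normr_ge0.
  rewrite [leLHS]prod_normE ge_max; apply/andP; split; apply: mx_norm_le => // i j;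
    apply: le_trans (mi i).
    by rewrite prod_normE le_max (le_trans _ (mx_norm_coord _ ord0 j)) ?mxE.
  by rewrite prod_normE le_max (le_trans _ (mx_norm_coord (row i Z.2) ord0 j)) ?orbT // mxE.
exists i; apply/eqP; rewrite eq_le antiperiodic_norm.
by rewrite antiperiodic_lt.
Qed.

(* A sawtooth of slope [-2] that is antiperiodic with period [N]. *)
Definition sawtooth : M := \matrix_(i, j) (1 - 2 * i%:R / N%:R).

Lemma difference_sawtooth (i : 'I_N) (j : 'I_n) : (difference *m sawtooth) i j = -2.
Proof.
have N0 : N%:R != 0 :> R by rewrite pnatr_eq0.
rewrite difference_mul !mxE; have := ltn_ord i; rewrite leq_eqVlt.
case: eqVneq => [iN _|iN /= iN'].
  rewrite iN ltnn /= mul0r !mul1r mulr0 mul0r subr0.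
  have -> : (i : nat)%:R = N%:R - 1 :> R by have := congr1 (fun k : nat => k%:R : R) iN; rewrite -natr1 => <-; rewrite addrK.
  by field.
rewrite iN' inordK // -natr1 mul1r mul0r subr0.
by field.
Qed.

Lemma sum_sq_linear k (c : R) : \sum_(i < k) (c - 2 * i%:R) ^+ 2 =
  k%:R * c ^+ 2 - 2 * c * k%:R * (k%:R - 1)
  + 2 / 3 * (k%:R - 1) * k%:R * (2 * k%:R - 1).
Proof.
elim: k => [|k IH]; first by rewrite big_ord0; field.
by rewrite big_ord_recr /= IH -natr1; field.
Qed.

(** The sum of squares is exactly [n (N + 2 / N) / 3]; the 3 reflects the mean square [1/3] of a
    sawtooth between [1] and [-1]. *)
Lemma mdot_sawtooth : n%:R * N%:R <= 3 * mdot sawtooth sawtooth.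
Proof.
have N0 : 0 < N%:R :> R by rewrite ltr0n.
have -> : mdot sawtooth sawtooth = n%:R * (N%:R ^- 2 * \sum_(i < N) (N%:R - 2 * i%:R) ^+ 2).
  rewrite !mulr_sumr; apply: eq_bigr => i _.
  rewrite (eq_bigr (fun=> (1 - 2 * i%:R / N%:R) ^+ 2)).
    rewrite sumr_const card_ord -[LHS]mulr_natl; congr (_ * _).
    by field; rewrite gt_eqF.
  by move=> j _; rewrite !mxE expr2.
rewrite sum_sq_linear mulrCA ler_wpM2l //.
move: (N%:R : R) N0 => c c1.
have -> : 3 * (c ^- 2 * (c * c ^+ 2 - 2 * c * c * (c - 1) +
    2 / 3 * (c - 1) * c * (2 * c - 1))) = c + 2 / c.
  by field; rewrite gt_eqF.
by rewrite lerDl divr_ge0 // ltW.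
Qed.

Variables (H : Cn R n -> R) (gr : Cn R n -> Cn R n) (c0 : R).
Hypothesis hH : hamiltonian H gr c0.
Hypothesis n0 : (0 < n)%N.

Notation act := (action difference).

Lemma udot_le_energy (Z : U) : c0 * udot Z Z <= (n.*2)%:R * energy H Z.
Proof.
rewrite udotE /energy !mulr_sumr; apply: ler_sum => i _.
apply: le_trans (ler_wpM2l (ltW (ham_c0 hH)) (inner_self_le _)) _.
by rewrite mulrCA ler_wpM2l // (ham_coercive hH).
Qed.

(** The difference of the sawtooth is [-2] in every entry, so the action is the sum of the terms
    [-2 s y], each at most [s^2 + y^2]. No power of [N] appears, thanks to the scaling of
    [difference]. *)
Lemma action_sawtooth_le (s : R) (Y : M) :
  act (s *: sawtooth, Y) <= 3 * udot (s *: sawtooth, Y) (s *: sawtooth, Y).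
Proof.
rewrite /udot /action /= mdotZl mdotZr.
apply: (@le_trans _ _ (s ^+ 2 * (n%:R * N%:R) + mdot Y Y)); last first.
  have := ler_wpM2l (sqr_ge0 s) mdot_sawtooth; have := mdot_ge0 Y; rewrite expr2; lra.
have -> : s ^+ 2 * (n%:R * N%:R) = \sum_(i < N) \sum_(j < n) s ^+ 2.
  rewrite (eq_bigr (fun=> n%:R * s ^+ 2)); last first.
    by move=> i _; rewrite sumr_const card_ord mulr_natl.
  by rewrite sumr_const card_ord -[RHS]mulr_natl; ring.
rewrite /mdot -big_split; apply: ler_sum => i _; rewrite -big_split; apply: ler_sum => j _ /=.
rewrite -scalemxAr mxE difference_sawtooth.
have := sqr_ge0 (s + Y i j); rewrite !expr2; lra.
Qed.

(** The 3 comes from the sawtooth, [2 n / c0] from comparing the Euclidean with the sup norm and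
    from coercivity. Independence of [p] is the point. *)
Definition rayleigh_bound : R := 3 * (n.*2)%:R / c0.

Lemma rayleigh_sawtooth_le (s : R) (Y : M) : (s *: sawtooth, Y) != 0 ->
  rayleigh H difference (s *: sawtooth, Y) <= rayleigh_bound.
Proof.
move=> Z0; have c00 := ham_c0 hH.
rewrite ler_pdivrMr ?(energy_gt0 hH) //; apply: le_trans (action_sawtooth_le s Y) _.
rewrite /rayleigh_bound mulrAC ler_pdivlMr // -mulrA -mulrA ler_wpM2l //.
by rewrite mulrC; exact: udot_le_energy.
Qed.

Lemma critical_point : exists Z : U, [/\ Z != 0, residual H gr difference Z = 0 &
  -1 <= rayleigh H difference Z <= rayleigh_bound].
Proof.
(* Dimension count of the link: coordinate 0 is the amplitude of the sawtooth and the other [N n]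
   coordinates fill [y], against the [N n] coordinate functions of [y]. *)
pose tl (v : 'rV[R]_(N * n).+1) : M := vec_mx (\row_j v 0 (lift ord0 j)).
pose L (v : 'rV[R]_(N * n).+1) : U := (v 0 ord0 *: sawtooth, tl v).
have saw0 (s : R) : s *: sawtooth = 0 -> s = 0.
  move=> /matrixP /(_ ord0 (Ordinal n0)); rewrite !mxE mulr0 mul0r subr0 mulr1.
  by [].
have L0 v : v != 0 -> L v != 0.
  apply: contraNneq => -[/saw0 v0 tv]; apply/eqP/rowP => j; rewrite mxE.
  case: (unliftP ord0 j) => [j' ->|->] //.
  have /(congr1 mxvec) := tv; rewrite vec_mxK linear0 => /rowP /(_ j').
  by rewrite !mxE.
apply: (@rayleigh_critical R n p H gr c0 hH difference _ rayleigh_bound L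
  (fun j Z => mxvec Z.2 0 j)) => //.
- move=> v; apply: (@continuous_pair _ _ _ (fun v : 'rV[R]_(N * n).+1 => v 0 ord0 *: sawtooth) tl).
    apply: continuousZr_tmp; exact: coord_continuous.
  apply: continuous_mx => i j.
  rewrite (_ : (fun _ => _) = (fun v : 'rV[R]_(N * n).+1 => v 0 (lift ord0 (mxvec_index i j)))).
    exact: coord_continuous.
  by apply/funext => t; rewrite !mxE.
- move=> v; rewrite /L /tl mxE scaleNr; congr pair.
  by apply/matrixP => i j; rewrite !mxE.
- by rewrite divr_ge0 ?mulr_ge0 // ltW // (ham_c0 hH).
- by move=> v /L0; exact: rayleigh_sawtooth_le.
- move=> j Z; case/mxvec_indexP: j => i j.
  rewrite (_ : (fun _ => _) = (fun Z : U => Z.2 i j)).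
    exact: (continuous_coordU i j Z).2.
  by apply/funext => t; rewrite mxvecE.
- by move=> j Z; rewrite linearN mxE.
- move=> Z _ Zk; have -> : rayleigh H difference Z = 0 => //.
  have Z2 : Z.2 = 0.
    by apply: (can_inj mxvecK); rewrite linear0; apply/rowP => j; rewrite Zk mxE.
  rewrite /rayleigh /action Z2 (_ : mdot _ _ = 0) ?mul0r //.
  by rewrite -(scale0r (0 : M)) mdotZl mul0r.
Qed.

End DifferenceScheme.

(** * From critical points to the Euler scheme *)

Section DiscreteOrbit.
Variables (R : realType) (n : nat).
Variables (H : Cn R n -> R) (gr : Cn R n -> Cn R n) (c0 : R).
Hypothesis hH : hamiltonian H gr c0.
Hypothesis n0 : (0 < n)%N.

(** Row [i] of the forward difference gives the increment of [x]; row [i + 1] of the transpose gives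
    that of [y], hence a gradient at the next point. At the wrap-around the sign passes through the
    odd map [gr]. *)
Lemma antiperiodic_scheme p (Z : 'M[R]_(p.+1, n) * 'M[R]_(p.+1, n)) (lam : R) (i : 'I_p.+1) :
  action_grad (difference R p) Z = lam *: energy_grad gr Z ->
  antiperiodic Z i.+1 - antiperiodic Z i =
  (lam / p.+1%:R) *: ((gr (antiperiodic Z i)).2, - (gr (antiperiodic Z i.+1)).1).
Proof.
move=> e; have N0 : p.+1%:R != 0 :> R by rewrite pnatr_eq0.
have e1 (k : 'I_p.+1) (j : 'I_n) :
    ((difference R p)^T *m Z.2) k j = lam * (gr (point Z k)).1 0 j.
  by move/(congr1 fst)/matrixP/(_ k j): e; rewrite !mxE.
have e2 (k : 'I_p.+1) (j : 'I_n) :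
    (difference R p *m Z.1) k j = lam * (gr (point Z k)).2 0 j.
  by move/(congr1 snd)/matrixP/(_ k j): e; rewrite !mxE.
rewrite antiperiodic_lt.
have := ltn_ord i; rewrite leq_eqVlt => /orP[/eqP[ip]|ip].
  have iN : i.+1 = (0 + p.+1)%N by rewrite ip.
  have im : i = ord_max by apply: val_inj.
  rewrite iN antiperiodicD (antiperiodic_lt Z ord0).
  have -> : gr (- point Z ord0) = - gr (point Z ord0).
    by rewrite -scaleN1r (ham_gradZ hH) ?oppr_eq0 ?oner_eq0 // scaleN1r.
  congr pair; apply/rowP => j.
    have := e2 i j; rewrite difference_mul ip ltnn eqxx !mxE mul0r mul1r sub0r.
    by rewrite mulrAC => <-; field.
  have := e1 ord0 j; rewrite difference_tr_mul ltnn eqxx !mxE mul0r mul1r sub0r im.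
  by rewrite mulrAC opprK => <-; field.
have ei := antiperiodic_lt Z (Ordinal ip); rewrite /= in ei; rewrite ei.
have -> : Ordinal ip = inord i.+1 by apply: val_inj; rewrite /= inordK.
congr pair; apply/rowP => j.
  have := e2 i j; rewrite difference_mul ip ltn_eqF // !mxE mul0r mul1r subr0.
  by rewrite mulrAC => <-; field.
have := e1 (inord i.+1) j; rewrite difference_tr_mul inordK // ltn0Sn /= inord_val.
rewrite !mxE mul0r mul1r subr0 mulrN mulrAC => <-; by field.
Qed.

(* The discretisation is the symplectic Euler scheme: with the forward difference in [x]
   and the backward one in [y], the spectrum of the discrete action has no spurious branch. *)
Lemma discrete_orbit : exists b : R, forall p, exists (a : nat -> Cn R n) (lam : R),
  [/\ `|lam| <= b, forall i, a (i + p.+1)%N = - a i,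
      forall i, a i.+1 - a i = (lam / p.+1%:R) *: ((gr (a i)).2, - (gr (a i.+1)).1),
      forall i, `|a i| <= 1 & `|a 0%N| = 1].
Proof.
exists (Num.max 1 (rayleigh_bound n c0)) => p.
have [Z [Z0 res /andP[l1 l2]]] := critical_point p hH n0.
set lam := rayleigh H (difference R p) Z in l1 l2.
have nZ0 : `|Z| != 0 by rewrite normr_eq0.
have nZ : `|Z|^-1 != 0 by rewrite invr_eq0.
pose Y := `|Z|^-1 *: Z.
have Y1 : `|Y| = 1 by rewrite normrZ normfV normr_id mulVf.
have Y0 : Y != 0 by rewrite -normr_eq0 Y1 oner_eq0.
have eY : action_grad (difference R p) Y = lam *: energy_grad gr Y.
  rewrite /Y action_gradZ (energy_gradZ hH) // scalerA mulrC -scalerA; congr (_ *: _).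
  by apply/eqP; rewrite -subr_eq0; apply/eqP.
(* Starting at a sample of maximal norm places the normalisation at a fixed time, where it survives
   the limit. *)
have [k0 hk0] := antiperiodic_norm_attained Y0.
exists (fun i => antiperiodic Y (k0 + i)), lam; split.
- rewrite ler_norml [X in _ && X]le_max l2 orbT andbT lerNl le_max; apply/orP; left; lra.
- by move=> i; rewrite addnA antiperiodicD.
- move=> i; rewrite addnS; move: (k0 + i)%N => k.
  rewrite (divn_eq k p.+1) -addnS !antiperiodicMD.
  have := antiperiodic_scheme (Ordinal (ltn_pmod k (ltn0Sn p))) eY; rewrite /= => h.
  have s0 : (-1) ^+ (k %/ p.+1) != 0 :> R by rewrite expf_neq0 // oppr_eq0 oner_eq0.
  move: h; move: (antiperiodic _ _) (antiperiodic _ _) => u v h.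
  move: s0; move: ((-1) ^+ (k %/ p.+1)) => s s0.
  rewrite !(ham_gradZ hH) // -scalerBr h scalerA [s * _]mulrC -[LHS]scalerA.
  rewrite -[(_, _) in RHS]/(((s *: gr u).2, - (s *: gr v).1) : Cn R n).
  rewrite -[LHS]/((lam / p.+1%:R) *: ((s *: (gr u).2, s *: - (gr v).1) : Cn R n)).
  by rewrite scalerN.
- by move=> i; rewrite -Y1 antiperiodic_norm.
- by rewrite addn0 hk0.
Qed.

End DiscreteOrbit.

(** * Limit of the discrete orbits *)

Lemma ultra_fmap (T U : Type) (f : T -> U) (F : set_system T) :
  UltraFilter F -> UltraFilter (f @ F).
Proof.
move=> FU; apply: Build_UltraFilter => G GP FG; apply/seteqP; split=> // A GA.
have [//|FA] := @in_ultra_setVsetC _ _ (f @^-1` A) FU.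
have GAC : G (~` A) by apply: FG.
by have := filter_not_empty G; rewrite -(setICr A) => -[]; exact: filterI.
Qed.

(** One ultrafilter provides the limits at all times together, without extracting subsequences. *)
Lemma compact_ultra_cvg (T : Type) (V : topologicalType) (K : set V) (F : set_system T)
    (u : T -> V) :
  UltraFilter F -> compact K -> (\forall x \near F, K (u x)) ->
  exists2 l, K l & u @ F --> l.
Proof.
move=> FU; rewrite compact_ultra => /(_ _ (ultra_fmap u FU)) h Fu.
by have [l [Kl ul]] := h Fu; exists l.
Qed.

(** * Estimates for the Euler scheme *)

Section EulerScheme.
Variables (R : realType) (n : nat) (gr : Cn R n -> Cn R n) (b : R).

(** On the diagonal this is the standard complex structure up to sign. Two arguments are needed
    because the scheme takes the two halves of the gradient at consecutive samples. *)
Definition sympl (u v : Cn R n) : Cn R n := (u.2, - v.1).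

Lemma symplB u u' v v' : sympl (u - u') (v - v') = sympl u v - sympl u' v'.
Proof. by rewrite /sympl; congr pair; rewrite /= opprD opprK. Qed.

Lemma norm_sympl (u v : Cn R n) : `|sympl u v| <= Num.max `|u| `|v|.
Proof.
have pn (w : Cn R n) : `|w.1| <= `|w| /\ `|w.2| <= `|w|.
  by split; rewrite [leRHS]prod_normE le_max lexx ?orbT.
rewrite [leLHS]prod_normE normrN ge_max; apply/andP; split.
  by apply: le_trans (pn u).2 _; rewrite le_max lexx.
by apply: le_trans (pn v).1 _; rewrite le_max lexx orbT.
Qed.

Section Scheme.
Variables (N : R) (lam : R) (a : nat -> Cn R n).
Hypothesis N0 : 0 < N.
Hypothesis lamb : `|lam| <= b.
Hypothesis scheme : forall i,
  a i.+1 - a i = (lam / N) *: sympl (gr (a i)) (gr (a i.+1)).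

(** Telescoping: each step differs from the step with constant gradient [c] by at most
    [b / N * e]. *)
Lemma scheme_close (c : Cn R n) (e : R) i j : (i <= j)%N ->
  (forall l, (i <= l <= j)%N -> `|gr (a l) - c| <= e) ->
  `|a j - a i - ((j%:R - i%:R) * (lam / N)) *: sympl c c| <= (j%:R - i%:R) * (b / N) * e.
Proof.
elim: j => [|j IH]; first by rewrite leqn0 => /eqP -> _; rewrite !subrr !mul0r scale0r subrr normr0.
rewrite leq_eqVlt => /orP[/eqP <- _|ij h]; first by rewrite !subrr !mul0r scale0r subrr normr0.
have {}IH := IH ij _.
have IH' : `|a j - a i - ((j%:R - i%:R) * (lam / N)) *: sympl c c| <= (j%:R - i%:R) * (b / N) * e.
  by apply: IH => l /andP[il lj]; apply: h; rewrite il leqW.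
have -> : a j.+1 - a i - ((j.+1%:R - i%:R) * (lam / N)) *: sympl c c =
  (a j - a i - ((j%:R - i%:R) * (lam / N)) *: sympl c c) +
  (lam / N) *: sympl (gr (a j) - c) (gr (a j.+1) - c).
  have E : a j.+1 = a j + (lam / N) *: sympl (gr (a j)) (gr (a j.+1)).
    by rewrite -scheme addrC subrK.
  rewrite {1}E symplB.
  have -> : (j.+1%:R - i%:R) * (lam / N) = (j%:R - i%:R) * (lam / N) + lam / N.
    by rewrite -natr1; ring.
  rewrite scalerBr scalerDl; move: (_ *: _) (_ *: _) (_ *: _) => x y z.
  rewrite opprD !addrA; congr (_ - _).
  by rewrite [a j + z - a i]addrAC addrAC.
apply: le_trans (ler_normD _ _) _; rewrite -natr1.
have -> : (j%:R + 1 - i%:R) * (b / N) * e = (j%:R - i%:R) * (b / N) * e + b / N * e by ring.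
apply: lerD => //; rewrite normrZ; apply: ler_pM => //.
  by rewrite normrM normfV (gtr0_norm N0) ler_wpM2r // invr_ge0 ltW.
apply: le_trans (norm_sympl _ _) _; rewrite ge_max; apply/andP; split; apply: h.
  by rewrite -ltnS ij leqnSn.
by rewrite (ltnW ij) leqnn.
Qed.

Lemma scheme_lipschitz (G : R) i j : (forall l, `|gr (a l)| <= G) -> (i <= j)%N ->
  `|a j - a i| <= (j%:R - i%:R) * (b / N) * G.
Proof.
move=> hG ij; have := @scheme_close 0 G i j ij.
have -> : sympl 0 0 = 0 by rewrite /sympl oppr0.
rewrite scaler0 subr0; apply => l _.
by rewrite subr0.
Qed.

(** The Lipschitz bound confines the intermediate samples to the [D]-ball about [a i], where the
    gradient is close to [c]. The index [j] may precede [i], as a two-sided derivative requires. *)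
Lemma scheme_step (G D e : R) (c : Cn R n) i j : (forall l, `|gr (a l)| <= G) ->
  `|j%:R - i%:R| * (b / N) * G <= D ->
  (forall w, `|w - a i| <= D -> `|gr w - c| <= e) ->
  `|a j - a i - ((j%:R - i%:R) * (lam / N)) *: sympl c c| <= `|j%:R - i%:R| * (b / N) * e.
Proof.
move=> hG hD hc.
have b0 : 0 <= b by apply: le_trans lamb.
have bN : 0 <= b / N by rewrite divr_ge0 // ltW.
have G0 : 0 <= G by apply: le_trans (hG 0%N).
have [ij|ji] := leqP i j.
  rewrite ger0_norm ?subr_ge0 ?ler_nat // in hD *.
  apply: scheme_close => // l /andP[il lj]; apply: hc; apply: le_trans hD.
  apply: le_trans (scheme_lipschitz hG il) _.
  by rewrite !ler_wpM2r // lerB // ler_nat.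
have {}ji := ltnW ji.
rewrite distrC ger0_norm ?subr_ge0 ?ler_nat // in hD *.
have -> : a j - a i - ((j%:R - i%:R) * (lam / N)) *: sympl c c =
  - (a i - a j - ((i%:R - j%:R) * (lam / N)) *: sympl c c).
  by rewrite !opprB -scaleNr -mulNr opprB addrC.
rewrite normrN; apply: scheme_close => // l /andP[jl li]; apply: hc.
apply: le_trans hD; rewrite distrC; apply: le_trans (scheme_lipschitz hG li) _.
by rewrite !ler_wpM2r // lerB // ler_nat.
Qed.

End Scheme.
End EulerScheme.

Lemma compact_norm_bounded (R : realType) (V : normedModType R) (W : normedModType R)
    (K : set V) (f : V -> W) :
  compact K -> continuous f -> exists2 M : R, 0 < M & forall x, K x -> `|f x| <= M.
Proof.
move=> cK fc.
have /compact_bounded [M [Mr hM]] : compact (f @` K).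
  by apply: continuous_compact => //; exact: continuous_subspaceT.
exists (`|M| + 1); first by rewrite ltr_wpDl.
move=> x Kx; apply: (hM (`|M| + 1)); last by exists x.
by rewrite (le_lt_trans (ler_norm M)) // ltrDl.
Qed.

(** * Passage to the limit *)

Section EulerLimit.
Variables (R : realType) (n : nat) (gr : Cn R n -> Cn R n) (b : R).
Hypothesis gr_cont : continuous gr.
Variables (a : nat -> nat -> Cn R n) (lam : nat -> R).
Hypothesis lamb : forall p, `|lam p| <= b.
Hypothesis anti : forall p i, a p (i + p.+1)%N = - a p i.
Hypothesis scheme : forall p i, a p i.+1 - a p i =
  (lam p / p.+1%:R) *: sympl (gr (a p i)) (gr (a p i.+1)).
Hypothesis a_le1 : forall p i, `|a p i| <= 1.
Hypothesis a0 : forall p, `|a p 0%N| = 1.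

(** Time [t] is sampled near index [N t]. The shift by [2 N] units of time gives negative times a
    natural index once [N] is large, and being an even number of antiperiods it does not change the
    sign. *)
Let idx p (t : R) : nat := Num.truncn (p.+1%:R * (t + 2 * p.+1%:R)).
Let u p t : Cn R n := a p (idx p t).

Let near_ge (K : R) : \forall p \near \oo, K <= p.+1%:R.
Proof.
have [m hm] : exists m : nat, K <= m%:R by exists (Num.truncn K).+1; rewrite ltW // truncnS_gt.
by exists m => // p /= mp; apply: le_trans hm _; rewrite ler_nat (leq_trans mp).
Qed.

Let idx_pos p (t : R) : - t <= p.+1%:R -> 0 <= p.+1%:R * (t + 2 * p.+1%:R).
Proof.
have N0 : 0 < p.+1%:R :> R by rewrite ltr0n.
by move=> h; apply: mulr_ge0; lra.
Qed.

Let idx_itv p (t : R) : - t <= p.+1%:R ->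
  (idx p t)%:R <= p.+1%:R * (t + 2 * p.+1%:R) < (idx p t)%:R + 1.
Proof. by move=> /idx_pos /truncn_itv; rewrite -/(idx p t) -[(idx p t).+1%:R]natr1. Qed.

Let idx_diff p (t s : R) : - t <= p.+1%:R -> - s <= p.+1%:R ->
  `|((idx p s)%:R - (idx p t)%:R) / p.+1%:R - (s - t)| <= p.+1%:R^-1.
Proof.
move=> /idx_itv /andP[t1 t2] /idx_itv /andP[s1 s2].
have N0 : 0 < p.+1%:R :> R by rewrite ltr0n.
have -> : ((idx p s)%:R - (idx p t)%:R) / p.+1%:R - (s - t) =
  ((idx p s)%:R - (idx p t)%:R - p.+1%:R * (s - t)) / p.+1%:R.
  by field.
rewrite normrM [`|_^-1|]gtr0_norm ?invr_gt0 // -[leRHS]mul1r ler_wpM2r ?invr_ge0 ?ler0n //.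
by rewrite ler_norml; apply/andP; split; lra.
Qed.

Let u_anti p (t : R) : - t <= p.+1%:R -> u p (t + 1) = - u p t.
Proof.
move=> tp; rewrite /u -anti; congr (a p _).
apply: truncn_def; have /andP[h1 h2] := idx_itv tp.
rewrite -[(_ + _).+1%:R]natr1 natrD; have -> : p.+1%:R * (t + 1 + 2 * p.+1%:R) =
  p.+1%:R * (t + 2 * p.+1%:R) + p.+1%:R by ring.
by apply/andP; split; lra.
Qed.

Let u0 p : `|u p 0| = 1.
Proof.
have -> : u p 0 = a p ((2 * p.+1) * p.+1)%N.
  congr (a p _); apply: truncn_def; rewrite add0r -[(_ * _).+1%:R]natr1 !natrM.
  by apply/andP; split; lra.
elim: (2 * p.+1)%N => [|q IH]; first by rewrite mul0n a0.
by rewrite mulSn addnC anti normrN.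
Qed.

Lemma euler_limit : exists (z : R -> Cn R n) (l : R),
  [/\ forall t : R, is_derive t 1 z (l *: sympl (gr (z t)) (gr (z t))),
      forall t : R, z (t + 1) = - z t & `|z 0| = 1].
Proof.
have b0 : 0 <= b by apply: le_trans (lamb 0).
have [F [FU oF]] := @ultraFilterLemma nat (nbhs \oo) _.
have FP : ProperFilter F by exact: ultra_proper.
have ballc : compact [set z : Cn R n | `|z| <= 1] by exact: compact_pair_ball.
have uz t : {z : Cn R n | u^~ t @ F --> z}.
  apply: cid; have [|l _ ul] := @compact_ultra_cvg _ _ _ F (u^~ t) FU ballc.
    by apply: nearW => p; exact: a_le1.
  by exists l.
pose z t := projT1 (uz t).
have zc t : u^~ t @ F --> z t by exact: projT2 (uz t).
have [l hl lc] : exists2 l, `|l| <= b & lam @ F --> l.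
  have [|l lb lc] := @compact_ultra_cvg _ _ _ F lam FU (@segment_compact R (- b) b).
    by apply: nearW => p /=; rewrite in_itv /= -ler_norml.
  by exists l => //; move: lb; rewrite /= in_itv /= -ler_norml.
have [G G0 hG] := compact_norm_bounded ballc gr_cont.
have aG p i : `|gr (a p i)| <= G by exact: hG (a_le1 p i).
exists z, l; split; last first.
- have h1 : (fun p => `|u p 0|) @ F --> `|z 0| by exact: cvg_norm (zc 0).
  have h2 : (fun p => `|u p 0|) @ F --> (1 : R).
    by rewrite (_ : (fun _ => _) = cst 1); [exact: cvg_cst | apply/funext].
  exact: (@norm_cvg_unique R R ((fun p => `|u p 0|) @ F) _ _ _ h1 h2).
- move=> t; have h1 := zc (t + 1).
  have h2 : (fun p => - u p t) @ F --> - z t by exact: cvgN (zc t).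
  apply: (@norm_cvg_unique R (Cn R n) (u^~ (t + 1) @ F) _ _ _ h1).
  have E : {near F, (fun p => - u p t) =1 u^~ (t + 1)}.
    by apply: oF; have := near_ge (- t); apply: filterS => p /u_anti ->.
  exact: (cvg_trans (near_eq_cvg E) h2).
move=> t; set c := gr (z t); set V := sympl c c.
apply: eps_is_derive => e e0.
pose ep := e / (b + 1).
have ep0 : 0 < ep by rewrite divr_gt0 // ltr_wpDl.
have grc : {for z t, continuous gr} by exact: gr_cont.
move/cvgrPdist_lt: grc => /(_ _ ep0) /nbhs_ballP [d /= d0 hd].
have bG0 : 0 < b * G + 1 by rewrite ltr_wpDl // mulr_ge0 // ltW.
(* Of the radius [d] one half is kept for the distance of [u p t] to [z t], a quarter for the motion
   during [h] and a quarter for the rounding of times. *)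
pose r := d / 4 / (b * G + 1).
have r0 : 0 < r by rewrite !divr_gt0.
exists r => // h hr.
pose K := b * ep + b * `|V|.
(* Only the samples at [t] and [t + h] enter, so pointwise convergence is enough to differentiate
   the limit. The term in [K] is the rounding error, which disappears as [p] grows. *)
have main : \forall p \near F,
  `|u p (t + h) - u p t - (h * lam p) *: V| <= b * ep * `|h| + K * p.+1%:R^-1.
  have near1 : \forall p \near F, `|z t - u p t| < d / 2.
    by move/cvgrPdist_lt: (zc t); apply; rewrite divr_gt0.
  have near2 : \forall p \near F, - t <= p.+1%:R by exact: oF (near_ge _).
  have near3 : \forall p \near F, - (t + h) <= p.+1%:R by exact: oF (near_ge _).
  have near4 : \forall p \near F, b * G / (d / 4) <= p.+1%:R by exact: oF (near_ge _).
  apply: filterS (filterI (filterI near1 near2) (filterI near3 near4)).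
  move=> p [[n1 n2] [n3 n4]].
  have N0 : 0 < p.+1%:R :> R by rewrite ltr0n.
  have dj := idx_diff n2 n3; rewrite [t + h - t]addrC addKr in dj.
  rewrite /u; set i := idx p t in dj *; set j := idx p (t + h) in dj *.
  set dl := (j%:R - i%:R) in dj *.
  have djh : `|dl| / p.+1%:R <= `|h| + p.+1%:R^-1.
    have -> : `|dl| / p.+1%:R = `|dl / p.+1%:R| by rewrite normrM normfV (gtr0_norm N0).
    by rewrite -[dl / _](subrK h) (le_trans (ler_normD _ _)) // addrC lerD.
  have step := @scheme_step R n gr b p.+1%:R (lam p) (a p) N0 (lamb p) (scheme p) G (d / 2)
    ep c i j (aG p).
  have {step} : `|a p j - a p i - (dl * (lam p / p.+1%:R)) *: V| <=
     `|dl| * (b / p.+1%:R) * ep.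
    apply: step.
      rewrite -/dl; have -> : `|dl| * (b / p.+1%:R) * G = (`|dl| / p.+1%:R) * (b * G) by ring.
      apply: (@le_trans _ _ ((`|h| + p.+1%:R^-1) * (b * G))).
        by rewrite ler_wpM2r // mulr_ge0 // ltW.
      rewrite mulrDl; have -> : d / 2 = d / 4 + d / 4 by field.
      apply: lerD.
        move: hr; rewrite /r ltr_pdivlMr // => /ltW; apply: le_trans.
        by rewrite ler_wpM2l // lerDl.
      by rewrite mulrC ler_pdivrMr // -ler_pdivrMl ?divr_gt0 // mulrC.
    move=> w hw; have := hd w; rewrite -ball_normE /= distrC => hw'.
    apply: ltW; rewrite distrC; apply: hw'.
    rewrite -(subrKA (a p i)) [d]splitr; apply: le_lt_trans (ler_normD _ _) _.
    by apply: ler_ltD => //; rewrite distrC.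
  set A := a p j - a p i => step.
  have -> : A - (h * lam p) *: V = (A - (dl * (lam p / p.+1%:R)) *: V)
     + ((dl / p.+1%:R - h) * lam p) *: V.
    rewrite -[RHS]addrA; congr (_ + _).
    have -> : (dl / p.+1%:R - h) * lam p = dl * (lam p / p.+1%:R) - h * lam p by ring.
    by rewrite scalerBl addKr.
  apply: le_trans (ler_normD _ _) _.
  apply: (@le_trans _ _ (`|dl| * (b / p.+1%:R) * ep + p.+1%:R^-1 * b * `|V|)).
    by apply: lerD => //; rewrite normrZ ler_wpM2r // normrM ler_pM.
  have -> : `|dl| * (b / p.+1%:R) * ep = b * ep * (`|dl| / p.+1%:R) by ring.
  have bep : 0 <= b * ep by rewrite mulr_ge0 // ltW.
  apply: le_trans (lerD (ler_wpM2l bep djh) (lexx _)) _.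
  by rewrite le_eqVlt; apply/orP; left; apply/eqP; rewrite /K; ring.
have hc : (fun p => `|u p (t + h) - u p t - (h * lam p) *: V|) @ F -->
    `|z (t + h) - z t - (h * l) *: V|.
  apply: cvg_norm; apply: cvgB; first by apply: cvgB; exact: zc.
  by apply: cvgZr_tmp; apply: cvgMl_tmp.
have Kc : (fun p => b * ep * `|h| + K * p.+1%:R^-1) @ F --> b * ep * `|h| + K * 0.
  apply: cvgD; first exact: cvg_cst.
  apply: cvgMl_tmp; apply: cvg_trans (@cvg_harmonic R).
  by move=> A hA; exact: oF.
have := ler_cvg_to hc Kc main => /(_ FP).
rewrite mulr0 addr0 scalerA => /le_trans; apply; rewrite ler_wpM2r //.
rewrite /ep mulrCA ger_pMr // ler_pdivrMr ?mul1r ?lerDl //.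
by rewrite ltr_wpDl.
Qed.

End EulerLimit.

(** * The gauge function of a star-shaped hypersurface *)

(* Sign change of [F (p + y s)], which is [c * (s - alpha)] up to [o (r)]. *)
Lemma zero_near (R : realType) (V : normedModType R) (F : V -> R) (p : V) (c K e : R) :
  (forall x, differentiable F x) -> F p = 0 -> c != 0 -> 0 < K -> 0 < e ->
  exists2 d : R, 0 < d & forall (r alpha : R) (y : R -> V), 0 < r < d -> continuous y ->
    (forall s, `|s - alpha| <= e * r ->
       `|y s| <= K * r /\ `|'d F p (y s) - c * (s - alpha)| <= K * r ^+ 2) ->
    exists2 s, `|s - alpha| <= e * r & F (p + y s) = 0.
Proof.
move=> dF Fp c0 K0 e0.
have c1 : 0 < `|c| by rewrite normr_gt0.
(* The Taylor remainder and the quadratic term may each cost a third of [|c| e r]; this leaves [F]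
   with opposite signs at the two ends of the interval. *)
pose e1 := `|c| * e / (3 * K).
have e10 : 0 < e1 by rewrite divr_gt0 // mulr_gt0.
have [d1 d10 hd] := differentiable_eps (dF p) e10.
pose d := Num.min (d1 / K) (`|c| * e / (3 * K)).
exists d; first by rewrite lt_min !divr_gt0 // mulr_gt0.
move=> r alpha y /andP[r0]; rewrite lt_min => /andP[rd1 rd2] yc hy.
pose Phi s := F (p + y s).
have er : 0 < e * r by rewrite mulr_gt0.
have est s : `|s - alpha| <= e * r -> `|Phi s - c * (s - alpha)| <= 2 / 3 * (`|c| * (e * r)).
  move=> /hy [h1 h2].
  have yd : `|y s| < d1.
    by apply: le_lt_trans h1 _; rewrite mulrC -ltr_pdivlMr.
  have := hd _ yd; rewrite Fp subr0 -/(Phi s) => h3.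
  have -> : Phi s - c * (s - alpha) = (Phi s - 'd F p (y s)) + ('d F p (y s) - c * (s - alpha)).
    by ring.
  apply: le_trans (ler_normD _ _) _.
  have h4 : e1 * `|y s| <= 1 / 3 * (`|c| * (e * r)).
    apply: (@le_trans _ _ (e1 * (K * r))); first by rewrite ler_wpM2l // ltW.
    rewrite le_eqVlt; apply/orP; left; apply/eqP; rewrite /e1; field.
    by rewrite gt_eqF.
  have h5 : K * r ^+ 2 <= 1 / 3 * (`|c| * (e * r)).
    have := ltW rd2; rewrite ler_pdivlMr ?mulr_gt0 // => rd.
    have := ler_wpM2r (ltW r0) rd; rewrite expr2; lra.
  by lra.
have Phic : continuous Phi.
  move=> s; apply: (@continuous_comp _ _ _ (fun s => p + y s) F).
    by apply: (@continuousD _ _ _ (cst p) y); [exact: cvg_cst | exact: yc].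
  exact: differentiable_continuous.
have ends b : `|b| = 1 -> 0 < c * b * Phi (alpha + b * (e * r)).
  move=> b1; have := est (alpha + b * (e * r)).
  rewrite [alpha + _ - alpha]addrAC subrr add0r normrM b1 mul1r gtr0_norm // lexx => /(_ isT).
  set P := Phi _ => hP.
  have : `|c * b * P - (c * b) ^+ 2 * (e * r)| <= 2 / 3 * (`|c| ^+ 2 * (e * r)).
    have -> : c * b * P - (c * b) ^+ 2 * (e * r) = (c * b) * (P - c * (b * (e * r))) by ring.
    rewrite normrM normrM b1 mulr1.
    have := ler_wpM2l (ltW c1) hP; rewrite expr2; lra.
  have -> : (c * b) ^+ 2 = `|c| ^+ 2.
    by rewrite -(real_normK (num_real (c * b))) normrM b1 mulr1.
  have h0 := mulr_gt0 (exprn_gt0 2 c1) er.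
  by rewrite ler_norml => /andP[h1 _]; lra.
have hp := ends 1 (normr1 _); have hm := ends (-1) (normrN1 _).
rewrite !mul1r mulr1 in hp; rewrite mulN1r mulrN1 mulNr in hm.
have le : alpha - e * r <= alpha + e * r by lra.
have [s] : exists2 s, s \in `[alpha - e * r, alpha + e * r] & Phi s = 0.
  apply: IVT => //; first exact: continuous_subspaceT.
  have [cp|cn|cz] := ltrgt0P c; last by rewrite cz eqxx in c0.
    rewrite pmulr_rgt0 // in hp; rewrite oppr_gt0 pmulr_rlt0 // in hm.
    by rewrite ge_min le_max (ltW hp) (ltW hm) orbT.
  rewrite nmulr_rgt0 // in hp; rewrite oppr_gt0 nmulr_rlt0 // in hm.
  by rewrite ge_min le_max (ltW hp) (ltW hm) orbT.
rewrite in_itv /= => /andP[s1 s2] Ps; exists s => //.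
by rewrite ler_norml; apply/andP; split; lra.
Qed.

(** The solution for a given [t] has to be chosen before [e] is known. Taking its size within
    [t ^+ 2] of the infimum of the admissible sizes makes it [o(t)]. *)
Lemma choose_small (R : realType) (P : R -> R -> Prop) :
  (forall e : R, 0 < e -> exists2 d : R, 0 < d &
     forall t, `|t| < d -> exists2 s, `|s| <= e * `|t| & P t s) ->
  exists s : R -> R, (exists2 d : R, 0 < d & forall t, `|t| < d -> P t (s t)) /\
    (forall e : R, 0 < e -> exists2 d : R, 0 < d & forall t, `|t| < d -> `|s t| <= e * `|t|).
Proof.
move=> h.
have [d1 d10 hd1] := h 1 ltr01.
pose A t := [set x : R | exists2 s, x = `|s| & P t s].
have Alb t : has_lbound (A t) by exists 0 => x [s -> _].
have sel t : exists s, `|t| < d1 -> P t s /\ `|s| <= inf (A t) + t ^+ 2.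
  have [td|td] := boolP (`|t| < d1); last by exists 0.
  have [s0 s0t Ps0] := hd1 t td.
  have An : A t !=set0 by exists `|s0|, s0.
  have [->|t0] := eqVneq t 0.
    have n0 : `|0 : R| < d1 by rewrite normr0.
    have [s0'] := hd1 0 n0; rewrite mul1r normr0 normr_le0 => /eqP -> P00.
    exists 0 => _; split => //; rewrite normr0 expr0n addr0.
    by apply: lb_le_inf; [exists `|0 : R|, 0 | move=> x [s -> _]].
  have t2 : 0 < t ^+ 2 by rewrite exprn_even_gt0.
  have [x [s -> Ps] hx] := inf_adherent t2 (conj An (Alb t)).
  by exists s => _; split => //; exact: ltW.
have [s hs] := choice sel; exists s; split.
  by exists d1 => // t /hs [].
move=> e e0; have e2 : 0 < e / 2 by rewrite divr_gt0.
have [d d0 hd] := h _ e2.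
exists (Num.min d1 (Num.min d (e / 2))); first by rewrite !lt_min d10 d0.
move=> t; rewrite !lt_min => /andP[td1 /andP[td te]].
have [_ st] := hs t td1; apply: (le_trans st).
have [s' s't Ps'] := hd t td.
have i1 : inf (A t) <= e / 2 * `|t|.
  by apply: le_trans s't; apply: ge_inf => //; exists s'.
have : t ^+ 2 <= e / 2 * `|t|.
  by rewrite -real_normK ?num_real // expr2 ler_wpM2r // ltW.
lra.
Qed.

Section StarShaped.
Variables (R : realType) (n : nat) (S D : set (Cn R n)).
Hypothesis Dc : compact D.
Hypothesis D0 : D 0.
Hypothesis Dstar : forall p (t : R), D p -> 0 <= t <= 1 -> D (t *: p).
Hypothesis SE : S = closure D `\` interior D.
Hypothesis St : forall p, S p -> ~ tangent S p (liouville_field p).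

Lemma star_closed : closed D.
Proof. by apply: compact_closed => //; exact: norm_hausdorff. Qed.

Lemma star_boundary p : S p <-> D p /\ ~ interior D p.
Proof.
rewrite SE; split=> -[h1 h2]; split => //.
  by rewrite (closure_id D).1 //; exact: star_closed.
exact: subset_closure.
Qed.

(** The radial field vanishes at the origin, and a constant curve makes the zero vector tangent. *)
Lemma star_not0 : ~ S 0.
Proof.
move=> S0; apply: (St S0); exists (cst 0); split => //.
by rewrite derive_cst /liouville_field scaler0.
Qed.

Lemma star_int0 : interior D 0.
Proof.
by apply: contrapT => h; apply: star_not0; apply/star_boundary.
Qed.

Lemma star_int_scale q (t : R) : 0 < t <= 1 -> interior D q -> interior D (t *: q).
Proof.
move=> /andP[t0 t1] Dq.
have c : {for t *: q, continuous (fun x : Cn R n => t^-1 *: x)} by exact: scaler_continuous.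
have : \forall x \near t *: q, D (t^-1 *: x).
  by apply: c; rewrite /= scalerA mulVf ?gt_eqF // scale1r.
rewrite /interior /=; apply: filterS => x Dx.
have := @Dstar _ t Dx; rewrite scalerA mulfV ?gt_eqF // scale1r; apply.
by rewrite ltW.
Qed.

(* Otherwise the segment from [p] to [s *: p] lies in [S], and the radial field is tangent. *)
Lemma star_radial_unique p (s : R) : S p -> 1 < s -> ~ D (s *: p).
Proof.
move=> Sp s1 Ds; have [Dp nDp] := (star_boundary p).1 Sp.
have s0 : 0 < s by exact: lt_trans s1.
have Su (u : R) : 1 < u <= s -> S (u *: p).
  move=> /andP[u1 us]; have u0 : 0 < u by exact: lt_trans u1.
  apply/star_boundary; split.
    have := @Dstar _ (u / s) Ds; rewrite scalerA divfK ?gt_eqF //; apply.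
    apply/andP; split; first by apply: divr_ge0; apply: ltW.
    by rewrite ler_pdivrMr // mul1r.
  move=> iu; apply: nDp; have := @star_int_scale _ u^-1 _ iu.
  rewrite scalerA mulVf ?gt_eqF // scale1r; apply.
  by rewrite invr_gt0 u0 invf_le1 // ltW.
(* The curve starts at the midpoint between [1] and [s], and [d] is so small that [u0 (1 + t / 2)]
   stays between them. Beyond [d] it is frozen, because [tangent] wants a curve defined on the whole
   line. *)
pose u0 := (1 + s) / 2.
have [q qE] : exists q : Cn R n, q = u0 *: p by exists (u0 *: p).
pose d := (s - 1) / (2 * s).
have d0 : 0 < d by rewrite divr_gt0 ?mulr_gt0 // subr_gt0.
have Sq : S q by rewrite qE; apply: Su; rewrite /u0; apply/andP; split; lra.
pose g (t : R) : Cn R n := if `|t| < d then (1 + t / 2) *: q else q.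
have gd : is_derive (0 : R) (1 : R) g (2^-1 *: q).
  apply: eps_is_derive => e e0; exists d => // h hd.
  rewrite add0r /g hd normr0 d0 mul0r addr0 scale1r scalerDl scale1r.
  by rewrite [q + _]addrC addrK scalerA subrr normr0 mulr_ge0 // ltW.
apply: (St Sq); exists g; have [g1 g2] := gd; split => //; last first.
  by rewrite /g normr0 d0 mul0r addr0 scale1r.
move=> t; rewrite /g; case: ifP => // td; rewrite qE scalerA; apply: Su.
have : `|t| * (2 * s) < s - 1 by rewrite -ltr_pdivlMr // mulr_gt0.
move: td; rewrite ltr_norml => /andP[t1 t2] ts.
have h1 : t <= `|t| by exact: ler_norm.
have h2 : - t <= `|t| by rewrite -normrN ler_norm.
rewrite /u0; apply/andP; split; nra.
Qed.

Lemma star_radial_exists z : z != 0 -> exists2 t : R, 0 < t & S (t *: z).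
Proof.
move=> z0; have nz : 0 < `|z| by rewrite normr_gt0.
have [M M0 hM] : exists2 M : R, 0 < M & forall p, D p -> `|p| <= M.
  exact: (@compact_norm_bounded R _ _ D id Dc (fun z => cvg_id)).
pose A := [set t : R | 0 <= t /\ D (t *: z)].
have A0 : A 0 by split => //; rewrite scale0r.
have Aub : ubound A (M / `|z|).
  move=> t [t0 /hM]; rewrite normrZ ger0_norm // => h.
  by rewrite ler_pdivlMr.
have Ah : has_sup A by split; [exists 0 | exists (M / `|z|)].
have linec : continuous (fun t : R => t *: z) by exact: scalel_continuous.
have Acl : closed A.
  have -> : A = [set t | 0 <= t] `&` (fun t : R => t *: z) @^-1` D by [].
  apply: closedI; first exact: closed_ge.
  by apply: closed_comp; [move=> t _; exact: linec | exact: star_closed].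
have As : A (sup A).
  have : closure A (sup A) by apply: closure_sup; [exists 0 | exists (M / `|z|)].
  by rewrite -(closure_id A).1.
have [s0 Ds] := As.
have nI : ~ interior D (sup A *: z).
  move=> I; have : \forall t \near sup A, D (t *: z) by exact: linec.
  move=> /nbhs_ballP [r /= r0 hr].
  have : A (sup A + r / 2).
    split; first by rewrite addr_ge0 // divr_ge0 // ltW.
    apply: hr; rewrite -ball_normE /= opprD addNKr normrN gtr0_norm ?divr_gt0 //.
    by rewrite ltr_pdivrMr // ltr_pMr // ltr1n.
  move=> /(sup_upper_bound Ah); rewrite gerDl leNgt divr_gt0 //.
have Ss : S (sup A *: z) by apply/star_boundary.
exists (sup A) => //; rewrite lt_neqAle s0 andbT eq_sym.
apply/negP => /eqP h; apply: star_not0.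
by move: Ss; rewrite h scale0r.
Qed.

Lemma star_bounds : exists m M : R, [/\ 0 < m, 0 < M &
  forall p, S p -> m <= `|p| <= M].
Proof.
have [M M0 hM] := @compact_norm_bounded R _ _ D id Dc (fun z => cvg_id).
have /nbhs_ballP [m /= m0 hm] := star_int0.
exists m, M; split => // p /star_boundary [Dp nDp]; rewrite (hM p Dp) andbT leNgt.
apply/negP => pm; apply: nDp; apply: (@filterS _ _ _ (ball 0 m)) => //.
apply: open_nbhs_nbhs; split; first exact: ball_open.
by rewrite -ball_normE /= sub0r normrN.
Qed.

End StarShaped.

Lemma sum_pair (R : realType) n (I : Type) (s : seq I) (f g : I -> 'rV[R]_n) :
  \sum_(i <- s) ((f i, g i) : Cn R n) = (\sum_(i <- s) f i, \sum_(i <- s) g i).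
Proof.
elim: s => [|i s IH]; first by rewrite !big_nil.
by rewrite !big_cons IH.
Qed.

(** The error is [(3 + 2 s) s^2 / (1 + s)^2], with [3 + 2 s] at most 4 and [(1 + s)^2] at least
    [1/4]; hence 16. *)
Lemma inv_sqr_estimate (R : realType) (s : R) : `|s| <= 2^-1 ->
  `|(1 + s) ^- 2 - 1 + 2 * s| <= 16 * s ^+ 2.
Proof.
rewrite ler_norml => /andP[s1 s2].
have p0 : 0 < 1 + s by lra.
have -> : (1 + s) ^- 2 - 1 + 2 * s = (3 + 2 * s) * s ^+ 2 / (1 + s) ^+ 2.
  by field; rewrite gt_eqF.
rewrite ger0_norm; last first.
  by rewrite divr_ge0 ?exprn_ge0 ?(ltW p0) // mulr_ge0 ?sqr_ge0 //; lra.
rewrite ler_pdivrMr ?exprn_gt0 // mulrAC ler_wpM2r ?sqr_ge0 //.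
by rewrite expr2; nra.
Qed.

Lemma continuous_line (R : realType) (V : normedModType R) (x v : V) :
  continuous (fun s : R => x + s *: v).
Proof.
move=> s; apply: (@continuousD _ _ _ (cst x) (fun s : R => s *: v)).
  exact: cvg_cst.
exact: scalel_continuous.
Qed.

(** * Differentiability of the gauge from a local equation *)

Section SmoothHypersurface.
Variables (R : realType) (n : nat) (S : set (Cn R n)).

Definition gradient (F : Cn R n -> R) (p : Cn R n) : Cn R n :=
  (\row_j 'D_((delta_mx 0 j, 0) : Cn R n) F p,
   \row_j 'D_((0, delta_mx 0 j) : Cn R n) F p).

Lemma diff_inner F p w : differentiable F p -> 'd F p w = inner (gradient F p) w.
Proof.
move=> dF.
have E : w = \sum_j (w.1 0 j *: ((delta_mx 0 j, 0) : Cn R n) +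
                     w.2 0 j *: ((0, delta_mx 0 j) : Cn R n)).
  rewrite big_split /=.
  have -> : \sum_j w.1 0 j *: ((delta_mx 0 j, 0) : Cn R n) = (w.1, 0).
    transitivity (\sum_j ((w.1 0 j *: delta_mx 0 j, 0) : Cn R n)).
      by apply: eq_bigr => j _; congr pair; rewrite /= scaler0.
    by rewrite sum_pair -row_sum_delta big1.
  have -> : \sum_j w.2 0 j *: ((0, delta_mx 0 j) : Cn R n) = (0, w.2).
    transitivity (\sum_j ((0, w.2 0 j *: delta_mx 0 j) : Cn R n)).
      by apply: eq_bigr => j _; congr pair; rewrite /= scaler0.
    by rewrite sum_pair -row_sum_delta big1.
  by rewrite [LHS]surjective_pairing; congr pair; rewrite /= ?addr0 ?add0r.
rewrite {1}E linear_sum; apply: eq_bigr => j _.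
by rewrite linearD [X in X + _]linearZ [X in _ + X]linearZ /= -!deriveE // /xc /yc !mxE mulrC [X in _ + X]mulrC.
Qed.

Lemma smooth_continuous_gradient F : smooth F -> continuous (gradient F).
Proof.
move=> sF p.
apply: (@continuous_pair _ _ _ (fun p => \row_j 'D_((delta_mx 0 j, 0) : Cn R n) F p)
  (fun p => \row_j 'D_((0, delta_mx 0 j) : Cn R n) F p)).
  apply: continuous_mx => i j.
  rewrite (_ : (fun _ => _) = (fun p => 'D_((delta_mx 0 j, 0) : Cn R n) F p)).
    by apply: differentiable_continuous; exact: (sF [:: ((delta_mx 0 j, 0) : Cn R n)] p).
  by apply/funext => t; rewrite mxE.
apply: continuous_mx => i j.
rewrite (_ : (fun _ => _) = (fun p => 'D_((0, delta_mx 0 j) : Cn R n) F p)).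
  by apply: differentiable_continuous; exact: (sF [:: ((0, delta_mx 0 j) : Cn R n)] p).
by apply/funext => t; rewrite mxE.
Qed.

Lemma diff_bound (F : Cn R n -> R) p : differentiable F p ->
  exists2 K : R, 0 < K & forall w, `|'d F p w| <= K * `|w|.
Proof.
move=> dF; exists ((n.*2)%:R * `|gradient F p| + 1).
  by rewrite ltr_wpDl // mulr_ge0.
move=> w; rewrite diff_inner //; apply: le_trans (inner_le _ _) _.
by rewrite mulrDl mul1r lerDl.
Qed.

Section LocalEquation.
Variables (U : set (Cn R n)) (F : Cn R n -> R).
Hypothesis oU : open U.
Hypothesis sF : smooth F.
Hypothesis SF : forall q, U q -> (S q <-> F q = 0).

Let dF x : differentiable F x. Proof. exact: (sF [::] x). Qed.

Let U_ball p : U p -> exists2 r : R, 0 < r & forall w, `|w| < r -> U (p + w).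
Proof.
move=> Up; have /nbhs_ballP [r /= r0 hr] : nbhs p U by exact: open_nbhs_nbhs.
by exists r => // w wr; apply: hr; rewrite -ball_normE /= opprD addrA subrr sub0r normrN.
Qed.

(** If [F] were stationary along the ray, moving by [o(t)] in the direction [v] would bring
    [p + (t / 2) p] back to [S], by the intermediate value theorem. The resulting curve has the
    Liouville vector as velocity, and [tangent] asks for differentiability at time 0 only. *)
Lemma radial_derivative_neq0 p : U p -> S p -> (exists v, 'D_v F p != 0) ->
  ~ tangent S p (liouville_field p) -> 'd F p p != 0.
Proof.
move=> Up Sp [v]; rewrite deriveE // => c0 nt; apply/negP => /eqP dp.
have Fp : F p = 0 by apply/SF.
have [rU rU0 hU] := U_ball Up.
pose P (t s : R) := U (p + ((t / 2) *: p + s *: v)) /\ F (p + ((t / 2) *: p + s *: v)) = 0.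
have [|sg [[d d0 hd] hs]] := @choose_small R P.
  move=> e e0; pose K := `|p| + e * `|v| + 1.
  have K0 : 0 < K by rewrite ltr_wpDl // addr_ge0 // mulr_ge0 // ltW.
  have [d d0 hd] := zero_near dF Fp c0 K0 e0.
  exists (Num.min d (rU / K)); first by rewrite lt_min d0 divr_gt0.
  move=> t; rewrite lt_min => /andP[td tU].
  have [->|t0] := eqVneq t 0.
    exists 0; first by rewrite normr0 mulr0.
    by rewrite /P mul0r !scale0r !addr0.
  have nt0 : 0 < `|t| by rewrite normr_gt0.
  pose y (s : R) := (t / 2) *: p + s *: v.
  have yK s : `|s| <= e * `|t| -> `|y s| <= K * `|t|.
    move=> hs; apply: le_trans (ler_normD _ _) _; rewrite !normrZ ?normrM normfV.
    rewrite (gtr0_norm (_ : 0 < 2 :> R)) // /K.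
    have h1 := ler_wpM2r (normr_ge0 v) hs.
    have h2 : 0 <= `|t| * `|p| by rewrite mulr_ge0.
    by lra.
  have [|||s hs1 hs2] := hd `|t| 0 y.
  - by rewrite nt0.
  - exact: continuous_line.
  - move=> s; rewrite subr0 => hs; split; first exact: yK.
    have -> : 'd F p (y s) = s * 'd F p v.
      by rewrite /y linearD !linearZ /= dp scaler0 add0r.
    rewrite mulrC subrr normr0.
    by rewrite mulr_ge0 ?exprn_ge0 // ltW.
  rewrite subr0 in hs1.
  exists s => //; split => //; apply: hU.
  by apply: le_lt_trans (yK s hs1) _; rewrite mulrC -ltr_pdivlMr.
have sg0 : sg 0 = 0.
  have [d' d'0 h] := hs 1 ltr01; have := h 0; rewrite normr0 => /(_ d'0).
  by rewrite mulr0 normr_le0 => /eqP.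
pose g (t : R) : Cn R n := if `|t| < d then p + ((t / 2) *: p + sg t *: v) else p.
have g0 : g 0 = p by rewrite /g normr0 d0 mul0r sg0 !scale0r !addr0.
have gd : is_derive (0 : R) (1 : R) g (2^-1 *: p).
  apply: eps_is_derive => e e0.
  have ev : 0 < e / (`|v| + 1) by rewrite divr_gt0 // ltr_wpDl.
  have [d' d'0 hd'] := hs _ ev.
  exists (Num.min d d'); first by rewrite lt_min d0.
  move=> h; rewrite lt_min => /andP[h1 /hd' h2]; rewrite add0r g0 /g h1.
  rewrite [p + _]addrC addrK scalerA [X in `|X|]addrC addrA addrC.
  rewrite [- _ + _]addrC subrr addr0 normrZ.
  apply: (@le_trans _ _ (e / (`|v| + 1) * `|h| * `|v|)); first by rewrite ler_wpM2r.
  rewrite mulrAC ler_wpM2r // mulrAC ler_pdivrMr ?ltr_wpDl // ler_wpM2l ?ltW //.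
  by rewrite ltrDl.
apply: nt; exists g; have [gd1 gd2] := gd; split => //.
move=> t; rewrite /g; case: ifP => // /hd [PU PF]; exact/SF.
Qed.

Variable H : Cn R n -> R.
Hypothesis HS : forall z t, 0 < t -> S (t *: z) -> H z = t ^- 2.

(** The ray through [p + w] meets [S] at a factor [1 + s] with [s] close to [- 'd F p w / c], so
    [H (p + w) = (1 + s)^-2] is close to [1 + 2 'd F p w / c]. *)
Lemma gauge_gradient p : U p -> S p -> 'd F p p != 0 ->
  has_gradient H p ((2 / 'd F p p) *: gradient F p).
Proof.
move=> Up Sp c0 e e0; set c := 'd F p p in c0 *.
have Fp : F p = 0 by apply/SF.
have [rU rU0 hU] := U_ball Up.
have [K1 K10 hK1] := diff_bound (dF p).
have Hp : H p = 1 by rewrite (HS (t := 1)) ?scale1r // expr1n invr1.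
have e40 : 0 < e / 4 by rewrite divr_gt0.
have c1 : 0 < `|c| by rewrite normr_gt0.
pose A := K1 / `|c| + e / 4.
have A0 : 0 < A by rewrite addr_gt0 // divr_gt0.
pose K := A * `|p| + 1 + A + A * K1.
have K0 : 0 < K.
  rewrite addr_gt0 ?mulr_gt0 // addr_gt0 // ltr_wpDl //.
  by apply: mulr_ge0 => //; exact: ltW.
have [d d0 hd] := zero_near dF Fp c0 K0 e40.
(* In order: the radius of [zero_near], the bound [|w|^2 <= |w|], staying in [U], [|s| <= 1/2], and
   absorbing [16 s^2] into half of [e |w|]. The other half is twice the error [e / 4] on [s]. *)
pose r := Num.min (Num.min d 1) (Num.min (rU / K) (Num.min (2 * A)^-1 (e / (32 * A ^+ 2)))).
exists r.
  by rewrite !lt_min d0 ltr01 !divr_gt0 ?invr_gt0 ?mulr_gt0 ?exprn_gt0.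
move=> w; rewrite !lt_min => /andP[/andP[wd w1] /andP[wU /andP[wA we]]].
have [->|w0] := eqVneq w 0.
  by rewrite addr0 subrr inner0r subrr !normr0 mulr0.
have nw0 : 0 < `|w| by rewrite normr_gt0.
pose alpha := - 'd F p w / c.
pose y (s : R) := w + s *: (p + w).
have sA s : `|s - alpha| <= e / 4 * `|w| -> `|s| <= A * `|w|.
  move=> hs; rewrite -(subrK alpha s); apply: le_trans (ler_normD _ _) _.
  rewrite /A mulrDl addrC; apply: lerD => //.
  by rewrite /alpha normrM normrN normfV mulrAC ler_wpM2r // invr_ge0.
have yK s : `|s - alpha| <= e / 4 * `|w| -> `|y s| <= K * `|w|.
  move=> /sA hs; apply: le_trans (ler_normD _ _) _.
  rewrite normrZ /K.
  have h0 := ler_wpM2l (normr_ge0 s) (ler_normD p w).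
  have h1 := ler_wpM2r (normr_ge0 p) hs.
  have h2 := ler_wpM2r (normr_ge0 w) hs.
  have h3 : A * `|w| * `|w| <= A * `|w| 
    by apply: ler_piMr; [apply: mulr_ge0 => //; exact: ltW | exact: ltW].
  have h4 : 0 <= A * K1 * `|w| by rewrite !mulr_ge0 // ltW.
  by lra.
have [|||s hs1 hs2] := hd `|w| alpha y.
- by rewrite nw0.
- exact: continuous_line.
- move=> s hs; split; first exact: yK.
  have -> : 'd F p (y s) = 'd F p w + s * (c + 'd F p w).
    by rewrite /y linearD linearZ linearD.
  have -> : 'd F p w + s * (c + 'd F p w) - c * (s - alpha) = s * 'd F p w.
    by rewrite /alpha; field.
  rewrite normrM; apply: (@le_trans _ _ (A * `|w| * (K1 * `|w|))).
    by apply: ler_pM => //; exact: sA.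
  rewrite expr2 mulrACA ler_wpM2r ?mulr_ge0 // /K lerDr.
  by rewrite !addr_ge0 // ?mulr_ge0 // ltW.
have sAw := sA s hs1.
have s2 : `|s| <= 2^-1.
  apply: le_trans sAw _; move: wA => /ltW; rewrite -[X in _ <= X]mul1r ler_pdivlMr ?mulr_gt0 //.
  lra.
have s1 : 0 < 1 + s by move: s2; rewrite ler_norml => /andP[? _]; lra.
have Hw : H (p + w) = (1 + s) ^- 2.
  apply: HS => //; have -> : (1 + s) *: (p + w) = p + y s.
    by rewrite /y scalerDl scale1r -addrA.
  apply/SF => //; apply: hU; apply: le_lt_trans (yK s hs1) _.
  by rewrite mulrC -ltr_pdivlMr.
rewrite Hw Hp innerZl -diff_inner //.
have -> : (1 + s) ^- 2 - 1 - 2 / c * 'd F p w =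
  ((1 + s) ^- 2 - 1 + 2 * s) - 2 * (s - alpha) by rewrite /alpha; ring.
apply: le_trans (ler_normB _ _) _; rewrite normrM (gtr0_norm (_ : 0 < 2 :> R)) //.
have h1 := inv_sqr_estimate s2.
have h2 : s ^+ 2 <= A ^+ 2 * `|w| ^+ 2.
  by rewrite -exprMn -real_normK ?num_real // ler_pXn2r // nnegrE mulr_ge0 // ltW.
have h3 : 16 * (A ^+ 2 * `|w| ^+ 2) <= e / 2 * `|w|.
  move: we => /ltW; rewrite ler_pdivlMr ?mulr_gt0 ?exprn_gt0 // => we.
  by have := ler_wpM2r (normr_ge0 w) we; rewrite [`|w| ^+ 2]expr2; lra.
by lra.
Qed.

End LocalEquation.
End SmoothHypersurface.

Section HasGradientTheory.
Variables (R : realType) (n : nat) (H : Cn R n -> R).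

Lemma is_derive_line_gradient (z g w : Cn R n) : has_gradient H z g ->
  is_derive (0 : R) (1 : R) (fun s => H (z + s *: w)) (inner g w).
Proof.
move=> hg; apply: (@is_derive_comp_gradient _ _ H (fun s => z + s *: w)).
  by rewrite scale0r addr0.
apply: eps_is_derive => e e0; exists 1 => // h _.
by rewrite add0r scale0r addr0 [z + _]addrC addrK subrr normr0 mulr_ge0 // ltW.
Qed.

Lemma has_gradient_unique (z g g' : Cn R n) :
  has_gradient H z g -> has_gradient H z g' -> g = g'.
Proof.
move=> h h'; apply: inner_inj => w.
by have [_ <-] := is_derive_line_gradient w h; have [_ <-] := is_derive_line_gradient w h'.
Qed.

Lemma has_gradient_scale (z g : Cn R n) (a : R) :
  (forall a z, H (a *: z) = a ^+ 2 * H z) -> a != 0 ->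
  has_gradient H z g -> has_gradient H (a *: z) (a *: g).
Proof.
move=> hom a0 hg e e0.
have na0 : 0 < `|a| by rewrite normr_gt0.
have e1 : 0 < e / `|a| by rewrite divr_gt0.
have [r r0 hr] := hg _ e1; exists (r * `|a|); first by rewrite mulr_gt0.
move=> w wr; have := hr (a^-1 *: w).
rewrite normrZ normfV [_^-1 * _]mulrC ltr_pdivrMr // => /(_ wr) hw.
have -> : a *: z + w = a *: (z + a^-1 *: w) by rewrite scalerDr scalerA mulfV // scale1r.
rewrite !hom; have -> : inner (a *: g) w = a ^+ 2 * inner g (a^-1 *: w).
  by rewrite innerZl innerZr; field.
rewrite -!mulrBr normrM normrX; apply: le_trans (ler_wpM2l (exprn_ge0 2 (ltW na0)) hw) _.
by rewrite le_eqVlt; apply/orP; left; apply/eqP; field; rewrite gt_eqF.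
Qed.

End HasGradientTheory.

(** * The squared gauge *)

Section Gauge.
Variables (R : realType) (n : nat) (S D : set (Cn R n)).
Hypothesis Dc : compact D.
Hypothesis D0 : D 0.
Hypothesis Dstar : forall p (t : R), D p -> 0 <= t <= 1 -> D (t *: p).
Hypothesis SE : S = closure D `\` interior D.
Hypothesis St : forall p, S p -> ~ tangent S p (liouville_field p).
Hypothesis Ssm : smooth_hypersurface S.
Hypothesis Sc : compact S.
Hypothesis Seven : forall p, S p -> S (- p).

Let S_neq0 p : S p -> p != 0.
Proof. by apply: contraPneq => ->; exact: star_not0 St. Qed.

Let radial_unique z (s t : R) : 0 < s -> 0 < t -> S (s *: z) -> S (t *: z) -> s = t.
Proof.
wlog st : s t / s <= t.
  by move=> h s0 t0 hs ht; case: (leP s t) => [/h|/ltW /h h1]; [exact|rewrite h1].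
move=> s0 t0 hs ht; apply/eqP; rewrite eq_le st /= leNgt; apply/negP => lst.
have h : 1 < t / s by rewrite ltr_pdivlMr // mul1r.
apply: (star_radial_unique Dc Dstar SE St hs h).
rewrite scalerA divfK ?gt_eqF //.
by have [] := (star_boundary Dc SE _).1 ht.
Qed.

Lemma gauge_exists : exists H : Cn R n -> R, H 0 = 0 /\
  forall z (t : R), 0 < t -> S (t *: z) -> H z = t ^- 2.
Proof.
have ex z : exists t : R, z != 0 -> 0 < t /\ S (t *: z).
  have [->|z0] := eqVneq z 0; first by exists 0.
  by have [t t0 St'] := star_radial_exists Dc D0 SE St z0; exists t.
have [t ht] := choice ex.
exists (fun z => if z == 0 then 0 else (t z) ^- 2); split; first by rewrite eqxx.
move=> z s s0 Ss; have z0 : z != 0.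
  by apply: contra (S_neq0 Ss) => /eqP ->; rewrite scaler0.
have [t0 St'] := ht z z0; rewrite (negbTE z0).
by rewrite (radial_unique t0 s0 St' Ss).
Qed.

Variable H : Cn R n -> R.
Hypothesis H0 : H 0 = 0.
Hypothesis HS : forall z (t : R), 0 < t -> S (t *: z) -> H z = t ^- 2.

Let radial z : z != 0 -> exists t : R, [/\ 0 < t, S (t *: z) & H z = t ^- 2].
Proof.
move=> z0; have [t t0 St'] := star_radial_exists Dc D0 SE St z0.
by exists t; split => //; exact: HS.
Qed.

Lemma gauge_eq1 p : S p <-> H p = 1.
Proof.
split=> [Sp|h]; first by rewrite (HS (t := 1)) ?scale1r // expr1n invr1.
have [p0|p0] := eqVneq p 0; first by move: h; rewrite p0 H0 => /esym/eqP; rewrite oner_eq0.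
have [t [t0 St' Ht]] := radial p0.
move: Ht; rewrite h => /(congr1 GRing.inv); rewrite invrK invr1 => /esym/eqP.
rewrite sqrf_eq1 => /orP[/eqP t1|/eqP t1]; first by move: St'; rewrite t1 scale1r.
by move: t0; rewrite t1 oppr_gt0 ltNge ler01.
Qed.

Lemma gauge_homogeneous a z : H (a *: z) = a ^+ 2 * H z.
Proof.
have [->|z0] := eqVneq z 0; first by rewrite scaler0 H0 mulr0.
have [->|a0] := eqVneq a 0; first by rewrite scale0r H0 expr0n mul0r.
have [t [t0 St' ->]] := radial z0.
have na0 : 0 < `|a| by rewrite normr_gt0.
rewrite (HS (t := t / `|a|)) ?divr_gt0 //.
  by rewrite expr_div_n invf_div real_normK ?num_real.
rewrite scalerA; have [a1|a1] := ltP 0 a.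
  by rewrite (gtr0_norm a1) divfK ?gt_eqF.
rewrite (ler0_norm a1) (_ : t / - a * a = - t); last by field.
by rewrite scaleNr; exact: Seven.
Qed.

Lemma gauge_bounds : exists c C : R, [/\ 0 < c, 0 < C &
  forall z, c * `|z| ^+ 2 <= H z <= C * `|z| ^+ 2].
Proof.
have [m [M [m0 M0 h]]] := star_bounds Dc D0 SE St.
exists (M ^- 2), (m ^- 2); split; rewrite ?invr_gt0 ?exprn_gt0 // => z.
have [->|z0] := eqVneq z 0; first by rewrite H0 normr0 expr0n !mulr0 lexx.
have [t [t0 St' ->]] := radial z0.
have := h _ St'; rewrite normrZ gtr0_norm // => /andP[h1 h2].
have e1 : `|z| / M <= t^-1 by rewrite ler_pdivrMr // ler_pdivlMl.
have e2 : t^-1 <= `|z| / m by rewrite ler_pdivlMr // ler_pdivrMl.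
have p0 : 0 <= t^-1 by rewrite invr_ge0 ltW.
rewrite mulrC -expr_div_n [m ^- 2 * _]mulrC -expr_div_n -exprVn.
by apply/andP; split; rewrite ler_pXn2r // nnegrE divr_ge0 // ltW.
Qed.

Lemma gauge_zero_gradient : has_gradient H 0 0.
Proof.
have [c [C [c0 C0 h]]] := gauge_bounds.
move=> e e0; exists (e / C); first by rewrite divr_gt0.
move=> w we; rewrite add0r H0 subr0 innerC inner0r subr0.
have /andP[h1 h2] := h w.
rewrite ger0_norm; last by apply: le_trans h1; rewrite mulr_ge0 ?exprn_ge0 // ltW.
apply: (le_trans h2); rewrite expr2 mulrA ler_wpM2r // mulrC.
by rewrite -ler_pdivlMr // ltW.
Qed.

(** One local equation serves all nearby points of [S] at once, so the gradient has a formula there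
    that is continuous at [p]. *)
Lemma gauge_local_gradient p : S p -> exists (V : set (Cn R n)) (G : Cn R n -> Cn R n),
  [/\ open V, V p, {for p, continuous G} &
      forall q, V q -> S q -> has_gradient H q (G q)].
Proof.
move=> Sp; have [U [F [oU Up sF SF Fv]]] := Ssm Sp.
have dF x : differentiable F x by exact: (sF [::] x).
have c0 := radial_derivative_neq0 oU sF SF Up Sp Fv (St Sp).
pose dr q := inner (gradient F q) q.
have drc : continuous dr.
  move=> q; apply: continuous_sum => j.
  have [x1 y1] := continuous_pair_coord j (@smooth_continuous_gradient _ _ _ sF q).
  have [x2 y2] := @continuous_pair_coord _ _ _ id q j cvg_id.
  apply: continuousD; apply: continuousM; [exact: x1|exact: x2|exact: y1|exact: y2].
pose V := U `&` dr @^-1` [set t | t != 0].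
exists V, (fun q => (2 / dr q) *: gradient F q); split.
- apply: openI => //; apply: open_comp; first by move=> q _; exact: drc.
  exact: open_neq.
- by split => //=; rewrite /dr -diff_inner.
- apply: continuousZ; last exact: smooth_continuous_gradient.
  apply: (@continuousM _ _ (cst 2) (fun q => (dr q)^-1)); first exact: cvg_cst.
  apply: (@continuous_comp _ _ _ dr); first exact: drc.
  by apply: inv_continuous; rewrite /dr -diff_inner.
move=> q [Uq /= dq] Sq; rewrite /dr -diff_inner //.
by apply: (gauge_gradient oU sF SF HS Uq Sq); rewrite diff_inner.
Qed.

Lemma gauge_gradient_exists z : exists g, has_gradient H z g.
Proof.
have [->|z0] := eqVneq z 0; first by exists 0; exact: gauge_zero_gradient.
have [t [t0 St' _]] := radial z0.
have [V [G [_ Vp _ hG]]] := gauge_local_gradient St'.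
exists (t^-1 *: G (t *: z)).
have ti : t^-1 != 0 by rewrite invr_eq0 gt_eqF.
have E : t^-1 *: (t *: z) = z by rewrite scalerA mulVf ?scale1r ?gt_eqF.
by have := has_gradient_scale gauge_homogeneous ti (hG _ Vp St'); rewrite E.
Qed.

Lemma gauge_gt0 z : z != 0 -> 0 < H z.
Proof. by move=> /radial [t [t0 _ ->]]; rewrite invr_gt0 exprn_gt0. Qed.

Lemma gauge_sqrt z : z != 0 -> S ((Num.sqrt (H z))^-1 *: z).
Proof.
move=> /radial [t [t0 St' ->]].
by rewrite -exprVn sqrtr_sqr ger0_norm ?invr_ge0 ?ltW // invrK.
Qed.

(** Away from the origin, homogeneity expresses [gr y] through the radial projection of [y] to [S],
    where the local formula applies. At the origin a linear bound on [gr], from compactness of [S],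
    suffices. *)
Lemma gauge_continuous_gradient gr : (forall z, has_gradient H z (gr z)) -> continuous gr.
Proof.
move=> hgr.
have Hc : continuous H by move=> z; exact: has_gradient_continuous (hgr z).
have sc : continuous (fun z => Num.sqrt (H z)).
  by move=> z; apply: (@continuous_comp _ _ _ H Num.sqrt); [exact: Hc | exact: sqrt_continuous].
have sq0 z : z != 0 -> Num.sqrt (H z) != 0.
  by move=> z0; rewrite gt_eqF // sqrtr_gt0 gauge_gt0.
have grZ a z : a != 0 -> gr (a *: z) = a *: gr z.
  move=> a0; apply: has_gradient_unique (hgr _) _.
  by apply: has_gradient_scale => //; exact: gauge_homogeneous.
have proj z : z != 0 -> {for z, continuous (fun y => (Num.sqrt (H y))^-1 *: y)}.
  move=> z0; apply: continuousZ; last exact: cvg_id.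
  apply: (@continuous_comp _ _ _ (fun z => Num.sqrt (H z))); first exact: sc.
  by apply: inv_continuous; exact: sq0.
have grc z : z != 0 -> {for z, continuous gr}.
  move=> z0; have Sp := gauge_sqrt z0.
  have [V [G [oV Vp Gc hG]]] := gauge_local_gradient Sp.
  have loc : \forall y \near z, V ((Num.sqrt (H y))^-1 *: y) /\ y != 0.
    apply: filterI.
      by apply: proj => //; apply: open_nbhs_nbhs.
    exact: (@cvgr_neq0 R (Cn R n) _ (nbhs z) _ id z cvg_id z0).
  have E : {near z, (fun y => Num.sqrt (H y) *: G ((Num.sqrt (H y))^-1 *: y)) =1 gr}.
    apply: filterS loc => y [Vy y0].
    rewrite -(has_gradient_unique (hgr _) (hG _ Vy (gauge_sqrt y0))).
    by rewrite grZ ?invr_eq0 ?sq0 // scalerA mulfV ?sq0 // scale1r.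
  have c : {for z, continuous (fun y => Num.sqrt (H y) *: G ((Num.sqrt (H y))^-1 *: y))}.
    apply: continuousZ; first exact: sc.
    by apply: (@continuous_comp _ _ _ (fun y => (Num.sqrt (H y))^-1 *: y) G); [exact: proj|exact: Gc].
  have Ez : Num.sqrt (H z) *: G ((Num.sqrt (H z))^-1 *: z) = gr z := nbhs_singleton E.
  have c' : (fun y => Num.sqrt (H y) *: G ((Num.sqrt (H y))^-1 *: y)) @ z --> gr z.
    by rewrite -Ez; exact: c.
  exact: (cvg_trans (near_eq_cvg E) c').
have [B B0 hB] : exists2 B : R, 0 < B & forall p, S p -> `|gr p| <= B.
  have /compact_bounded [M [Mr hM]] : compact (gr @` S).
    apply: continuous_compact => //; apply: continuous_in_subspaceT => p /set_mem Sp.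
    by apply: grc; exact: S_neq0.
  exists (`|M| + 1); first by rewrite ltr_wpDl.
  move=> x Sx; apply: (hM (`|M| + 1)); last by exists x.
  by rewrite (le_lt_trans (ler_norm M)) // ltrDl.
have gr0 : gr 0 = 0 := has_gradient_unique (hgr 0) gauge_zero_gradient.
have [m [M [m0 M0 hm]]] := star_bounds Dc D0 SE St.
have gr_le z : `|gr z| <= B / m * `|z|.
  have [->|z0] := eqVneq z 0; first by rewrite gr0 !normr0 mulr0.
  have [t [t0 St' _]] := radial z0.
  have := hB _ St'; have /andP[h1 _] := hm _ St'.
  rewrite grZ ?gt_eqF // !normrZ (gtr0_norm t0) in h1 *.
  move=> h2; rewrite mulrAC ler_pdivlMr // -(ler_pM2l t0) mulrA [t * (B * _)]mulrCA.
  by apply: ler_pM => //; rewrite ?mulr_ge0 // ltW.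
move=> z; have [->|/grc //] := eqVneq z 0.
apply/cvgrPdist_lt => e e0.
have d0 : 0 < e / (B / m) by rewrite !divr_gt0.
apply: filterS (nbhsx_ballx (0 : Cn R n) _ d0) => y.
rewrite -ball_normE /= gr0 !sub0r !normrN => h.
by apply: le_lt_trans (gr_le y) _; rewrite mulrC -ltr_pdivlMr ?divr_gt0.
Qed.

End Gauge.

Lemma star_shaped_hamiltonian (R : realType) (n : nat) (S : set (Cn R n)) :
  star_shaped_hypersurface S -> compact S -> (forall p, S p -> S (- p)) ->
  exists (H : Cn R n -> R) (gr : Cn R n -> Cn R n) (c0 : R),
    hamiltonian H gr c0 /\ forall p, S p <-> H p = 1.
Proof.
move=> [D [Dc D0 Dstar SE [Ssm St]]] Sc Seven.
have Dstar' p (t : R) : D p -> 0 <= t <= 1 -> D (t *: p) by exact: Dstar.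
have [H [H0 HS]] := gauge_exists Dc D0 Dstar' SE St.
have [gr hgr] := choice (gauge_gradient_exists Dc D0 SE St Ssm Seven H0 HS).
have [c [C [c0 _ hc]]] := gauge_bounds Dc D0 SE St H0 HS.
exists H, gr, c; split; last by move=> p; exact: (gauge_eq1 Dc D0 SE St H0 HS).
split => //.
- exact: (gauge_continuous_gradient Dc D0 SE St Ssm Sc Seven H0 HS hgr).
- exact: (gauge_homogeneous Dc D0 SE St Seven H0 HS).
- by move=> z; have /andP[] := hc z.
Qed.

(** * Loops in the quotient *)

Lemma uniform_below (R : realType) (m : nat) (P : nat -> R -> Prop) :
  (forall j e e', 0 < e' -> e' <= e -> P j e -> P j e') ->
  (forall j, (j < m)%N -> exists2 e : R, 0 < e & P j e) ->
  exists2 e : R, 0 < e & forall j, (j < m)%N -> P j e.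
Proof.
move=> mono; elim: m => [|m IH] h; first by exists 1.
have [|e1 e10 h1] := IH; first by move=> j jm; apply: h; exact: leqW.
have [e2 e20 h2] := h m (ltnSn m).
have e0 : 0 < Num.min e1 e2 by rewrite lt_min e10.
exists (Num.min e1 e2) => // j; rewrite ltnS leq_eqVlt => /orP[/eqP ->|jm].
  by apply: mono h2 => //; rewrite ge_min lexx orbT.
by apply: mono (h1 j jm) => //; rewrite ge_min lexx.
Qed.

(** * The cyclic action and its quotient *)

Section CyclicAction.
Variables (R : realType) (n m : nat) (k : 'I_n -> int).
Hypothesis m_gt0 : (0 < m)%N.
Hypothesis k_coprime : forall j, coprimez (k j) m%:Z.

Notation act j := (iter j (phi m k)).

Let m_neq0 : m%:R != 0 :> R.
Proof. by rewrite pnatr_eq0 -lt0n. Qed.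

Lemma act_xc j (p : Cn R n) l : xc (act j p) l =
  cos (j%:R * rot_angle R m k l) * xc p l - sin (j%:R * rot_angle R m k l) * yc p l.
Proof. by rewrite iter_phi /xc !mxE. Qed.

Lemma act_yc j (p : Cn R n) l : yc (act j p) l =
  sin (j%:R * rot_angle R m k l) * xc p l + cos (j%:R * rot_angle R m k l) * yc p l.
Proof. by rewrite iter_phi /yc !mxE. Qed.

Lemma Cn_eqP (p q : Cn R n) : (forall l, xc p l = xc q l /\ yc p l = yc q l) -> p = q.
Proof.
move=> h; rewrite [p]surjective_pairing [q]surjective_pairing.
by congr pair; apply/rowP => l; have [] := h l.
Qed.

Lemma act_mod j (p : Cn R n) : act (j %% m) p = act j p.
Proof.
apply: Cn_eqP => l; rewrite !act_xc !act_yc.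
have -> : j%:R * rot_angle R m k l =
    (j %% m)%N%:R * rot_angle R m k l + 2 * pi * ((j %/ m)%:Z * k l)%:~R.
  rewrite {1}(divn_eq j m) natrD natrM /rot_angle intrM -pmulrn; field.
  exact: m_neq0.
rewrite cosD sinD; have [-> ->] := cos_sin_2piZ R ((j %/ m)%:Z * k l).
by split; ring.
Qed.

Lemma actB j (p q : Cn R n) : act j (p - q) = act j p - act j q.
Proof.
have xcB (u v : Cn R n) l : xc (u - v) l = xc u l - xc v l by rewrite /xc !mxE.
have ycB (u v : Cn R n) l : yc (u - v) l = yc u l - yc v l by rewrite /yc !mxE.
by apply: Cn_eqP => l; rewrite !(xcB, ycB, act_xc, act_yc); split; ring.
Qed.

Lemma act_norm j (p : Cn R n) : `|act j p| <= 2 * `|p|.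
Proof.
have c (x : R) : `|cos x| <= 1 by rewrite ler_norml cos_geN1 cos_le1.
have s (x : R) : `|sin x| <= 1 by rewrite ler_norml sin_geN1 sin_le1.
have b l : `|xc (act j p) l| <= 2 * `|p| /\ `|yc (act j p) l| <= 2 * `|p|.
  have [x1 y1] := Cn_norm_coord p l.
  rewrite act_xc act_yc; split.
    apply: le_trans (ler_normB _ _) _; rewrite !normrM [2]mulr2n mulrDl mul1r.
    by apply: lerD; rewrite -[leRHS]mul1r ler_pM.
  apply: le_trans (ler_normD _ _) _; rewrite !normrM [2]mulr2n mulrDl mul1r.
  by apply: lerD; rewrite -[leRHS]mul1r ler_pM.
rewrite prod_normE ge_max; apply/andP; split; apply: mx_norm_le.
- by rewrite mulr_ge0.
- by move=> i l; rewrite [i]ord1; exact: (b l).1.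
- by rewrite mulr_ge0.
- by move=> i l; rewrite [i]ord1; exact: (b l).2.
Qed.

Lemma act_continuous j : continuous (fun p : Cn R n => act j p).
Proof.
move=> p; apply/cvgrPdist_lt => e e0.
have e2 : 0 < e / 2 by rewrite divr_gt0.
apply: filterS (nbhsx_ballx p _ e2) => q; rewrite -ball_normE /= => pq.
by rewrite -actB; apply: le_lt_trans (act_norm _ _) _; rewrite mulrC -ltr_pdivlMr.
Qed.

(** By coprimality [j * k l] leaves a remainder [0 < r < m] modulo [m]; the half angle [pi r / m]
    has positive sine, and [cos (2 x) = 1 - 2 sin^2 x]. *)
Lemma cos_neq1 (j : nat) l : (0 < j < m)%N -> cos (j%:R * rot_angle R m k l) != 1.
Proof.
move=> /andP[j0 jm].
pose a := (j%:Z * k l)%R; pose r := (a %% m%:Z)%Z.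
have mz : m%:Z != 0 by rewrite eqz_nat -lt0n.
have r0 : r != 0.
  apply/negP => /eqP /dvdz_mod0P; rewrite /a Gauss_dvdzl.
    by rewrite dvdzE /= => /(dvdn_leq j0); rewrite leqNgt jm.
  by rewrite coprimez_sym; exact: k_coprime.
have rge : (0 <= r)%R by exact: modz_ge0.
have rlt : (r < m%:Z)%R by apply: ltz_pmod; rewrite ltz_nat.
have -> : j%:R * rot_angle R m k l = 2 * pi * r%:~R / m%:R + 2 * pi * (a %/ m%:Z)%Z%:~R.
  have : a%:~R = (a %/ m%:Z)%Z%:~R * m%:R + r%:~R :> R.
    by rewrite {1}(divz_eq a m%:Z) intrD intrM -pmulrn.
  rewrite /a intrM -pmulrn => h.
  have -> : j%:R * rot_angle R m k l = 2 * pi * (j%:R * (k l)%:~R) / m%:R.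
    by rewrite /rot_angle; field; exact: m_neq0.
  by rewrite h; field; exact: m_neq0.
rewrite cosD; have [-> ->] := cos_sin_2piZ R (a %/ m%:Z)%Z.
rewrite mulr1 mulr0 subr0.
have m0 : 0 < m%:R :> R by rewrite ltr0n.
have -> : 2 * pi * r%:~R / m%:R = (pi * r%:~R / m%:R) *+ 2 :> R.
  by rewrite -mulr_natl; ring.
have : 0 < sin (pi * r%:~R / m%:R) :> R.
  have rp : 0 < r%:~R :> R by rewrite ltr0z lt_neqAle eq_sym r0 rge.
  apply: sin_gt0_pi; apply/andP; split; first by rewrite divr_gt0 // mulr_gt0 ?pi_gt0.
  by rewrite ltr_pdivrMr // ltr_pM2l ?pi_gt0 // pmulrn ltr_int.
rewrite cos_mulr2n => sp; apply/eqP => h.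
have := cos2Dsin2 (pi * r%:~R / m%:R : R).
have : 0 < sin (pi * r%:~R / m%:R) ^+ 2 :> R by rewrite exprn_gt0.
by lra.
Qed.

Lemma act_free j (p : Cn R n) : p != 0 -> (0 < j < m)%N -> act j p != p.
Proof.
move=> p0 jm; apply: contra p0 => /eqP h; apply/eqP/Cn_eqP => l.
have hx := act_xc j p l; have hy := act_yc j p l; rewrite h in hx hy.
have c1 := cos_neq1 l jm.
set c := cos _ in hx hy c1; set s := sin _ in hx hy.
have cs : c ^+ 2 + s ^+ 2 = 1 by exact: cos2Dsin2.
have e : (1 - c) * (xc p l ^+ 2 + yc p l ^+ 2) = 0.
  have -> : (1 - c) * (xc p l ^+ 2 + yc p l ^+ 2) =
    xc p l * (xc p l - (c * xc p l - s * yc p l)) +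
    yc p l * (yc p l - (s * xc p l + c * yc p l)) by ring.
  by rewrite -hx -hy !subrr !mulr0 addr0.
move/eqP: e; rewrite mulf_eq0 subr_eq0 eq_sym (negbTE c1) /=.
rewrite paddr_eq0 ?sqr_ge0 // !sqrf_eq0 => /andP[/eqP -> /eqP ->].
by rewrite /xc /yc !mxE.
Qed.

(** The total angle in coordinate [l] is [pi * k l], and [k l] is odd since it is coprime to an even
    number. *)
Lemma act_half (p : Cn R n) : ~~ odd m -> act m./2 p = - p.
Proof.
move=> me; apply: Cn_eqP => l.
have mh : m = (m./2 * 2)%N by rewrite muln2 -[LHS]odd_double_half (negbTE me).
have h0 : m./2%:R != 0 :> R.
  by rewrite pnatr_eq0; apply: contraTneq m_gt0 => h; rewrite mh h.
have -> : xc (- p) l = - xc p l by rewrite /xc !mxE.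
have -> : yc (- p) l = - yc p l by rewrite /yc !mxE.
rewrite act_xc act_yc.
have [q hq] : exists q : int, k l = 2 * q + 1.
  have := k_coprime l; rewrite mh => co.
  have : ~~ (2 %| k l)%Z.
    apply/negP => d2; have : (2 %| gcdz (k l) (m./2 * 2)%N%:Z)%Z.
      by rewrite dvdz_gcd d2 /= PoszM dvdz_mull.
    by rewrite (eqP co).
  move=> nd; exists (k l %/ 2)%Z.
  rewrite {1}(divz_eq (k l) 2) mulrC; congr (_ + _).
  have : (0 <= k l %% 2 < 2)%Z by rewrite modz_ge0 //= ltz_pmod.
  move: nd; rewrite dvdz_eq; have := divz_eq (k l) 2.
  move=> e1 e2; case: (_ %% _)%Z e1 => [[|[|r]]|r] //= e1.
  by rewrite addr0 in e1; rewrite -e1 eqxx in e2.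
have -> : m./2%:R * rot_angle R m k l = pi + 2 * pi * q%:~R.
  rewrite /rot_angle hq {2}mh natrM intrD intrM; field.
  exact: h0.
rewrite cosD sinD; have [-> ->] := cos_sin_2piZ R q.
by rewrite cospi sinpi; split; ring.
Qed.

Lemma zm_proj_eq (p q : Cn R n) : zm_proj m k p = zm_proj m k q <-> exists j, q = act j p.
Proof.
split.
  by move=> /eqmodP /asboolP.
by move=> h; apply/eqmodP/asboolP.
Qed.

Lemma zm_proj_act j (p : Cn R n) : zm_proj m k (act j p) = zm_proj m k p.
Proof. by symmetry; apply/zm_proj_eq; exists j. Qed.

Lemma zm_proj_open (B : set (Cn R n)) : open B -> open (zm_proj m k @` B).
Proof.
move=> oB; rewrite /open /= /quotient_open.
have -> : \pi_(Cn_mod R m k)%qT @^-1` (zm_proj m k @` B) =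
    \bigcup_j ((fun p : Cn R n => act j p) @^-1` B).
  apply/seteqP; split => [p [b Bb /esym /zm_proj_eq [j bj]]|p [j _ Bp]].
    by exists j => //=; rewrite -bj.
  by exists (act j p) => //; exact: zm_proj_act.
by apply: bigcup_open => j _; apply: open_comp => // p _; exact: act_continuous.
Qed.

Variable S : set (Cn R n).
Hypothesis Sc : compact S.
Hypothesis S0 : ~ S 0.
Hypothesis Sphi : phi m k @` S = S.

Lemma act_S j p : S p -> S (act j p).
Proof.
by move=> Sp; elim: j => //= j IH; rewrite -Sphi; exists (act j p).
Qed.

Lemma S_neq0 p : S p -> p != 0.
Proof. by apply: contraPneq => ->. Qed.

(** Freeness and compactness of [S] bound the displacement of each nontrivial power from below, and
    modulo [m] there are finitely many powers. *)
Lemma act_separated : exists2 e : R, 0 < e &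
  forall p j, S p -> `|act j p - p| < e -> act j p = p.
Proof.
pose P (j : nat) (e : R) := (0 < j)%N -> forall p, S p -> e <= `|act j p - p|.
have [e e0 he] : exists2 e : R, 0 < e & forall j, (j < m)%N -> P j e.
  apply: uniform_below.
    by move=> j e e' _ ee' h j0 p Sp; apply: le_trans ee' (h j0 p Sp).
  move=> j jm; have [->|j0] := posnP j; first by exists 1.
  pose Q (e : R) (p : Cn R n) := e <= `|act j p - p|.
  have [||e e0 he] := @compact_uniform R _ S Q Sc.
  - by move=> e e' y _; exact: le_trans.
  - move=> x Sx; set a := `|act j x - x|.
    have a0 : 0 < a by rewrite normr_gt0 subr_eq0 act_free ?S_neq0 // j0.
    (* As [act j] at most doubles norms, the displacement varies by at most [3 |x - y|]. *)
    exists (a / 4); first by rewrite divr_gt0.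
    move=> y _ xy; rewrite /Q.
    have h1 := act_norm j (x - y).
    have : a <= `|act j y - y| + (`|act j (x - y)| + `|x - y|).
      have -> : a = `|(act j y - y) + (act j (x - y) - (x - y))|.
        rewrite actB /a; congr `|_|; rewrite addrACA [act j y + _]addrC subrK.
        by rewrite opprB addKr.
      apply: le_trans (ler_normD _ _) _; rewrite lerD2l; exact: ler_normB.
    by lra.
  by exists e => // _; exact: he.
exists e => // p j Sp; rewrite -act_mod => h.
have jm : (j %% m < m)%N by rewrite ltn_mod.
have [->//|jp] := posnP (j %% m)%N.
by have := he _ jm jp p Sp; rewrite leNgt h.
Qed.

End CyclicAction.

(** * Lifting a homotopy on a grid *)

Section GridLifting.
Variables (R : realType) (n m : nat) (k : 'I_n -> int) (S : set (Cn R n)).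
Hypothesis m_gt0 : (0 < m)%N.
Hypothesis m_even : ~~ odd m.
Hypothesis k_coprime : forall j, coprimez (k j) m%:Z.
Hypothesis Sc : compact S.
Hypothesis S0 : ~ S 0.
Hypothesis Sphi : phi m k @` S = S.

Notation proj := (zm_proj m k).
Notation act j := (iter j (phi m k)).

Lemma S_opp (p : Cn R n) : S p -> S (- p).
Proof. by move=> Sp; rewrite -(act_half m_gt0 k_coprime p m_even); exact: act_S. Qed.

Lemma proj_opp (p : Cn R n) : proj (- p) = proj p.
Proof. by rewrite -(act_half m_gt0 k_coprime p m_even) zm_proj_act. Qed.

Lemma proj_inv_S (p : Cn R n) : (proj @` S) (proj p) -> S p.
Proof. by move=> [q Sq /zm_proj_eq [j ->]]; exact: act_S. Qed.

Variables (T : R) (H : R * R -> Cn_mod R m k).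
Hypothesis T0 : 0 < T.
Let K := `[0, 1]%classic `*` `[0, T]%classic : set (R * R).
Hypothesis Hc : {within K, continuous H}.
Hypothesis HS : forall x, K x -> (proj @` S) (H x).

Lemma compact_rectangle : compact K.
Proof. by apply: compact_setX; exact: segment_compact. Qed.

(** The projection is open, so points near [H x0] have lifts near [p0]. Any other lift of [H x] is a
    translate of the one near [p0], and translation at most doubles distances; hence the radius
    [e / 4]. *)
Lemma uniform_lift (e : R) : 0 < e -> exists2 d : R, 0 < d &
  forall x y, K x -> K y -> `|x - y| < d ->
    forall p : Cn R n, proj p = H x -> exists2 q : Cn R n, proj q = H y & `|q - p| < e.
Proof.
move=> e0.
pose P (d : R) (x : R * R) := forall y, K y -> `|x - y| < d ->
  forall p : Cn R n, proj p = H x -> exists2 q : Cn R n, proj q = H y & `|q - p| < e.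
have [||d d0 hd] := @compact_uniform R _ K P compact_rectangle.
- by move=> d d' x _ dd' h y Ky xy; apply: h => //; exact: lt_le_trans dd'.
- move=> x0 Kx0; have [p0 Sp0 p0x] := HS Kx0.
  have e4 : 0 < e / 4 by rewrite divr_gt0.
  have : nbhs (H x0) (proj @` ball p0 (e / 4)).
    apply: open_nbhs_nbhs; split; first by apply: zm_proj_open; exact: ball_open.
    by exists p0 => //; exact: ballxx.
  move/subspace_continuousP: Hc => /(_ x0 Kx0) h /h.
  rewrite /= /within /= => /nbhs_ballP [r /= r0 hr].
  exists (r / 2); first by rewrite divr_gt0.
  move=> x Kx x0x y Ky xy p px.
  have r2 : r / 2 <= r by rewrite ler_pdivrMr // ler_pMr // ler1n.
  have [b1 b1p b1x] : (proj @` ball p0 (e / 4)) (H x).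
    by apply: hr => //; rewrite -ball_normE /=; exact: lt_le_trans r2.
  have [b2 b2p b2y] : (proj @` ball p0 (e / 4)) (H y).
    apply: hr => //; rewrite -ball_normE /= -(subrKA x) [r]splitr.
    by apply: le_lt_trans (ler_normD _ _) _; exact: ltrD.
  have [j pj] : exists j, p = act j b1 by apply/zm_proj_eq; rewrite b1x px.
  exists (act j b2); first by rewrite zm_proj_act.
  rewrite pj -actB; apply: le_lt_trans (act_norm _ _ _ _) _.
  move: b1p b2p; rewrite -!ball_normE /= => b1p b2p.
  have : `|b2 - b1| <= `|p0 - b2| + `|p0 - b1|.
    rewrite -(subrKA p0) [X in _ <= X + _]distrC; exact: ler_normD.
  by lra.
by exists d => // x y Kx Ky xy; exact: hd.
Qed.

Hypothesis H_end : forall s, 0 <= s <= T -> H (1, s) = H (1, 0).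
Hypothesis H_loop : forall t, 0 <= t <= 1 -> H (t, 0) = H (t, T).

Variable g : R -> Cn R n.
Hypothesis g_cont : continuous g.
Hypothesis H_start : forall s, 0 <= s <= T -> H (0, s) = proj (g s).

(* On a fine grid [H] is lifted row by row; the relation [w N = - w 0] between the ends of a
   lifted row propagates, but the last row lifts a constant loop. *)
Lemma no_antipodal_lift : g T <> - g 0.
Proof.
move=> gT.
have [e0 e00 sep] := act_separated m_gt0 k_coprime Sc S0.
have sepE (p q : Cn R n) : S p -> proj p = proj q -> `|q - p| < e0 -> q = p.
  by move=> Sp /zm_proj_eq [j ->]; exact: sep.
(* The longest comparison of two lifts below is a chain of four moves, each shorter than [e]. *)
pose e := e0 / 4; have ep : 0 < e by rewrite divr_gt0.
have [d1 d10 hd1] := uniform_lift ep.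
have [d2 d20 hd2] : exists2 d : R, 0 < d & forall s t, 0 <= s <= T -> `|s - t| < d -> `|g t - g s| < e.
  pose P (d : R) (s : R) := forall t, `|s - t| < d -> `|g t - g s| < e.
  have [||d d0 hd] := @compact_uniform R _ _ P (@segment_compact R 0 T).
  - by move=> d d' x _ dd' h t st; apply: h; exact: lt_le_trans dd'.
  - move=> x _; have e2 : 0 < e / 2 by rewrite divr_gt0.
    have gx : {for x, continuous g} by exact: g_cont.
    move/cvgrPdist_lt: gx => /(_ _ e2) /nbhs_ballP [r /= r0 hr].
    exists (r / 2); first by rewrite divr_gt0.
    move=> s _ xs t st.
    have h1 : `|g x - g s| < e / 2.
      apply: hr; rewrite -ball_normE /=; apply: lt_le_trans xs _.
      by rewrite ler_pdivrMr // ler_pMr // ler1n.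
    have h2 : `|g x - g t| < e / 2.
      apply: hr; rewrite -ball_normE /= -(subrKA s) [r]splitr.
      by apply: le_lt_trans (ler_normD _ _) _; exact: ltrD.
    rewrite -(subrKA (g x)) [e]splitr; apply: le_lt_trans (ler_normD _ _) _.
    by apply: ltrD => //; rewrite distrC.
  by exists d => // s t hs; apply: hd; rewrite /= in_itv.
pose d := Num.min d1 d2; have d0 : 0 < d by rewrite lt_min d10.
pose N := (Num.truncn ((1 + T) / d)).+1.
have N0 : 0 < N%:R :> R by rewrite ltr0n.
have hN : (1 + T) / N%:R < d.
  by rewrite ltr_pdivrMr // mulrC -ltr_pdivrMr //; exact: truncnS_gt.
have iN : N%:R^-1 < d.
  by apply: le_lt_trans hN; rewrite mulrDl mul1r lerDl divr_ge0 // ltW.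
have TN : T / N%:R < d.
  by apply: le_lt_trans hN; rewrite mulrDl mul1r lerDr invr_ge0 ltW.
pose x i : R := i%:R / N%:R; pose y l : R := l%:R * T / N%:R.
have x01 i : (i <= N)%N -> 0 <= x i <= 1.
  by move=> h; rewrite /x divr_ge0 ?ler0n //= ler_pdivrMr // mul1r ler_nat.
have y0T l : (l <= N)%N -> 0 <= y l <= T.
  move=> h; rewrite /y divr_ge0 ?mulr_ge0 ?ler0n ?(ltW T0) //= ler_pdivrMr // mulrC.
  by rewrite ler_pM2l // ler_nat.
have KN i l : (i <= N)%N -> (l <= N)%N -> K (x i, y l).
  by move=> hi hl; split; rewrite /= in_itv /= ?x01 ?y0T.
have y0 : y 0%N = 0 by rewrite /y mul0r mul0r.
have yN : y N = T by rewrite /y mulrC mulKf // gt_eqF.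
have x0 : x 0%N = 0 by rewrite /x mul0r.
have xN : x N = 1 by rewrite /x divff // gt_eqF.
have dx i l : `|(x i, y l) - (x i.+1, y l)| < d1.
  rewrite prod_normE /= subrr normr0 gt_max d10 andbT.
  have -> : x i - x i.+1 = - N%:R^-1 by rewrite /x -natr1; field; rewrite gt_eqF.
  by rewrite normrN gtr0_norm ?invr_gt0 // (lt_le_trans iN) // ge_min lexx.
have dy l : `|y l - y l.+1| < d.
  have -> : y l - y l.+1 = - (T / N%:R) by rewrite /y -natr1; field; rewrite gt_eqF.
  by rewrite normrN gtr0_norm ?divr_gt0.
have dy1 i l : `|(x i, y l) - (x i, y l.+1)| < d1.
  rewrite prod_normE /= subrr normr0 gt_max d10 /=.
  by rewrite (lt_le_trans (dy l)) // ge_min lexx.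
have HSp i l (p : Cn R n) : (i <= N)%N -> (l <= N)%N -> proj p = H (x i, y l) -> S p.
  by move=> hi hl hp; apply: proj_inv_S; rewrite hp; apply: HS; exact: KN.
have row i : (i <= N)%N -> exists w : nat -> Cn R n,
  [/\ forall l, (l <= N)%N -> proj (w l) = H (x i, y l),
      forall l, (l < N)%N -> `|w l.+1 - w l| < e & w N = - w 0%N].
  elim: i => [_|i IH iN'].
    exists (fun l => g (y l)); split.
    - by move=> l lN; rewrite x0 H_start // y0T.
    - move=> l lN; apply: hd2; first by rewrite y0T // ltnW.
      by rewrite (lt_le_trans (dy l)) // ge_min lexx orbT.
    - by rewrite y0 yN.
  have [w [w1 w2 w3]] := IH (ltnW iN').
  have ex l : exists q : Cn R n, (l <= N)%N -> proj q = H (x i.+1, y l) /\ `|q - w l| < e.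
    have [lN|lN] := leqP l N; last by exists 0.
    have [q q1 q2] := hd1 _ _ (KN _ _ (ltnW iN') lN) (KN _ _ iN' lN) (dx i l) _ (w1 l lN).
    by exists q.
  have [w' hw'] := choice ex.
  exists w'; split.
  - by move=> l /hw' [].
  (* The new row is chosen pointwise near the old one. Its gaps are again below [e], because
     [w' l.+1] and the lift [q] next to [w' l] lie over one point within [4 e], hence coincide. *)
  - move=> l lN; have [a1 a2] := hw' _ (ltnW lN); have [b1 b2] := hw' _ lN.
    have [q q1 q2] := hd1 _ _ (KN _ _ iN' (ltnW lN)) (KN _ _ iN' lN) (dy1 i.+1 l) _ a1.
    have -> : w' l.+1 = q.
      apply: sepE; [exact: HSp q1 | by rewrite q1 b1 |].
      have -> : w' l.+1 - q = (w' l.+1 - w l.+1) + (w l.+1 - w l) + (w l - w' l) + (w' l - q).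
        by rewrite !addrA !subrK.
      apply: le_lt_trans (ler_normD _ _) _.
      apply: le_lt_trans (lerD (ler_normD _ _) (lexx _)) _.
      apply: le_lt_trans (lerD (lerD (ler_normD _ _) (lexx _)) (lexx _)) _.
      have := w2 l lN; rewrite (distrC (w l)) (distrC (w' l) q) => c2.
      by move: a2 b2 c2 q2; rewrite /e; lra.
    exact: q2.
  (* Each row of [H] is a loop and opposite points have the same projection, so [w' N] and [- w' 0]
     lie over one point; being within [2 e] they are equal. *)
  - have [a1 a2] := hw' _ (leq0n N); have [b1 b2] := hw' _ (leqnn N).
    apply: sepE.
    + by apply: S_opp; exact: HSp a1.
    + by rewrite proj_opp a1 b1 y0 yN H_loop // x01.
    have -> : w' N - - w' 0%N = (w' N - w N) + (w' 0%N - w 0%N).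
      by rewrite w3 !opprK addrACA subrr addr0.
    by apply: le_lt_trans (ler_normD _ _) _; move: a2 b2; rewrite /e; lra.
have [w [w1 w2 w3]] := row N (leqnn N).
have const l : (l <= N)%N -> w l = w 0%N.
  elim: l => // l IH lN; have lN' := ltnW lN; rewrite -(IH lN'); apply: sepE.
  - exact: HSp (leqnn N) lN' (w1 _ lN').
  - by rewrite (w1 _ lN) (w1 _ lN') xN (H_end (y0T _ lN)) (H_end (y0T _ lN')).
  - by apply: lt_le_trans (w2 l lN) _; rewrite /e ler_pdivrMr // ler_pMr // ler1n.
have Sw : S (w 0%N) by exact: HSp (w1 _ (leq0n N)).
have := const N (leqnn N); rewrite w3 => /esym/eqP; rewrite -addr_eq0 -mulr2n -scaler_nat.
rewrite scaler_eq0 pnatr_eq0 /= => /eqP w0.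
by apply: S0; rewrite -w0.
Qed.

End GridLifting.

Lemma antipodal_not_nullhomotopic (R : realType) (n m : nat) (k : 'I_n -> int)
    (S : set (Cn R n)) (g : R -> Cn R n) (T : R) :
  (0 < m)%N -> ~~ odd m -> (forall j, coprimez (k j) m%:Z) -> compact S -> ~ S 0 ->
  phi m k @` S = S -> 0 < T -> continuous g -> g T = - g 0 ->
  ~ freely_nullhomotopic_in (zm_proj m k @` S) T (fun s => zm_proj m k (g s)).
Proof.
move=> m0 me kc Sc S0 Sphi T0 gc gT [H [Hc HS Hst Hend Hloop]].
apply: (no_antipodal_lift m0 me kc Sc S0 Sphi T0 Hc _ _ _ gc _ gT).
- by move=> [t s] [/= t1 s1]; exact: HS.
- by move=> s hs; apply: Hend; rewrite in_itv.
- by move=> t ht; apply: Hloop; rewrite in_itv.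
- by move=> s hs; apply: Hst; rewrite in_itv.
Qed.

(** * Closed Reeb orbits *)

Section HamiltonianOrbit.
Variables (R : realType) (n : nat).

Lemma is_derive_time_scale (W : normedModType R) (z : R -> W) (a t : R) v :
  is_derive (a * t) 1 z v -> is_derive t 1 (fun s => z (a * s)) (a *: v).
Proof.
move=> dz; have [->|a0] := eqVneq a 0.
  rewrite scale0r (_ : (fun _ => _) = cst (z 0)); first exact: is_derive_cst.
  by apply/funext => s; rewrite mul0r.
have na0 : 0 < `|a| by rewrite normr_gt0.
apply: eps_is_derive => e e0.
have e1 : 0 < e / `|a| by rewrite divr_gt0.
have [r r0 hr] := is_derive_eps dz e1.
exists (r / `|a|); first by rewrite divr_gt0.
move=> h; rewrite ltr_pdivlMr // => hlt.
have := hr (a * h); rewrite normrM [`|a| * _]mulrC => /(_ hlt).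
by rewrite -mulrDr scalerA [h * a]mulrC mulrA mulrAC divfK ?gt_eqF.
Qed.

Lemma is_derive_time_shift (W : normedModType R) (z : R -> W) (t : R) v :
  is_derive t 1 z v -> is_derive (0 : R) 1 (fun s => z (t + s)) v.
Proof.
move=> dz; apply: eps_is_derive => e e0; have [r r0 hr] := is_derive_eps dz e0.
by exists r => // h /hr; rewrite add0r addr0.
Qed.

Lemma inner_has_gradient (u p : Cn R n) : has_gradient (inner u) p u.
Proof.
move=> e e0; exists 1 => // w _.
by rewrite innerDr [inner u p + _]addrC addrK subrr normr0 mulr_ge0 // ltW.
Qed.

Lemma is_derive0_cst_Cn (z : R -> Cn R n) :
  (forall t : R, is_derive t 1 z 0) -> forall s t, z s = z t.
Proof.
move=> dz s t; apply: inner_inj => w; rewrite ![inner _ w]innerC.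
apply: (@is_derive0_cst R (fun t => inner w (z t))) => x.
have := is_derive_comp_gradient (inner_has_gradient w (z x)) (dz x).
by rewrite inner0r.
Qed.

Variables (H : Cn R n -> R) (gr : Cn R n -> Cn R n) (c0 : R).
Hypothesis hH : hamiltonian H gr c0.

Lemma inner_sympl (u w : Cn R n) : inner u (sympl w w) = \sum_j (xc u j * yc w j - yc u j * xc w j).
Proof. by apply: eq_bigr => j _; rewrite /sympl /xc /yc /= !mxE; ring. Qed.

Lemma inner_sympl_self (u : Cn R n) : inner u (sympl u u) = 0.
Proof. by rewrite inner_sympl big1 // => j _; ring. Qed.

Lemma symplZ (a : R) (u : Cn R n) : sympl (a *: u) (a *: u) = a *: sympl u u.
Proof. by rewrite /sympl; congr pair; rewrite /= scalerN. Qed.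

(** [H] is constant along the limit curve; dividing by its square root puts the curve on level 1,
    and the 1-homogeneous [gr] preserves the equation. *)
Lemma antiperiodic_orbit : (0 < n)%N -> exists (g : R -> Cn R n) (T : R),
  [/\ 0 < T, forall t : R, is_derive t 1 g (sympl (gr (g t)) (gr (g t))),
      forall t, H (g t) = 1 & g T = - g 0].
Proof.
move=> n0; have [b hb] := discrete_orbit hH n0.
have [a ha] := choice hb; have [lam hlam] := choice ha.
have [z [l [dz zanti z01]]] : exists (z : R -> Cn R n) (l : R),
    [/\ forall t : R, is_derive t 1 z (l *: sympl (gr (z t)) (gr (z t))),
        forall t : R, z (t + 1) = - z t & `|z 0| = 1].
  by apply: (@euler_limit R n gr b (ham_continuous hH) a lam) => p;
    have [h1 h2 h3 h4 h5] := hlam p.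
have z0 : z 0 != 0 by rewrite -normr_eq0 z01 oner_eq0.
have l0 : l != 0.
  apply/eqP => l0; have : z 1 = - z 0 by rewrite -zanti add0r.
  have -> : z 1 = z 0.
    by apply: is_derive0_cst_Cn => t; have := dz t; rewrite l0 scale0r.
  move=> /eqP; rewrite -addr_eq0 -mulr2n -scaler_nat scaler_eq0 pnatr_eq0 /=.
  by rewrite (negbTE z0).
have Hz t : H (z t) = H (z 0).
  apply: (@is_derive0_cst R (H \o z)) => x.
  have := is_derive_comp_gradient (ham_gradient hH (z x)) (dz x).
  by rewrite innerZr inner_sympl_self mulr0.
have H0 : 0 < H (z 0) by exact: ham_gt0 hH _ z0.
pose c := Num.sqrt (H (z 0)); have c1 : 0 < c by rewrite sqrtr_gt0.
have cN0 : c^-1 != 0 by rewrite invr_eq0 gt_eqF.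
(* For negative [l] the curve runs backwards, and [z (-1) = - z 0] gives the same antipodal
   condition at time [|l|]. *)
exists (fun t => c^-1 *: z (l^-1 * t)), `|l|; split.
- by rewrite normr_gt0.
- move=> t; rewrite (ham_gradZ hH) // symplZ.
  have := is_deriveZ c^-1 (is_derive_time_scale (dz (l^-1 * t))).
  by rewrite [l^-1 *: _]scalerA mulVf // scale1r.
- move=> t; rewrite (ham_homogeneous hH) Hz exprVn /c (sqr_sqrtr (ltW H0)).
  by rewrite mulVf ?gt_eqF //.
- rewrite /= -scalerN mulr0; congr (_ *: _).
  have [lp|ln] := ltP 0 l.
    by rewrite (gtr0_norm lp) mulVf // -[1]add0r zanti.
  rewrite (ler0_norm ln) mulrN mulVf //.
  by apply: oppr_inj; rewrite -zanti addNr opprK.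
Qed.

End HamiltonianOrbit.

(** The Liouville form on this field is half of [inner (gr p) p], that is [H p = 1] by Euler. Its
    differential pairs the field with [w] to [- inner (gr p) w], which vanishes because [H] is
    constant along curves in [S]. *)
Lemma hamiltonian_reeb (R : realType) (n : nat) (S : set (Cn R n)) (H : Cn R n -> R)
    (gr : Cn R n -> Cn R n) (c0 : R) (g : R -> Cn R n) :
  hamiltonian H gr c0 -> (forall p, S p <-> H p = 1) ->
  (forall t : R, is_derive t 1 g (sympl (gr (g t)) (gr (g t)))) ->
  (forall t, H (g t) = 1) -> reeb_trajectory S g.
Proof.
move=> hH SH dg Hg t.
have Sg s : S (g s) by apply/SH.
have [dg1 dg2] := dg t.
split => //; split => //; rewrite dg2; set p := g t; split.
- have [d1 d2] := is_derive_time_shift (dg t).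
  by exists (fun s => g (t + s)); split => //; rewrite addr0.
- have := ham_euler hH p; rewrite Hg mulr1 innerC => e.
  rewrite /liouville (_ : \sum_(j < n) _ = 2) ?mulVf // -e /inner.
  by apply: eq_bigr => j _; rewrite /sympl /xc /yc /= !mxE; ring.
move=> w [y [yS y0 dy yw]].
have dy' : is_derive (0 : R) 1 y w by split.
have := is_derive_comp_gradient (ham_gradient hH (y 0)) dy'.
rewrite y0 (_ : H \o y = cst 1); last by apply/funext => s /=; apply/SH.
move=> [_]; rewrite derive_cst => e.
have -> : dliouville (sympl (gr p) (gr p)) w = - inner (gr p) w.
  rewrite /inner -sumrN; apply: eq_bigr => j _.
  by rewrite /sympl /xc /yc /= !mxE; ring.
by rewrite -e oppr0.
Qed.

Theorem theorem2 (R : realType) (n m : nat) (k : 'I_n -> int)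
    (Sigma : set (Cn R n)) :
  (2 <= n)%N -> (2 <= m)%N -> ~~ odd m ->
  (forall j, coprimez (k j) m%:Z) ->
  star_shaped_hypersurface Sigma -> compact Sigma -> connected Sigma ->
  phi m k @` Sigma = Sigma ->
  exists (g : R -> Cn R n) (T : R),
    [/\ 0 < T, reeb_trajectory Sigma g,
        zm_proj m k (g T) = zm_proj m k (g 0) &
        ~ freely_nullhomotopic_in (zm_proj m k @` Sigma) T (fun s => zm_proj m k (g s))].
Proof.
move=> n2 m2 me kc star Sc _ Sphi.
have m0 : (0 < m)%N by exact: ltnW.
have Sev p : Sigma p -> Sigma (- p) by exact: S_opp m0 me kc Sphi p.
have S0 : ~ Sigma 0 by have [D [_ _ _ _ [_ St]]] := star; exact: star_not0 St.
have [H [gr [c0 [hH SH]]]] := star_shaped_hamiltonian star Sc Sev.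
have [g [T [T0 dg Hg gT]]] := antiperiodic_orbit hH (ltnW n2).
exists g, T; split => //.
- exact: hamiltonian_reeb hH SH dg Hg.
- by rewrite gT (proj_opp m0 me kc).
apply: antipodal_not_nullhomotopic => //.
by move=> t; exact: is_derive_continuous (dg t).
Qed.
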